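(* Fix $T>0$. Suppose that $K\in L^1([0,T];\mathbb{R}^{d\times d})$ is completely monotone with $K(t_0)>0$ for some $t_0>0$. Let $L$ be the resolvent of the first kind of $K$, and let $Z$ and $\Gamma$ (with domain $D(\Gamma)$) be the operators defined in the context. Then the following hold. (a) For each $\eta\in[0,1]$, $Z$ defines a continuous linear operator $Z: C^{\eta}([0,T];\mathbb{R}^d)\to C^{\eta}_0([0,T];\mathbb{R}^d)$. (b) Suppose that $K\in C^1(\mathbb{R}_+;\mathbb{R}^{d\times d})$. Then $C([0,T];\mathbb{R}^d)\subset D(\Gamma)$, $\Gamma: C([0,T];\mathbb{R}^d)\to C([0,T];\mathbb{R}^d)$ is a continuous linear operator, and there exists a constant $C>0$ independent of $t\in[0,T]$ and $z\in C([0,T];\mathbb{R}^d)$ such that $$|\Gamma_t(z)|^2\le C|K(0)|^2|z_t|^2+C\left(\int_0^T|K'(r)|^2dr\right)\int_0^t|z_s|^2ds .$$ Moreover, for each $x\in C([0,T];\mathbb{R}^d)$ and each $z\in C([0,T];\mathbb{R}^d)$, $$\Gamma(Z(x))=x-x_0\quad\text{and}\quad Z(\Gamma(z))=z-L([0,t])z_0,$$ where the second identity means $Z_t(\Gamma(z))=z_t-L([0,t])z_0$ for $t\in[0,T]$. (c) Suppose there exists $\alpha\in(1/2,1]$ with $$\sup_{t\in(0,T]}\left(t^{1-\alpha}|K(t)|+t^{2-\alpha}|K'(t)|\right)<\infty .$$ Let $\eta\in(1-\alpha,1]$. Then $C_0^{\eta}([0,T];\mathbb{R}^d)\subset D(\Gamma)$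 and $\Gamma: C_0^{\eta}([0,T];\mathbb{R}^d)\to C_0([0,T];\mathbb{R}^d)$ is a continuous linear operator. Moreover, for each $x\in C([0,T];\mathbb{R}^d)$ satisfying $Z(x)\in C_0^{\eta}([0,T];\mathbb{R}^d)$, and each $z\in C_0^{\eta}([0,T];\mathbb{R}^d)$, $$\Gamma(Z(x))=x-x_0\quad\text{and}\quad Z(\Gamma(z))=z .$$ (d) If, in addition to the condition on $K$ and $K'$ in (c) (with $\alpha$ and $\eta$ as there), $\sup_{t\in(0,T]}t^{3-\alpha}|K''(t)|<\infty$, then $\Gamma: C_0^{\eta}([0,T];\mathbb{R}^d)\to C_0^{\eta+\alpha-1}([0,T];\mathbb{R}^d)$ is a continuous linear operator.
   Context: $\mathbb{R}_+=[0,\infty)$. For $A\in\mathbb{R}^{d\times d}$, $A\ge0$ means $\bar v^{\top}Av\ge0$ for all $v\in\mathbb{C}^d$, and $A>0$ means $\bar v^{\top}Av>0$ for all $v\in\mathbb{C}^d\setminus\{0\}$. A kernel $K\in L^1_{loc}(\mathbb{R}_+;\mathbb{R}^{d\times d})$ is completely monotone if it is $C^\infty$ on $(0,\infty)$ and $(-1)^nK^{(n)}(t)\ge0$ for all $t>0$, $n\in\mathbb{N}_0$. The resolvent of the first kind of $K$ is the unique $\mathbb{R}^{d\times d}$-valued measure $L$ on $\mathbb{R}_+$ of locally bounded variation with $\int_{[0,t]}K(t-s)L(ds)=\int_{[0,t]}L(ds)K(t-s)=I_d$ (the identity matrix) for all $t>0$; it exists when $K$ is completely monotone with $K(t_0)>0$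 for some $t_0>0$. $C^{\eta}([0,T];\mathbb{R}^d)$, $\eta\in[0,1]$, is the space of $\eta$-Hölder continuous functions with its usual norm (with $C^0=C$, the continuous functions with the sup norm). $C_0^{\eta}$ and $C_0$ denote the subspaces of functions vanishing at $0$. Define $$Z_t(x)=\int_{[0,t]}L(ds)(x_{t-s}-x_0),\qquad x\in C([0,T];\mathbb{R}^d),$$ $$\Gamma_t(z)=K(t)z_t+\int_0^tK'(t-s)(z_s-z_t)\,ds,\qquad z\in D(\Gamma),$$ where $D(\Gamma)$ is the set of $z\in C([0,T];\mathbb{R}^d)$ with $\int_0^T|K(t)z_t|dt+\int_0^T\int_0^t|K'(t-s)||z_s-z_t|\,ds\,dt<\infty$. Then $\Gamma(z)$ is a well-defined element of $L^1([0,T];\mathbb{R}^d)$.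
   Formalization: In (b) the second identity is corrected to Z_t(Γ(z)) = z_t − L([0,t])K(0)z_0; as printed, without K(0), it fails for d=1, K≡2, L=δ_0/2, z≡1, where the left side is 0 and the right side is 1/2. *)

(* Defs.v *)
From HB Require Import structures.
From mathcomp Require Export all_boot all_order all_algebra.
From mathcomp Require Export all_classical all_reals all_analysis.
From mathcomp Require Export complex.

Set Implicit Arguments.
Unset Strict Implicit.
Unset Printing Implicit Defensive.

Export Order.TTheory GRing.Theory Num.Theory numFieldNormedType.Exports.

#[global] Open Scope ring_scope.
#[global] Open Scope classical_set_scope.

(* Conventions.  Functions on R_+, on (0, oo) or on [0, T] are total functions
   on R; their values outside the stated domain are never used.  The norm
   `|_| on vectors and matrices is the one of the library (largest absolute
   value of an entry); all norms being equivalent in finite dimension, none of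
   the statements below depends on that choice.                              *)

Section definitions.
Variables (R : realType) (d : nat).

Local Notation leb := (@lebesgue_measure R).
Local Notation vec := 'cV[R]_d.
Local Notation mat := 'M[R]_d.

(* The order of R[i] makes 0 <= z and 0 < z include that z is real; as v ranges
   over complex vectors, mx_ge0 A therefore entails that A is symmetric.      *)
Definition cquad (A : mat) (v : 'cV[R[i]]_d) : R[i] :=
  ((map_mx conjc v)^T *m map_mx (real_complex R) A *m v) ord0 ord0.

Definition mx_ge0 (A : mat) : Prop := forall v, 0 <= cquad A v.

Definition mx_gt0 (A : mat) : Prop := forall v, v != 0 -> 0 < cquad A v.

Definition integrable_mx (D : set R) (K : R -> mat) : Prop :=
  forall i j, leb.-integrable D (fun t => (K t i j)%:E).

Definition completely_monotone (K : R -> mat) : Prop :=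
  [/\ forall S : R, integrable_mx `[0, S] K,
      forall (n : nat) (t : R), 0 < t -> derivable (derive1n n K) t 1 &
      forall (n : nat) (t : R), 0 < t -> mx_ge0 ((-1) ^+ n *: derive1n n K t)].

(* Continuously differentiable on [0, oo), with a one-sided derivative at 0;
   in particular the value K 0 is then the limit of K at 0.                   *)
Definition C1_Rplus (K : R -> mat) : Prop :=
  exists2 K1 : R -> mat, {within `[0, +oo[, continuous K1} &
    forall t : R, 0 <= t ->
      (fun s => (s - t)^-1 *: (K s - K t)) @ within `[0, +oo[ t^' --> K1 t.

(* A real-valued measure on R_+ of locally bounded variation, given by its
   Jordan decomposition: two mutually singular positive measures, finite on
   each [0, t].  It is in general not a charge of the library, since its total
   variation on R_+ may be infinite.                                          *)
Record lbv_measure := LbvMeasure {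
  lbv_pos : {measure set (measurableTypeR R) -> \bar R} ;
  lbv_neg : {measure set (measurableTypeR R) -> \bar R} ;
  lbv_pos_supp : lbv_pos `]-oo, 0[ = 0%E ;
  lbv_neg_supp : lbv_neg `]-oo, 0[ = 0%E ;
  lbv_pos_fin : forall t : R, (lbv_pos `[0%R, t] < +oo)%E ;
  lbv_neg_fin : forall t : R, (lbv_neg `[0%R, t] < +oo)%E ;
  lbv_singular : exists A : set (measurableTypeR R),
    [/\ measurable A, lbv_pos (~` A) = 0%E & lbv_neg A = 0%E] }.

Definition lbv_integrable (nu : lbv_measure) (D : set R) (f : R -> R) : Prop :=
  (lbv_pos nu).-integrable D (EFin \o f) /\
  (lbv_neg nu).-integrable D (EFin \o f).

Definition lbv_integral (nu : lbv_measure) (D : set R) (f : R -> R) : R :=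
  \int[lbv_pos nu]_(s in D) f s - \int[lbv_neg nu]_(s in D) f s.

Definition mx_measure := 'I_d -> 'I_d -> lbv_measure.

Definition mxm_val (L : mx_measure) (D : set R) : mat :=
  \matrix_(i, j) (fine (lbv_pos (L i j) D) - fine (lbv_neg (L i j) D)).

(* \int_D K(s) L(ds), \int_D L(ds) K(s) and \int_D L(ds) x(s). *)
Definition int_mulm (L : mx_measure) (D : set R) (K : R -> mat) : mat :=
  \matrix_(i, j) \sum_k lbv_integral (L k j) D (fun s => K s i k).

Definition int_mmul (L : mx_measure) (D : set R) (K : R -> mat) : mat :=
  \matrix_(i, j) \sum_k lbv_integral (L i k) D (fun s => K s k j).

Definition int_mvec (L : mx_measure) (D : set R) (x : R -> vec) : vec :=
  \col_i \sum_k lbv_integral (L i k) D (fun s => x s k ord0).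

Definition resolvent_first_kind (K : R -> mat) (L : mx_measure) : Prop :=
  forall t : R, 0 < t ->
  [/\ forall i j k,
        lbv_integrable (L k j) `[0, t] (fun s => K (t - s) i k) /\
        lbv_integrable (L i k) `[0, t] (fun s => K (t - s) k j),
      int_mulm L `[0, t] (fun s => K (t - s)) = 1%:M &
      int_mmul L `[0, t] (fun s => K (t - s)) = 1%:M].

Definition C_space (T : R) : set (R -> vec) :=
  [set x | {within `[0, T], continuous x}].

Definition sup_norm (T : R) (x : R -> vec) : \bar R :=
  ereal_sup [set `|x t|%:E | t in `[0, T]].

Definition holder_seminorm (T eta : R) (x : R -> vec) : \bar R :=
  ereal_sup [set (`|x p.1 - x p.2| / `|p.1 - p.2| `^ eta)%:E |
             p in [set p : R * R | [/\ 0 <= p.1 <= T, 0 <= p.2 <= T &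
                                       p.1 != p.2]]].

Definition holder_norm (T eta : R) (x : R -> vec) : \bar R :=
  if eta == 0 then sup_norm T x
  else (sup_norm T x + holder_seminorm T eta x)%E.

Definition holder_space (T eta : R) : set (R -> vec) :=
  [set x | C_space T x /\ (holder_norm T eta x < +oo)%E].

Definition C0_space (T : R) : set (R -> vec) :=
  C_space T `&` [set x | x 0 = 0].

Definition holder0_space (T eta : R) : set (R -> vec) :=
  holder_space T eta `&` [set x | x 0 = 0].

(* F, restricted to the space U of functions on [0, T] normed by nU, is a
   continuous linear operator into the space V normed by nV.                  *)
Definition continuous_linear_operator (T : R)
    (U : set (R -> vec)) (nU : (R -> vec) -> \bar R)
    (V : set (R -> vec)) (nV : (R -> vec) -> \bar R)
    (F : (R -> vec) -> R -> vec) : Prop :=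
  [/\ forall x, U x -> V (F x),
      forall (a : R) x y, U x -> U y -> forall t, 0 <= t <= T ->
        F (fun s => a *: x s + y s) t = a *: F x t + F y t &
      forall x, U x -> forall e : R, 0 < e -> exists2 delta : R, 0 < delta &
        forall y, U y -> (nU (fun t => y t - x t)%R < delta%:E)%E ->
          (nV (fun t => F y t - F x t)%R < e%:E)%E].

Definition Zop (L : mx_measure) (x : R -> vec) (t : R) : vec :=
  int_mvec L `[0, t] (fun s => x (t - s) - x 0).

(* derive1 K is K'. *)
Definition Gammaop (K : R -> mat) (z : R -> vec) (t : R) : vec :=
  K t *m z t +
  \col_i \int[leb]_(s in `[0, t]) (derive1 K (t - s) *m (z s - z t)) i ord0.

Definition Gamma_dom (K : R -> mat) (T : R) : set (R -> vec) :=
  [set z | C_space T z /\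
    (\int[leb]_(t in `[0%R, T]) `|K t *m z t|%:E +
     \int[leb]_(t in `[0%R, T]) \int[leb]_(s in `[0%R, t])
       (`|derive1 K (t - s)| * `|z s - z t|)%:E < +oo)%E].

End definitions.

(* Main.v *)
Require Import Defs.
From mathcomp Require Import measurable_realfun lra ring.

(** Entry by entry, Gamma and Z become scalar convolutions.  For y vanishing
    at 0 and prolonged by 0 to the left,
      Gamma_t(y) = K(T) y_t + int_0^T K'(u) (y_{t-u} - y_t) du
    ([sGamma_fullE]), and, with y = x - x_0,
      Z_t(x) = int_[0,T] L(ds) y_{t-s}
    ([lconv_fullE]): in both formulas the time t has left the domain of
    integration, so that increments in t are increments of y.

    For Z the increments are bounded by those of y times the total variation of
    L on [0, T] ([lconv_modulus]), which is part (a).  For Gamma, with h the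
    distance of the two times ([sGamma_modulus]), the integral over u < h is at
    most C h^(eta+alpha-1), because the integrand is O(u^(eta+alpha-2)), and on
    u > h the increments of y, of order h^eta, are multiplied by the integral of
    |K'| over [h, T].  That integral is O(h^(alpha-1))
    ([variation_kernel_le]): -K' is positive semidefinite, so its entries are
    dominated by its trace, which integrates to tr K(h) - tr K(T).  This gives
    the continuity of Gamma in (c) and (d).

    The inverse relations come from
      int_0^t Gamma_s(y) ds = (K * y)_t                [sGamma_primitive],
    that is, Gamma is the derivative of the convolution with K.  With K'
    replaced by its restriction to u > delta this is Fubini's theorem
    ([conv_assoc], [Rintegral_conv_primitive]); the errors are of order
    delta^(eta+alpha-1) and delta^alpha.  As L * K = K * L = I and convolution
    is associative, the primitive of Gamma(Z(x)) is K * (L * (x - x_0)), which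
    is the primitive of x - x_0, and the primitive of Z(Gamma(z)) is
    L * (K * z), which is the primitive of z; all these functions are
    continuous, so that they are equal as soon as their primitives are
    ([ucont_on_eq0]).

    In (b), K' is bounded near 0, every continuous y with y_0 = 0 can be treated
    as above with eta+alpha-1 replaced by 1, and
      Gamma_t(z) = K(0) z_t + (K' * z)_t,
    from which the sup and L^2 bounds follow ([conv_cauchy_schwarz]).  For
    z_0 <> 0 one writes z = y + z_0: then Gamma(z) = Gamma(y) + K z_0, and
    Z(K z_0) is computed from L * K = I for t > 0, and at t = 0 by right
    continuity of t |-> L([0, t]) ([Zop_kernel0]). *)

Set Implicit Arguments.
Unset Strict Implicit.
Unset Printing Implicit Defensive.

(** * Reflection of a segment and integrability *)

Section reflection.
Variable R : realType.
Local Notation leb := (@lebesgue_measure R).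
Implicit Types (t : R) (f : R -> R).

Lemma measurable_rev t : measurable_fun [set: measurableTypeR R]
  (fun s : measurableTypeR R => t - s : measurableTypeR R).
Proof. exact: measurable_funB. Qed.

Lemma lebesgue_measure_rev t (A : set R) : measurable A ->
  pushforward leb (fun s : measurableTypeR R => t - s : measurableTypeR R) A = leb A.
Proof.
move=> mA.
have mphi := measurable_rev t.
apply/esym/lebesgue_measure_unique => //= _ [[a b]] _ <-.
rewrite /pushforward.
have -> : (fun s : R => t - s) @^-1` `]a, b]%classic = `[t - b, t - a[%classic.
  by apply/seteqP; split => s /=; rewrite !in_itv/= => /andP[? ?]; apply/andP; split; lra.
rewrite !lebesgue_measure_itv/= !lte_fin ltrD2l ltrN2.
by case: ifPn => // _; rewrite -!EFinB; congr EFin; lra.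
Qed.

Lemma rev_preimage t :
  (fun s : R => t - s) @^-1` `[0, t]%classic = `[0, t]%classic.
Proof.
by apply/seteqP; split => s /=; rewrite !in_itv/= => /andP[? ?]; apply/andP; split; lra.
Qed.

Lemma rev_itv t s : `[0, t]%classic s -> `[0, t]%classic (t - s).
Proof. by rewrite /= !in_itv/= => /andP[? ?]; apply/andP; split; lra. Qed.

Lemma integrable_rev t f : leb.-integrable `[0, t] (EFin \o f) ->
  leb.-integrable `[0, t] (EFin \o (fun s => f (t - s))).
Proof.
move=> fi; have mphi := measurable_rev t.
have mf := measurable_int _ fi.
apply/integrableP; split.
  apply: (measurable_comp (F := `[0, t]%classic) (f := EFin \o f)) => //.
    by move=> _ /= [s st <-]; apply: rev_itv.
  exact: measurable_funS mphi.
have := @ge0_integral_pushforward _ _ _ _ R _ mphi leb `[0, t]%classic (fun s => `|(f s)%:E|%E).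
rewrite rev_preimage => <- //.
  rewrite (eq_measure_integral leb).
    by move/integrableP : fi => [].
  by move=> A mA _; exact: lebesgue_measure_rev.
by apply: measurableT_comp.
Qed.

Lemma Rintegral_rev t f : leb.-integrable `[0, t] (EFin \o f) ->
  \int[leb]_(s in `[0, t]) f (t - s) = \int[leb]_(s in `[0, t]) f s.
Proof.
move=> fi; have mphi := measurable_rev t.
have mf := measurable_int _ fi.
have fri := integrable_rev fi.
rewrite /Rintegral; congr fine.
pose g := (EFin \o f) \_ `[0, t].
transitivity (\int[leb]_(s in `[0%R, t]) (g (t - s)%R))%E.
  apply: eq_integral => s /set_mem/rev_itv/mem_set st.
  by rewrite /g patchE st.
transitivity (\int[leb]_(s in `[0%R, t]) g s)%E; last first.
  by apply: eq_integral => s st; rewrite /g patchE st.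
have mg : measurable_fun [set: measurableTypeR R] (g : measurableTypeR R -> \bar R).
  exact/(measurable_restrictT _ _).1.
have := @integral_pushforward _ _ _ _ R _ mphi leb `[0, t]%classic g mg.
rewrite rev_preimage => <- //.
- by apply: eq_measure_integral => A mA _; exact: lebesgue_measure_rev.
- apply: (eq_integrable _ _ _ _ fri) => //= s /set_mem/rev_itv/mem_set st.
  by rewrite /g patchE st.
Qed.

End reflection.

Section integration_tools.
Variable R : realType.
Local Notation X := (measurableTypeR R).
Variable mu : {measure set X -> \bar R}.
Implicit Types (D : set X) (f g : X -> R) (M : R).

Lemma integrable_bounded D f M : measurable D -> (mu D < +oo)%E ->
  measurable_fun D f -> (forall s, D s -> `|f s| <= M) ->
  mu.-integrable D (EFin \o f).
Proof.
move=> mD fD mf fM; apply: measurable_bounded_integrable => //.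
exists M; split; first exact: num_real.
by move=> N MN s Ds /=; rewrite (le_trans (fM _ Ds))// ltW.
Qed.

Lemma integrableR_eq D f g : measurable D -> (forall s, D s -> f s = g s) ->
  mu.-integrable D (EFin \o f) -> mu.-integrable D (EFin \o g).
Proof.
by move=> mD fg; apply: eq_integrable => // s /set_mem Ds; rewrite /= fg.
Qed.

Lemma integrableRZ D f c : measurable D -> mu.-integrable D (EFin \o f) ->
  mu.-integrable D (EFin \o (fun s => c * f s)).
Proof. by move=> mD fi; exact: (integrableZl mD c fi). Qed.

Lemma integrableRD D f g : measurable D -> mu.-integrable D (EFin \o f) ->
  mu.-integrable D (EFin \o g) -> mu.-integrable D (EFin \o (fun s => f s + g s)).
Proof. by move=> mD fi gi; exact: (integrableD mD fi gi). Qed.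

Lemma integrableRB D f g : measurable D -> mu.-integrable D (EFin \o f) ->
  mu.-integrable D (EFin \o g) -> mu.-integrable D (EFin \o (fun s => f s - g s)).
Proof. by move=> mD fi gi; exact: (integrableB mD fi gi). Qed.

Lemma integrable_measurable D f : mu.-integrable D (EFin \o f) -> measurable_fun D f.
Proof. by move=> fi; apply/measurable_EFinP; exact: measurable_int fi. Qed.

Lemma integrable_dominated D f g : measurable D -> measurable_fun D f ->
  (forall s, D s -> `|f s| <= g s) -> mu.-integrable D (EFin \o g) ->
  mu.-integrable D (EFin \o f).
Proof.
move=> mD mf fg gi; apply: (le_integrable mD _ _ gi).
  exact/measurable_EFinP.
move=> s Ds /=; rewrite lee_fin (le_trans (fg _ Ds))// ler_norm//.
Qed.

Lemma normr_Rintegral_le D f g : measurable D -> measurable_fun D f ->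
  (forall s, D s -> `|f s| <= g s) -> mu.-integrable D (EFin \o g) ->
  `|\int[mu]_(s in D) f s| <= \int[mu]_(s in D) g s.
Proof.
move=> mD mf fg gi; have fi := integrable_dominated mD mf fg gi.
rewrite (le_trans (le_normr_Rintegral mD fi))//.
apply: le_Rintegral => //.
have := integrable_norm fi; exact.
Qed.

Lemma normr_Rintegral_le_cst D f M : measurable D -> (mu D < +oo)%E ->
  measurable_fun D f -> (forall s, D s -> `|f s| <= M) ->
  `|\int[mu]_(s in D) f s| <= M * fine (mu D).
Proof.
move=> mD fD mf fM; rewrite -Rintegral_cst//.
apply: normr_Rintegral_le => //.
apply: (@integrable_bounded _ _ `|M|) => //.
Qed.

Lemma integrable_mulr_bounded D f g M : measurable D -> measurable_fun D f ->
  (forall s, D s -> `|f s| <= M) -> mu.-integrable D (EFin \o g) ->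
  mu.-integrable D (EFin \o (fun s => f s * g s)).
Proof.
move=> mD mf fM gi.
have mg := integrable_measurable gi.
apply: (@integrable_dominated _ _ (fun s => M * `|g s|)) => //.
- exact: measurable_funM.
- by move=> s Ds; rewrite normrM ler_wpM2r// fM.
- by apply: integrableRZ => //; exact: integrable_norm.
Qed.

Lemma integrableR_sum (I : Type) (r : seq I) D (f : I -> X -> R) : measurable D ->
  (forall i, mu.-integrable D (EFin \o f i)) ->
  mu.-integrable D (EFin \o (fun s => \sum_(i <- r) f i s)).
Proof.
move=> mD fi; apply: (eq_integrable mD (fun s => \sum_(j <- r) (f j s)%:E)%E) => //.
  by move=> s _ /=; rewrite sumEFin.
by apply: (integrable_sum mD r (P := xpredT)) => j _; exact: fi.
Qed.

Lemma Rintegral_sum (I : Type) (r : seq I) D (f : I -> X -> R) : measurable D ->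
  (forall i, mu.-integrable D (EFin \o f i)) ->
  \int[mu]_(s in D) (\sum_(i <- r) f i s) = \sum_(i <- r) \int[mu]_(s in D) f i s.
Proof.
move=> mD fi; elim: r => [|i r ih].
  rewrite big_nil; under eq_Rintegral do rewrite big_nil.
  by rewrite Rintegral_cst// mul0r.
rewrite big_cons -ih -RintegralD//.
  by apply: eq_Rintegral => s _; rewrite big_cons.
exact: integrableR_sum.
Qed.

End integration_tools.

Section nonmeasurable_bound.
Context d (X : measurableType d) (R : realType).
Variable mu : {measure set X -> \bar R}.
Local Open Scope ereal_scope.

(** Monotonicity without measurability: the inner integral in the definition
    of the domain of Gamma is not known to be a measurable function of t. *)
Lemma ge0_integral_le (D : set X) (f g : X -> \bar R) :
  (forall x, D x -> 0 <= f x) -> (forall x, D x -> f x <= g x) ->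
  \int[mu]_(x in D) f x <= \int[mu]_(x in D) g x.
Proof.
move=> f0 fg; rewrite (integral_mkcond D f) (integral_mkcond D g).
have f0' x : 0 <= (f \_ D) x by apply: erestrict_ge0.
have fg' x : (f \_ D) x <= (g \_ D) x.
  by rewrite !patchE; case: ifPn => // /set_mem; exact: fg.
rewrite !ge0_integralTE//; last by move=> x; exact: le_trans (fg' x).
apply: ereal_sup_le => _ [h hf <-].
by exists h => // x; exact: le_trans (hf x) (fg' x).
Qed.

End nonmeasurable_bound.

Section restricted_measure.
Context d (X : measurableType d) (R : realType).
Variable mu : {measure set X -> \bar R}.
Variables (D : set X) (mD : measurable D) (Doo : (mu D < +oo)%E).
Local Open Scope ereal_scope.

(** The Fubini theorem asks for sigma-finite measures; a measure finite on
    [0, t] is replaced by its restriction, which is a finite measure. *)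
Lemma integral_mfrestr (E : set X) (f : X -> \bar R) : E `<=` D ->
  \int[mfrestr mD Doo]_(x in E) f x = \int[mu]_(x in E) f x.
Proof.
move=> ED; apply: eq_measure_integral => A mA AE.
by rewrite /= /mfrestr/= /mrestr/= setIidl//; exact: subset_trans ED.
Qed.

Lemma integrable_mfrestr (E : set X) (f : X -> \bar R) : E `<=` D ->
  (mfrestr mD Doo).-integrable E f <-> mu.-integrable E f.
Proof.
by move=> ED; split=> /integrableP[mf fi]; apply/integrableP; split => //;
  [rewrite -integral_mfrestr|rewrite integral_mfrestr].
Qed.

End restricted_measure.

Section measurable_fubini.
Context d1 d2 (T1 : measurableType d1) (T2 : measurableType d2) (R : realType).
Variable m1 : {sigma_finite_measure set T1 -> \bar R}.
Local Open Scope ereal_scope.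

(** The signed version of the measurability part of Tonelli's theorem,
    obtained from the positive and the negative part. *)
Lemma measurable_integral1 (f : T1 * T2 -> \bar R) : measurable_fun setT f ->
  measurable_fun setT (fun y => \int[m1]_x f (x, y)).
Proof.
move=> mf.
have -> : (fun y => \int[m1]_x f (x, y)) =
  (fun y => \int[m1]_x f^\+ (x, y)) \- (fun y => \int[m1]_x f^\- (x, y)).
  apply/funext => y; rewrite [LHS]integralE.
  under eq_integral do rewrite funepos_comp/=.
  by under [X in _ - X = _]eq_integral do rewrite funeneg_comp/=.
apply: emeasurable_funB.
  apply: (measurable_fun_fubini_tonelli_G (f^\+)) => //; exact: measurable_funepos.
apply: (measurable_fun_fubini_tonelli_G (f^\-)) => //; exact: measurable_funeneg.
Qed.

End measurable_fubini.

(** * Associativity of the convolution with a measure *)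

Section convolution.
Variable R : realType.
Local Notation leb := (@lebesgue_measure R).
Local Notation measure_on_R := {measure set (measurableTypeR R) -> \bar R}.
Implicit Types (mu : measure_on_R) (a b : R -> R) (t : R).

Definition conv a b t := \int[leb]_(s in `[0, t]) (a (t - s) * b s).

Definition mconv mu a t := \int[mu]_(s in `[0, t]) a (t - s).

(** Truncating both factors to [0, t] turns the triangle s <= t - r of the
    iterated convolution into a product domain. *)
Lemma restrict_triangle a b t r s : `[0, t]%classic r ->
  (a \_ `[0, t]) (t - r - s) * (b \_ `[0, t]) s =
  ((fun s => a (t - r - s) * b s) \_ `[0, t - r]) s.
Proof.
rewrite /= in_itv/= => /andP[r0 rt]; rewrite !patchE.
have [/set_mem/=|/negP h] := boolP (s \in `[0, t - r]%classic).
  rewrite in_itv/= => /andP[s0 st].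
  by rewrite !mem_set//= in_itv/=; apply/andP; split; lra.
case: ifPn; last by rewrite mul0r.
case: ifPn; last by rewrite mulr0.
rewrite !inE/= !in_itv/= => /andP[s0 st] /andP[h1 h2].
by exfalso; apply: h; rewrite inE/= in_itv/=; apply/andP; split; lra.
Qed.

(** Fubini's theorem for a(t - r - s) b(s) on the triangle.  The function
    a * mu is only known to exist almost everywhere, so that the equality of
    the inner integrals is an almost sure one; a uniform bound of the
    integrals over s is what makes the double integral finite. *)
Lemma conv_assoc mu t a b (M : R) : 0 <= t -> (mu `[0%R, t] < +oo)%E ->
  measurable_fun `[0, t] a -> measurable_fun `[0, t] b ->
  (forall r, `[0, t]%classic r ->
    (\int[leb]_(s in `[0%R, (t - r)%R]) `|(a (t - r - s) * b s)%:E| <= M%:E)%E) ->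
  [/\ mu.-integrable `[0, t] (EFin \o (fun r => conv a b (t - r))),
      leb.-integrable `[0, t] (EFin \o (fun s => mconv mu a (t - s) * b s)) &
      mconv mu (conv a b) t = conv (mconv mu a) b t].
Proof.
move=> t0 muoo ma mb abM.
have mD : measurable (`[0, t]%classic : set (measurableTypeR R)) by [].
(* F is the integrand, A its factor that does not contain b; F = b(s) A makes
   the inner integral over r proportional to a * mu. *)
pose nu := mfrestr mD muoo.
pose a0 := a \_ `[0, t]; pose b0 := b \_ `[0, t].
pose F (p : measurableTypeR R * measurableTypeR R) : \bar R :=
  (\1_`[0, t] p.1 * (a0 (t - p.1 - p.2) * b0 p.2))%:E.
pose A (p : measurableTypeR R * measurableTypeR R) : \bar R :=
  (\1_`[0, t] p.1 * (a0 (t - p.1 - p.2)))%:E.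
have ma0 : measurable_fun [set: measurableTypeR R] (a0 : measurableTypeR R -> R).
  exact/(measurable_restrictT _ _).1.
have mb0 : measurable_fun [set: measurableTypeR R] (b0 : measurableTypeR R -> R).
  exact/(measurable_restrictT _ _).1.
have mind : measurable_fun [set: measurableTypeR R * measurableTypeR R]
    (fun p => \1_`[0, t] p.1 : R).
  by apply: measurableT_comp.
have ma1 : measurable_fun [set: measurableTypeR R * measurableTypeR R]
    (fun p => a0 (t - p.1 - p.2)).
  apply: (measurableT_comp ma0).
  by apply: measurable_funB => //; apply: measurable_funB.
have mA : measurable_fun setT A.
  by apply/measurable_EFinP; apply: measurable_funM.
have mF : measurable_fun setT F.
  apply/measurable_EFinP; apply: measurable_funM => //; apply: measurable_funM => //.
  exact: (measurableT_comp mb0).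
have Fr r : `[0, t]%classic r -> (fun s => F (r, s)) =
    (EFin \o (fun s => a (t - r - s) * b s)) \_ `[0, t - r].
  move=> rt; apply/funext => s; rewrite /F/= indicE mem_set// mul1r.
  by rewrite restrict_triangle// restrict_EFin.
have Fr0 r s : ~ `[0, t]%classic r -> F (r, s) = 0%E.
  by move=> rt; rewrite /F/= indicE memNset// mul0r.
have intF : ((nu \x leb)%E).-integrable setT F.
  apply/integrable12ltyP => //.
  apply: (@le_lt_trans _ _ (\int[nu]_(r in `[0%R, t]) M%:E)%E).
    rewrite [leRHS]integral_mkcond; apply: ge0_integral_le => r _.
      exact: integral_ge0.
    rewrite patchE; case: ifPn => [/set_mem rt|/negP rt].
      apply: le_trans (abM _ rt); rewrite [leRHS]integral_mkcond.
      have -> : (fun s => `|F (r, s)|)%E = (abse \o (fun s => F (r, s)))%E by [].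
      rewrite Fr// ; apply: ge0_integral_le => s _ //=.
      by rewrite !patchE; case: ifPn; rewrite ?abse0.
    rewrite (eq_integral (cst 0%E)) ?integral0//.
    by move=> s _; rewrite Fr0 ?abse0// => /mem_set.
  rewrite integral_cst//= lte_mul_pinfty//.
    apply: le_trans (abM 0 _); first exact: integral_ge0.
    by rewrite /= in_itv/= lexx t0.
  by rewrite /= /mfrestr/= /mrestr/= setIid.
have convE r : `[0, t]%classic r -> (conv a b (t - r))%:E = (\int[leb]_s F (r, s))%E.
  move=> rt; rewrite /conv /Rintegral fineK.
    by rewrite integral_mkcond -Fr.
  rewrite fin_num_abs (le_lt_trans _ (ltry M))//.
  apply: le_trans (abM _ rt); apply: le_abse_integral => //.
  apply/(measurable_restrictT _ _).2 => //; rewrite -Fr//.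
  exact: (measurableT_comp mF).
have iF : nu.-integrable setT (fun r => \int[leb]_s F (r, s))%E.
  exact: (integrable_fubini_F intF).
have iconv : mu.-integrable `[0, t] (EFin \o (fun r => conv a b (t - r))).
  apply: (@integrable_mfrestr _ _ _ _ _ mD muoo _ _ _).1 => //.
  apply: (eq_integrable mD (fun r => \int[leb]_s F (r, s))%E).
    by move=> r /set_mem rt; rewrite /= convE.
  exact: integrableS iF.
have iG : leb.-integrable setT (fun s => \int[nu]_r F (r, s))%E.
  apply/integrableP; split; first exact: measurable_integral1.
  apply: le_lt_trans ((integrable21ltyP _ _ mF).1 intF).
  apply: ge0_integral_le => // s _; apply: le_abse_integral => //.
  exact: (measurableT_comp mF).
have mcE s : `[0, t]%classic s -> mconv mu a (t - s) = fine (\int[nu]_r A (r, s))%E.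
  move=> /= /[dup] st; rewrite in_itv/= => /andP[s0 st'].
  have sD : `[0, t - s]%classic `<=` `[0, t]%classic.
    by apply: subset_itvl; rewrite bnd_simp; lra.
  rewrite /mconv/Rintegral; congr fine.
  rewrite -(integral_mfrestr mD muoo)// [LHS]integral_mkcond.
  apply: eq_integral => r _; rewrite /A/= /a0 !patchE indicE.
  case: ifPn => [/set_mem/= rt|/negP rt].
    rewrite mem_set/=; last exact: sD.
    rewrite mul1r mem_set/=; first by congr EFin; congr a; lra.
    by move: rt; rewrite !in_itv/= => /andP[? ?]; apply/andP; split; lra.
  have [/set_mem/= rt'|_] := boolP (r \in `[0, t]%classic); last by rewrite mul0r.
  rewrite mul1r ifN//; apply/negP; rewrite inE/= in_itv/= => /andP[h1 h2].
  apply: rt; rewrite inE/= in_itv/=.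
  by move: rt'; rewrite in_itv/= => /andP[-> _]/=; lra.
have mmc : measurable_fun `[0, t] (fun s => mconv mu a (t - s) * b s).
  apply: measurable_funM => //.
  apply: (eq_measurable_fun (fun s => fine (\int[nu]_r A (r, s))%E)).
    by move=> s /set_mem st; rewrite mcE.
  apply: measurable_funTS; apply: measurableT_comp => //.
  exact: measurable_integral1.
have GE : ae_eq leb `[0, t] (EFin \o (fun s => mconv mu a (t - s) * b s))
    (fun s => \int[nu]_r F (r, s))%E.
  have := ae_integrable2 intF; apply: filterS => s iFs st /=.
  have FA r : F (r, s) = ((b s)%:E * A (r, s))%E.
    by rewrite /F/A/= -EFinM /b0 patchE mem_set//; congr EFin; ring.
  (* Where b(s) = 0, A(., s) may fail to be integrable, but F(., s) is 0. *)
  have [bs0|bs0] := eqVneq (b s) 0.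
    rewrite bs0 mulr0 (eq_integral (cst 0%E)) ?integral0// => r _.
    by rewrite FA bs0 mul0e.
  have iA : nu.-integrable setT (fun r => A (r, s)).
    apply: (eq_integrable measurableT (fun r => ((b s)^-1)%:E * F (r, s))%E).
      have b1 : (((b s)^-1)%:E * (b s)%:E = 1)%E by rewrite -EFinM mulVf.
      by move=> r _; rewrite FA muleA b1 mul1e.
    exact: integrableZl.
  under eq_integral do rewrite FA.
  rewrite integralZl// mcE// mulrC EFinM fineK//.
  exact: integrable_fin_num.
have mG := measurable_int _ iG.
split => //.
  apply/integrableP; split; first exact/measurable_EFinP.
  rewrite (ae_eq_integral (fun s => `|\int[nu]_r F (r, s)|)%E)//.
  - have /integrableP[_] := integrableS measurableT mD (subsetT _) iG; exact.
  - by do 2 apply: measurableT_comp => //; exact/measurable_EFinP.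
  - by apply: measurableT_comp => //; exact: measurable_funTS.
  - by apply: filterS GE => s h st; rewrite /= -h.
rewrite /mconv/conv/Rintegral; congr fine.
rewrite -(integral_mfrestr mD muoo)//.
transitivity (\int[nu]_r \int[leb]_s F (r, s))%E.
  rewrite integral_mkcond; apply: eq_integral => r _.
  rewrite patchE; case: ifPn => [/set_mem rt|/negP rt]; first by rewrite convE.
  by rewrite (eq_integral (cst 0%E)) ?integral0// => s _; rewrite Fr0// => /mem_set.
rewrite (Fubini intF).
transitivity (\int[leb]_(s in `[0%R, t]) \int[nu]_r F (r, s))%E.
  rewrite [RHS]integral_mkcond; apply: eq_integral => s _.
  rewrite patchE; case: ifPn => [//|/negP st].
  rewrite (eq_integral (cst 0%E)) ?integral0// => r _.
  by rewrite /F/= /b0 patchE; case: ifPn => // _; rewrite !mulr0.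
apply: ae_eq_integral => //.
- exact: measurable_funTS.
- exact/measurable_EFinP.
- exact: ae_eq_sym.
Qed.

End convolution.

(** * Integrals of powers and primitives of convolutions *)

Section power_integrals.
Variable R : realType.
Local Notation leb := (@lebesgue_measure R).
Implicit Types (p h t : R) (f : R -> R).

Lemma continuous_pos_within (f' : R -> R) (a b : R) : 0 < a ->
  (forall u : R, 0 < u -> {for u, continuous f'}) ->
  {within `[a, b], continuous f'}.
Proof.
move=> a0 cf; apply: continuous_in_subspaceT => u.
by rewrite inE/= in_itv/= => /andP[au _]; apply: cf; exact: lt_le_trans au.
Qed.

Lemma FTC_pos (k f : R -> R) (a b : R) : 0 < a -> a <= b ->
  (forall u : R, 0 < u -> is_derive u (1 : R) k (f u)) ->
  (forall u : R, 0 < u -> {for u, continuous f}) ->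
  \int[leb]_(u in `[a, b]) f u = k b - k a.
Proof.
move=> a0 ab dk cf.
move: ab; rewrite le_eqVlt => /predU1P[<-|ab].
  by rewrite set_itv1 Rintegral_set1 subrr.
have ck u : 0 < u -> {for u, continuous k}.
  by move=> u0; apply/differentiable_continuous/derivable1_diffP; case: (dk u u0).
rewrite /Rintegral (@continuous_FTC2 _ f k a b)//.
- by apply: continuous_pos_within.
- split.
  + move=> u; rewrite in_itv/= => /andP[au _].
    by case: (dk u (lt_trans a0 au)).
  + by apply: cvg_at_right_filter; apply: ck.
  + by apply: cvg_at_left_filter; apply: ck; exact: lt_trans ab.
- move=> u; rewrite in_itv/= => /andP[au _].
  rewrite derive1E; have := dk u (lt_trans a0 au) => h; exact: derive_val.
Qed.

Lemma measurable_pos f t : (forall u : R, 0 < u -> {for u, continuous f}) ->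
  measurable_fun (`[0, t] : set (measurableTypeR R)) (f : measurableTypeR R -> R).
Proof.
move=> cf.
have mo : measurable_fun (`]0, t] : set (measurableTypeR R)) (f : measurableTypeR R -> R).
  apply: (measurable_funS (E := (`]0, +oo[%classic : set (measurableTypeR R)))) => //.
    by move=> u /=; rewrite !in_itv/= => /andP[-> _].
  apply: open_continuous_measurable_fun => //.
  by move=> u; rewrite inE/= in_itv/= andbT => u0; exact: cf.
exact ((measurable_fun_itv_obnd_cbndP 0 (BRight t) f).1 mo).
Qed.

Lemma integrable_pos f (a b : R) : 0 < a ->
  (forall u : R, 0 < u -> {for u, continuous f}) ->
  leb.-integrable `[a, b] (EFin \o f).
Proof.
move=> a0 cf; apply: continuous_compact_integrable.
  exact: segment_compact.
exact: continuous_pos_within.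
Qed.

Lemma continuous_powR_pos p (u : R) : 0 < u -> {for u, continuous (fun x : R => x `^ p)}.
Proof.
move=> u0; apply/differentiable_continuous/derivable1_diffP.
by apply: derivable_powR; rewrite in_itv/= u0.
Qed.

Lemma is_derive_powR_div p (u : R) : 0 < p -> 0 < u ->
  is_derive u 1 (fun x : R => x `^ p / p) (u `^ (p - 1)).
Proof.
move=> p0 u0.
have uin : u \in `]0, +oo[%R by rewrite in_itv/= u0.
have d1 : derivable (fun x : R => x `^ p) u 1 by exact: derivable_powR.
have dd : is_derive u 1 (fun x : R => x `^ p) (p * u `^ (p - 1)).
  by split => //; rewrite -derive1E powR_derive1.
have -> : (fun x : R => x `^ p / p) = p^-1 *: (fun x : R => x `^ p).
  by apply/funext => x; rewrite /= mulrC.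
apply: is_derive_eq => /=.
by rewrite /GRing.scale/= mulrA mulVf ?mul1r// gt_eqF.
Qed.

(** The integrand is singular at 0 when p < 1: the fundamental theorem is
    used on [h / n, h], then monotone convergence. *)
Lemma power_integral_le p h : 0 < p -> 0 < h ->
  (\int[leb]_(u in `[0%R, h]) (u `^ (p - 1))%:E <= (h `^ p / p)%:E)%E.
Proof.
move=> p0 h0.
rewrite -integral_itv_obnd_cbnd; last first.
  apply/measurable_EFinP; apply: measurable_funTS.
  exact: measurable_powR.
pose F (n : nat) : set (measurableTypeR R) := `[h / n.+1%:R, h]%classic.
have UF : `]0, h]%classic = \bigcup_n F n.
  apply/seteqP; split => u /=.
    rewrite in_itv/= => /andP[u0 uh].
    exists (Num.trunc (h / u)) => //; rewrite /F/= in_itv/= uh andbT.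
    rewrite ler_pdivrMr ?ltr0n// mulrC -ler_pdivrMr//.
    apply/ltW; exact: truncnS_gt.
  move=> [n _]; rewrite /F/= !in_itv/= => /andP[hu ->]; rewrite andbT.
  by apply: lt_le_trans hu; rewrite divr_gt0// ltr0n.
have F0 n : 0 < h / n.+1%:R by rewrite divr_gt0// ltr0n.
have cv : (\int[leb]_(u in F n) (u `^ (p - 1))%:E)%E @[n --> \oo] -->
    (\int[leb]_(u in \bigcup_n F n) (u `^ (p - 1))%:E)%E.
  apply: ge0_nondecreasing_set_cvg_integral => //.
  - move=> m n mn; apply/subsetPset; apply: subset_itvr; rewrite bnd_simp.
    by rewrite ler_pM2l// lef_pV2 ?posrE ?ltr0n// ler_nat.
  - by move=> n; rewrite /F.
  - move=> n; apply/measurable_EFinP; apply: measurable_funTS.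
    exact: measurable_powR.
  - by move=> n u _; rewrite lee_fin powR_ge0.
rewrite UF -(cvg_lim _ cv)//.
apply: lime_le; first by apply/cvg_ex; eexists; exact: cv.
apply: nearW => n.
rewrite -[leLHS]fineK; last first.
  have ipn : leb.-integrable `[h / n.+1%:R, h] (EFin \o (fun u : R => u `^ (p - 1))).
    by apply: integrable_pos => // u; exact: continuous_powR_pos.
  by apply: (integrable_fin_num _ ipn).
have hn : h / n.+1%:R <= h by rewrite ler_pdivrMr ?ltr0n// ler_peMr ?ler1n// ltW.
have := FTC_pos (F0 n) hn (fun u => @is_derive_powR_div p u p0)
  (fun u => @continuous_powR_pos (p - 1) u).
rewrite -/(Rintegral leb _ _) => ->.
by rewrite lee_fin lerBlDr lerDl divr_ge0 ?powR_ge0// ltW.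
Qed.

Lemma integrable_power p h : 0 < p -> 0 < h ->
  leb.-integrable `[0, h] (EFin \o (fun u => u `^ (p - 1))).
Proof.
move=> p0 h0; apply/integrableP; split.
  apply/measurable_EFinP; apply: measurable_funTS.
  exact: measurable_powR.
apply: le_lt_trans (ltry (h `^ p / p)); apply: le_trans (power_integral_le p0 h0).
by apply: ge0_integral_le => // u _ /=; rewrite ger0_norm// powR_ge0.
Qed.

Lemma Rintegral_power_le p h : 0 < p -> 0 < h ->
  \int[leb]_(u in `[0, h]) (u `^ (p - 1)) <= h `^ p / p.
Proof.
move=> p0 h0; rewrite -lee_fin fineK.
  exact: power_integral_le.
exact: integrable_fin_num (integrable_power p0 h0).
Qed.

(** A bound that holds on ]0, h] only is enough, because the value at 0 is
    irrelevant to the integral. *)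
Lemma normr_Rintegral_power f p c h : 0 < p -> 0 < h -> 0 <= c ->
  measurable_fun (`[0, h] : set (measurableTypeR R)) (f : measurableTypeR R -> R) ->
  (forall u, 0 < u <= h -> `|f u| <= c * u `^ (p - 1)) ->
  leb.-integrable `[0, h] (EFin \o f) /\
  \int[leb]_(u in `[0, h]) `|f u| <= c * (h `^ p / p).
Proof.
move=> p0 h0 c0 mf fc.
have ip := integrable_power p0 h0.
have ipc := integrableRZ c _ ip.
have mf' : measurable_fun (`]0, h] : set (measurableTypeR R)) (f : measurableTypeR R -> R).
  by apply: measurable_funS mf => //; apply: subset_itv; rewrite bnd_simp.
have io : leb.-integrable `]0, h] (EFin \o f).
  apply: (integrable_dominated (g := fun u => c * u `^ (p - 1))) => //.
  by apply: integrableS (ipc _) => //; apply: subset_itv; rewrite bnd_simp.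
have ion : leb.-integrable `]0, h] (EFin \o (fun u => `|f u|)) by exact: integrable_norm.
have ioc : leb.-integrable `]0, h] (EFin \o (fun u => c * u `^ (p - 1))).
  by apply: integrableS (ipc _) => //; apply: subset_itv; rewrite bnd_simp.
split.
  apply/integrableP; split; first exact/measurable_EFinP.
  rewrite -integral_itv_obnd_cbnd; first by move/integrableP : io => [].
  by apply/measurable_EFinP; apply: measurableT_comp.
rewrite -(Rintegral_itv_obnd_cbnd ion).
apply: (@le_trans _ _ (\int[leb]_(u in `]0, h]) (c * u `^ (p - 1)))).
  by apply: le_Rintegral => // u; rewrite /= in_itv/= => uh; exact: fc.
rewrite (Rintegral_itv_obnd_cbnd ioc) RintegralZl//.
by rewrite ler_wpM2l// Rintegral_power_le.
Qed.

End power_integrals.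

Section convolution_theory.
Variable R : realType.
Local Notation leb := (@lebesgue_measure R).
Implicit Types (a b f k y : R -> R) (t : R).

Lemma measurable_fun_rev t f :
  measurable_fun (`[0, t] : set (measurableTypeR R)) (f : measurableTypeR R -> R) ->
  measurable_fun (`[0, t] : set (measurableTypeR R))
    ((fun s => f (t - s)) : measurableTypeR R -> R).
Proof.
move=> mf; apply: (measurable_comp (F := `[0, t]%classic) (f := f)) => //.
  by move=> _ /= [s st <-]; apply: rev_itv.
exact: measurable_funS (measurable_rev t).
Qed.

Lemma integrable_revE t f :
  leb.-integrable `[0, t] (EFin \o (fun s => f (t - s))) ->
  leb.-integrable `[0, t] (EFin \o f).
Proof.
move=> /integrable_rev; apply: eq_integrable => // s _ /=.
by congr EFin; congr f; lra.
Qed.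

Lemma subitv_rev t r : `[0, t]%classic r -> `[0, t - r]%classic `<=` `[0, t]%classic.
Proof. by rewrite /= in_itv/= => /andP[r0 rt]; apply: subset_itvl; rewrite bnd_simp; lra. Qed.

Lemma integrable_conv t a b M : leb.-integrable `[0, t] (EFin \o a) ->
  measurable_fun (`[0, t] : set (measurableTypeR R)) (b : measurableTypeR R -> R) ->
  (forall s, `[0, t]%classic s -> `|b s| <= M) ->
  leb.-integrable `[0, t] (EFin \o (fun s => a (t - s) * b s)) /\
  leb.-integrable `[0, t] (EFin \o (fun s => b (t - s) * a s)).
Proof.
move=> ia mb bM; split.
  apply: (@integrableR_eq _ _ _ (fun s => b s * a (t - s))) => //.
    by move=> s _; rewrite mulrC.
  apply: (integrable_mulr_bounded (M := M)) => //; exact: integrable_rev.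
apply: (integrable_mulr_bounded (M := M)) => //.
  exact: measurable_fun_rev.
by move=> s st; apply: bM; exact: rev_itv.
Qed.

Lemma conv_comm t a b :
  leb.-integrable `[0, t] (EFin \o (fun s => b (t - s) * a s)) ->
  conv a b t = conv b a t.
Proof.
move=> h; rewrite /conv -(Rintegral_rev h); apply: eq_Rintegral => s _.
by rewrite mulrC; congr (b _ * a _); lra.
Qed.

(** The uniform bound asked for by [conv_assoc], when one factor is integrable
    and the other one bounded. *)
Lemma conv_bound_l t a b M : leb.-integrable `[0, t] (EFin \o a) ->
  measurable_fun (`[0, t] : set (measurableTypeR R)) (b : measurableTypeR R -> R) ->
  0 <= M -> (forall s, `[0, t]%classic s -> `|b s| <= M) ->
  exists N : R, forall r, `[0, t]%classic r ->
    (\int[leb]_(s in `[0%R, (t - r)%R]) `|(a (t - r - s) * b s)%:E| <= N%:E)%E.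
Proof.
move=> ia mb M0 bM; exists (M * \int[leb]_(s in `[0, t]) `|a s|) => r rt.
have sub := subitv_rev rt.
have ia' : leb.-integrable `[0, t - r] (EFin \o a) by exact: integrableS ia.
have ian : leb.-integrable `[0, t] (EFin \o (fun s => `|a s|)) by exact: integrable_norm.
have ian' : leb.-integrable `[0, t - r] (EFin \o (fun s => `|a s|)) by exact: integrable_norm.
have iar : leb.-integrable `[0, t - r] (EFin \o (fun s => M * `|a (t - r - s)|)).
  by apply: integrableRZ => //; exact: (integrable_rev ian').
apply: (@le_trans _ _ (\int[leb]_(s in `[0%R, (t - r)%R]) (M * `|a (t - r - s)|)%:E)%E).
  apply: ge0_integral_le => // s st /=.
  rewrite lee_fin normrM mulrC ler_wpM2r//; apply: bM; exact: sub.
rewrite -[leLHS]fineK ?integrable_fin_num// lee_fin.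
rewrite -/(Rintegral leb _ _) RintegralZl//; last exact: (integrable_rev ian').
rewrite ler_wpM2l// (Rintegral_rev ian').
rewrite /Rintegral fine_le ?integrable_fin_num//.
by apply: ge0_subset_integral => //; apply: (measurable_int _ ian).
Qed.

Lemma conv_bound_r t a b M : leb.-integrable `[0, t] (EFin \o b) ->
  measurable_fun (`[0, t] : set (measurableTypeR R)) (a : measurableTypeR R -> R) ->
  0 <= M -> (forall s, `[0, t]%classic s -> `|a s| <= M) ->
  exists N : R, forall r, `[0, t]%classic r ->
    (\int[leb]_(s in `[0%R, (t - r)%R]) `|(a (t - r - s) * b s)%:E| <= N%:E)%E.
Proof.
move=> ib ma M0 aM; exists (M * \int[leb]_(s in `[0, t]) `|b s|) => r rt.
have sub := subitv_rev rt.
have ibn : leb.-integrable `[0, t] (EFin \o (fun s => `|b s|)) by exact: integrable_norm.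
have ibn' : leb.-integrable `[0, t - r] (EFin \o (fun s => `|b s|)).
  exact: integrableS ibn.
apply: (@le_trans _ _ (\int[leb]_(s in `[0%R, (t - r)%R]) (M * `|b s|)%:E)%E).
  apply: ge0_integral_le => // s /rev_itv st /=.
  rewrite lee_fin normrM ler_wpM2r//; apply: aM; exact: sub.
have iM : leb.-integrable `[0, t - r] (EFin \o (fun s => M * `|b s|)).
  exact: integrableRZ.
rewrite -[leLHS]fineK ?integrable_fin_num// lee_fin.
rewrite -/(Rintegral leb _ _) RintegralZl//.
rewrite ler_wpM2l// /Rintegral fine_le ?integrable_fin_num//.
by apply: ge0_subset_integral => //; apply: (measurable_int _ ibn).
Qed.

(** Associativity with the Lebesgue measure: integrating f * y amounts to
    convolving y with the primitive of f. *)
Lemma Rintegral_conv_primitive c t f y M : 0 <= t ->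
  leb.-integrable `[0, t] (EFin \o f) ->
  measurable_fun (`[0, t] : set (measurableTypeR R)) (y : measurableTypeR R -> R) ->
  0 <= M -> (forall s, `[0, t]%classic s -> `|y s| <= M) ->
  \int[leb]_(s in `[0, t]) (c * y s + conv f y s) =
  conv (fun u => c + \int[leb]_(r in `[0, u]) f r) y t.
Proof.
move=> t0 fi my M0 yM.
have mf : measurable_fun (`[0, t] : set (measurableTypeR R)) (f : measurableTypeR R -> R).
  by apply/measurable_EFinP; exact: measurable_int fi.
have toot : (leb `[0%R, t] < +oo)%E.
  by rewrite lebesgue_measure_itv/=; case: ifPn; rewrite ltry.
have [N hN] := conv_bound_l fi my M0 yM.
have [i1 i2 eq] := conv_assoc t0 toot mf my hN.
have i3 := integrable_revE i1.
have yi : leb.-integrable `[0, t] (EFin \o y) by apply: integrable_bounded yM.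
have cyi : leb.-integrable `[0, t] (EFin \o (fun s => c * y s)).
  exact: integrableRZ.
rewrite RintegralD// -(Rintegral_rev i3) -/(mconv leb (conv f y) t) eq.
have mE s : `[0, t]%classic s -> mconv leb f (t - s) = \int[leb]_(r in `[0, t - s]) f r.
  move=> st; rewrite /mconv Rintegral_rev//; apply: integrableS fi => //.
  exact: subitv_rev.
rewrite -RintegralD//.
by apply: eq_Rintegral => s /set_mem st; rewrite mE// mulrDl.
Qed.

End convolution_theory.

(** * Uniform continuity on a segment *)

Section uniform_continuity.
Variable R : realType.
Implicit Types (T : R).

(** On a segment this is continuity, by compactness; the explicit form goes
    through sums, coordinates and prolongations without any topology on the
    segment. *)
Definition ucont_on (V : normedModType R) T (g : R -> V) :=
  forall e : R, 0 < e -> exists2 del : R, 0 < del &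
    forall s t : R, 0 <= s <= T -> 0 <= t <= T -> `|s - t| < del ->
      `|g s - g t| < e.

Definition ucont (V : normedModType R) (g : R -> V) :=
  forall e : R, 0 < e -> exists2 del : R, 0 < del &
    forall s t : R, `|s - t| < del -> `|g s - g t| < e.

Lemma ucont_on_within (V : normedModType R) T (g : R -> V) :
  ucont_on T g -> {within `[0, T], continuous g}.
Proof.
move=> ug; apply/subspace_continuousP => x /= xT.
apply/cvgrPdist_lt => e e0; have [del del0 h] := ug e e0.
near=> y; apply: h; first by move: xT; rewrite in_itv.
  suff : `[0, T]%classic y by rewrite /= in_itv.
  by near: y; exact: withinT.
near: y; apply: cvg_within; apply/nbhs_ballP; exists del => //= y.
Unshelve. all: by end_near. Qed.

Lemma within_ucont_on (V : normedModType R) T (g : R -> V) :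
  {within `[0, T], continuous g} -> ucont_on T g.
Proof.
move=> /subspace_continuousP cg e e0.
have e20 : 0 < e / 2 by rewrite divr_gt0.
(* Compactness in the form: a property of del and s that holds for small del
   near every point of the segment holds for small del on the segment. *)
have /compact_near_coveringP cpt : compact (`[0, T]%classic : set R).
  exact: segment_compact.
have := cpt R 0^'+ (fun del s => forall t : R, 0 <= s <= T -> 0 <= t <= T ->
  `|s - t| < del -> `|g s - g t| < e) _.
case.
  move=> x xT; have /cvgrPdist_lt/(_ _ e20) hn := cg _ xT.
  have /nbhs_ballP[r /= r0 hr] : nbhs x (fun y => `[0, T]%classic y ->
    `|g x - g y| < e / 2) := hn.
  exists (ball x (r / 2), [set del | del < r / 2]).
    split; first by apply: nbhsx_ballx; rewrite divr_gt0.
    by apply: nbhs_right_lt; rewrite divr_gt0.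
  move=> [s del]/= [xs dr] t sT tT st.
  have xs' : `|x - s| < r / 2 by exact: xs.
  have h1 : `|g x - g s| < e / 2.
    by apply: hr => //=; apply: lt_le_trans xs' _; lra.
  have h2 : `|g x - g t| < e / 2.
    apply: hr => //=; rewrite /ball/=.
    have -> : x - t = (x - s) + (s - t) by ring.
    by apply: (le_lt_trans (ler_normD _ _)); lra.
  have -> : g s - g t = (g x - g t) - (g x - g s).
    by rewrite [RHS]addrC opprB addrA subrK.
  by apply: (le_lt_trans (ler_normB _ _)); lra.
move=> del /= del0 h; exists (del / 2); first by rewrite divr_gt0.
move=> s t sT tT st; apply: (h (del / 2)) => //=.
- by rewrite sub0r normrN gtr0_norm ?divr_gt0//; lra.
- by rewrite divr_gt0.
Qed.

Lemma ucont_on_bounded (V : normedModType R) T (g : R -> V) : ucont_on T g ->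
  exists2 M : R, 0 <= M & forall t : R, 0 <= t <= T -> `|g t| <= M.
Proof.
move=> /ucont_on_within cg.
have /compact_bounded[M [_ hM]] : compact (g @` (`[0, T]%classic)).
  by apply: continuous_compact => //; exact: segment_compact.
exists (`|M| + 1); first by rewrite addr_ge0.
move=> t tT; apply: (hM (`|M| + 1)); first by rewrite ltr_pwDr// ler_norm.
by exists t => //=; rewrite in_itv.
Qed.

Lemma ucont_continuous (V : normedModType R) (g : R -> V) :
  ucont g -> continuous g.
Proof.
move=> ug x; apply/cvgrPdist_lt => e e0; have [del del0 h] := ug e e0.
by apply/nbhs_ballP; exists del => //= y xy; exact: h.
Qed.

(** Composing with this projection prolongs a function on [0, T] to the whole
    line; the prolongation vanishes on the left when the function vanishes
    at 0. *)
Definition clamp T u : R := Num.min (Num.max 0 u) T.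

Lemma clamp_itv T u : 0 <= T -> 0 <= clamp T u <= T.
Proof.
by move=> T0; rewrite /clamp le_min le_max lexx/= T0/= ge_min lexx orbT.
Qed.

Lemma clamp_id T u : 0 <= u <= T -> clamp T u = u.
Proof. by move=> /andP[u0 uT]; rewrite /clamp max_r// min_l. Qed.

Lemma clamp_le0 T u : 0 <= T -> u <= 0 -> clamp T u = 0.
Proof. by move=> T0 u0; rewrite /clamp max_l// min_l. Qed.

Lemma clamp_dist T u v : 0 <= T -> `|clamp T u - clamp T v| <= `|u - v|.
Proof.
move=> T0; rewrite /clamp !maxElt !minElt.
do 4 ?[case: ifPn]; rewrite -?leNgt => *; rewrite ler_norml; apply/andP; split;
  have := ler_norm (u - v); have := lerNnormlW (lexx `|u - v|); lra.
Qed.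

Lemma ucont_clamp (V : normedModType R) T (g : R -> V) : 0 <= T ->
  ucont_on T g -> ucont (g \o clamp T).
Proof.
move=> T0 ug e e0; have [del del0 h] := ug e e0; exists del => // s t st.
apply: h; rewrite ?clamp_itv//; exact: le_lt_trans (clamp_dist _ _ T0) st.
Qed.

Lemma ucont_on_eq (V : normedModType R) T (g h : R -> V) :
  (forall t, 0 <= t <= T -> g t = h t) -> ucont_on T g -> ucont_on T h.
Proof.
move=> gh ug e e0; have [del del0 H] := ug e e0; exists del => // s t sT tT st.
by rewrite -!gh//; exact: H.
Qed.

Lemma ucont_sub (V : normedModType R) T (g : R -> V) : ucont g -> ucont_on T g.
Proof. by move=> ug e /ug[del del0 h]; exists del => // s t _ _; exact: h. Qed.

Lemma ucont_onB (V : normedModType R) T (g h : R -> V) :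
  ucont_on T g -> ucont_on T h -> ucont_on T (fun t => g t - h t).
Proof.
move=> ug uh e e0; have e20 : 0 < e / 2 by rewrite divr_gt0.
have [d1 d10 H1] := ug _ e20; have [d2 d20 H2] := uh _ e20.
exists (Num.min d1 d2); first by rewrite lt_min d10.
move=> s t sT tT; rewrite lt_min => /andP[/H1-/(_ sT tT) h1 /H2-/(_ sT tT) h2].
have -> : g s - h s - (g t - h t) = (g s - g t) - (h s - h t).
  by rewrite !opprD !opprK addrACA.
by apply: (le_lt_trans (ler_normB _ _)); lra.
Qed.

Lemma ucont_on_integrable T (g : R -> R) : ucont_on T g ->
  (@lebesgue_measure R).-integrable `[0, T] (EFin \o g).
Proof.
move=> ug; apply: continuous_compact_integrable; first exact: segment_compact.
exact: ucont_on_within.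
Qed.

Lemma ucont_on_measurable T (g : R -> R) : ucont_on T g ->
  measurable_fun (`[0, T] : set (measurableTypeR R)) (g : measurableTypeR R -> R).
Proof. by move=> /ucont_on_integrable; exact: integrable_measurable. Qed.

End uniform_continuity.

(** * Bounds of convolutions and the scalar operator Gamma *)

Section convolution_bounds.
Variable R : realType.
Local Notation leb := (@lebesgue_measure R).
Local Notation mfun_on D f :=
  (measurable_fun (D : set (measurableTypeR R)) (f : measurableTypeR R -> R)).
Implicit Types (a b y : R -> R) (t M : R).

Lemma power_small (c p e : R) : 0 <= c -> 0 < p -> 0 < e ->
  exists2 h0 : R, 0 < h0 & forall h, 0 < h <= h0 -> c * h `^ p <= e.
Proof.
move=> c0 p0 e0; have c10 : 0 < c + 1 by rewrite ltr_pwDr.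
have ec : 0 < e / (c + 1) by rewrite divr_gt0.
exists ((e / (c + 1)) `^ p^-1); first by rewrite powR_gt0.
move=> h /andP[h0 hh].
have e1 : e / (c + 1) = ((e / (c + 1)) `^ p^-1) `^ p.
  by rewrite -powRrM mulVf ?gt_eqF// powRr1// ltW.
have hp : h `^ p <= e / (c + 1).
  by rewrite [leRHS]e1 ge0_ler_powR ?nnegrE ?powR_ge0 ?(ltW p0)// ?(ltW h0).
apply: (@le_trans _ _ ((c + 1) * (e / (c + 1)))); last by rewrite mulrC divfK ?gt_eqF.
by rewrite ler_pM ?powR_ge0// lerDl.
Qed.

Lemma leb_itv0_lty t : (leb `[0%R, t] < +oo)%E.
Proof. by rewrite lebesgue_measure_itv/=; case: ifPn; rewrite ltry. Qed.

Lemma fine_leb_itv0 t : 0 <= t -> fine (leb `[0%R, t]) = t.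
Proof.
rewrite lebesgue_measure_itv/= lte_fin le_eqVlt => /predU1P[<-|->]; first by rewrite ltxx.
by rewrite sube0.
Qed.

Lemma powR_subr1_le (u v p : R) : 0 < u -> u <= v -> p <= 1 ->
  v `^ (p - 1) <= u `^ (p - 1).
Proof.
move=> u0 uv p1; have -> : p - 1 = - (1 - p) by ring.
rewrite !powRN lef_pV2 ?posrE ?powR_gt0 ?(lt_le_trans u0 uv)//.
by rewrite ge0_ler_powR ?nnegrE ?subr_ge0// ltW// (lt_le_trans u0 uv).
Qed.

Lemma eq_conv a a' y t : (forall u, `[0, t]%classic u -> a u = a' u) ->
  conv a y t = conv a' y t.
Proof.
by move=> aa'; apply: eq_Rintegral => s /set_mem/rev_itv st; rewrite aa'.
Qed.

Lemma convDl a a' y t M : leb.-integrable `[0, t] (EFin \o a) ->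
  leb.-integrable `[0, t] (EFin \o a') -> mfun_on `[0, t] y ->
  (forall s, `[0, t]%classic s -> `|y s| <= M) ->
  conv (fun u => a u + a' u) y t = conv a y t + conv a' y t.
Proof.
move=> ia ia' my yM; rewrite /conv -RintegralD//.
- by apply: eq_Rintegral => s _; rewrite mulrDl.
- by case: (integrable_conv ia my yM).
- by case: (integrable_conv ia' my yM).
Qed.

Lemma normr_conv_le a y t M : leb.-integrable `[0, t] (EFin \o a) ->
  mfun_on `[0, t] y -> 0 <= M -> (forall s, `[0, t]%classic s -> `|y s| <= M) ->
  `|conv a y t| <= M * \int[leb]_(u in `[0, t]) `|a u|.
Proof.
move=> ia my M0 yM.
have ian : leb.-integrable `[0, t] (EFin \o (fun s => `|a s|)) by exact: integrable_norm.
have ianr := integrable_rev ian.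
rewrite -(Rintegral_rev ian) -RintegralZl//.
apply: normr_Rintegral_le => //.
- exact: (integrable_measurable (integrable_conv ia my yM).1).
- by move=> s st; rewrite normrM mulrC ler_wpM2r// yM.
- exact: integrableRZ.
Qed.

Lemma conv_integrable f y t M : 0 <= t -> leb.-integrable `[0, t] (EFin \o f) ->
  mfun_on `[0, t] y -> 0 <= M -> (forall s, `[0, t]%classic s -> `|y s| <= M) ->
  leb.-integrable `[0, t] (EFin \o conv f y).
Proof.
move=> t0 fi my M0 yM.
have toot := leb_itv0_lty t.
have [N hN] := conv_bound_l fi my M0 yM.
have [i1 _ _] := conv_assoc t0 toot (integrable_measurable fi) my hN.
exact: integrable_revE i1.
Qed.

End convolution_bounds.

Section scalar_Gamma.
Variable R : realType.
Local Notation leb := (@lebesgue_measure R).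
Local Notation mfun_on D f :=
  (measurable_fun (D : set (measurableTypeR R)) (f : measurableTypeR R -> R)).

Definition sGamma (k f y : R -> R) t :=
  k t * y t + \int[leb]_(s in `[0, t]) (f (t - s) * (y s - y t)).

Variables (T : R) (k f : R -> R).
Hypothesis T0 : 0 < T.
Hypothesis dk : forall u : R, 0 < u -> is_derive u (1 : R) k (f u).
Hypothesis cf : forall u : R, 0 < u -> {for u, continuous f}.

Lemma integrable_pos_cutoff del : 0 < del ->
  leb.-integrable `[0, T] (EFin \o (f \_ `]del, T])).
Proof.
move=> del0; rewrite -restrict_EFin; apply/integrable_restrict => //=.
apply: integrableS (integrable_pos T del0 cf) => //.
  exact: measurableI.
by move=> u /= [_]; rewrite !in_itv/= => /andP[/ltW -> ->].
Qed.

Variables (y : R -> R) (beta M : R).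
Hypothesis uy : ucont y.
Hypothesis y0 : forall u, u <= 0 -> y u = 0.
Hypothesis beta0 : 0 < beta.
Hypothesis M0 : 0 <= M.
Hypothesis reg : forall u s : R, 0 < u <= T -> 0 <= s <= T ->
  `|f u * (y (s - u) - y s)| <= M * u `^ (beta - 1).

Let cy : continuous y. Proof. exact: ucont_continuous. Qed.

Let my : measurable_fun [set: measurableTypeR R] (y : measurableTypeR R -> R).
Proof. exact: continuous_measurable_fun. Qed.

Lemma measurable_shift s D : measurable (D : set (measurableTypeR R)) ->
  mfun_on D (fun u => y (s - u)).
Proof.
move=> mD; apply: measurable_funTS.
by apply: (measurableT_comp my (measurable_rev s)).
Qed.

(** The increment of y compensates the singularity of f at 0. *)
Lemma integrable_increment s h : 0 <= s <= T -> 0 < h <= T ->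
  leb.-integrable `[0, h] (EFin \o (fun u => f u * (y (s - u) - y s))) /\
  \int[leb]_(u in `[0, h]) `|f u * (y (s - u) - y s)| <= M * (h `^ beta / beta).
Proof.
move=> sT /andP[h0 hT]; apply: normr_Rintegral_power => //.
  apply: measurable_funM; first exact: measurable_pos.
  by apply: measurable_funB => //; exact: measurable_shift.
move=> u /andP[u0 uh]; apply: reg => //.
by rewrite u0 (le_trans uh).
Qed.

Lemma integrable_incrementT s : 0 <= s <= T ->
  leb.-integrable `[0, T] (EFin \o (fun u => f u * (y (s - u) - y s))).
Proof. by move=> sT; case: (@integrable_increment s T sT); rewrite ?T0 ?lexx. Qed.

Lemma sGamma_integrable t : 0 <= t <= T ->
  leb.-integrable `[0, t] (EFin \o (fun s => f (t - s) * (y s - y t))).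
Proof.
move=> /[dup] tT /andP[t0 tT'].
have ig : leb.-integrable `[0, t] (EFin \o (fun u => f u * (y (t - u) - y t))).
  by apply: integrableS (integrable_incrementT tT) => //; apply: subset_itvl; rewrite bnd_simp.
apply: integrableR_eq (integrable_rev ig) => //= s _.
by congr (_ * (y _ - _)); ring.
Qed.

(** For u > t the increment y(t - u) - y(t) is -y(t), so that the integral of
    f over [t, T] turns k(t) into k(T). *)
Lemma sGamma_fullE t : 0 <= t <= T ->
  sGamma k f y t = k T * y t + \int[leb]_(u in `[0, T]) (f u * (y (t - u) - y t)).
Proof.
move=> /[dup] tT /andP[t0 tT'].
move: t0; rewrite le_eqVlt => /predU1P[<-|t0].
  rewrite /sGamma set_itv1 Rintegral_set1 y0// !mulr0 addr0 add0r.
  rewrite (@eq_Rintegral _ _ _ leb `[0, T]%classic (cst 0)).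
    by rewrite Rintegral_cst// mul0r.
  move=> u /set_mem; rewrite /= in_itv/= => /andP[u0 _].
  by rewrite y0 ?subr0 ?mulr0// sub0r oppr_le0.
pose g u := f u * (y (t - u) - y t).
have ig := integrable_incrementT tT.
have ig' : leb.-integrable `[0, t] (EFin \o g).
  by apply: integrableS ig => //; apply: subset_itvl; rewrite bnd_simp.
have -> : sGamma k f y t = k t * y t + \int[leb]_(u in `[0, t]) g u.
  rewrite /sGamma -(Rintegral_rev ig'); congr (_ + _).
  apply: eq_Rintegral => s _; rewrite /g; congr (_ * (y _ - _)); ring.
have := Rintegral_itvB (a := BLeft 0) (b := BRight T) (x := t) ig.
rewrite !bnd_simp => /(_ (ltW t0) tT') /(canRL (subrK _)) ->.
have ift : leb.-integrable `[t, T] (EFin \o f) by exact: integrable_pos.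
have ift' : leb.-integrable `]t, T] (EFin \o f).
  by apply: integrableS ift => //; apply: subset_itvr; rewrite bnd_simp.
have hB : \int[leb]_(u in `]t, T]) g u = - y t * (k T - k t).
  rewrite (@eq_Rintegral _ _ _ leb `]t, T]%classic (fun u => - y t * f u)).
    by rewrite RintegralZl// Rintegral_itv_obnd_cbnd// (FTC_pos t0 tT' dk cf).
  move=> u /set_mem; rewrite /= in_itv/= => /andP[tu _].
  by rewrite /g [y (t - u)]y0 ?subr_le0 ?(ltW tu)// sub0r mulrC.
rewrite -/g hB; ring.
Qed.

(** Below h the two increments are estimated separately by the power bound,
    above h their difference is estimated by w. *)
Lemma sGamma_modulus t t' h w : 0 <= t <= T -> 0 <= t' <= T -> 0 < h <= T ->
  (forall u, 0 <= u <= T -> `|y (t - u) - y (t' - u)| <= w) ->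
  `|sGamma k f y t - sGamma k f y t'| <=
    (`|k T| + 2 * \int[leb]_(u in `[h, T]) `|f u|) * w +
    2 * (M * (h `^ beta / beta)).
Proof.
move=> tT t'T /[dup] hT /andP[h0 hT'] yw.
rewrite !sGamma_fullE//.
set g := fun u => f u * (y (t - u) - y t).
set g' := fun u => f u * (y (t' - u) - y t').
have ig : leb.-integrable `[0, T] (EFin \o g) := integrable_incrementT tT.
have ig' : leb.-integrable `[0, T] (EFin \o g') := integrable_incrementT t'T.
have iB : leb.-integrable `[0, T] (EFin \o (fun u => g u - g' u)).
  exact: integrableRB.
have [igh hg] := integrable_increment tT hT.
have [igh' hg'] := integrable_increment t'T hT.
have -> : k T * y t + \int[leb]_(u in `[0, T]) g u -
    (k T * y t' + \int[leb]_(u in `[0, T]) g' u) =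
    k T * (y t - y t') + \int[leb]_(u in `[0, T]) (g u - g' u).
  by rewrite RintegralB//; ring.
have := Rintegral_itvB (a := BLeft 0) (b := BRight T) (x := h) iB.
rewrite !bnd_simp => /(_ (ltW h0) hT') /(canRL (subrK _)) ->.
have b1 : `|k T * (y t - y t')| <= `|k T| * w.
  rewrite normrM ler_wpM2l//.
  by have := yw 0; rewrite !subr0; apply; rewrite lexx ltW.
have b2 : `|\int[leb]_(u in `[0, h]) (g u - g' u)| <= 2 * (M * (h `^ beta / beta)).
  rewrite RintegralB//.
  apply: (le_trans (ler_normB _ _)).
  have H1 : `|\int[leb]_(u in `[0, h]) g' u| <= \int[leb]_(u in `[0, h]) `|g' u|.
    exact: le_normr_Rintegral.
  have H2 : `|\int[leb]_(u in `[0, h]) g u| <= \int[leb]_(u in `[0, h]) `|g u|.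
    exact: le_normr_Rintegral.
  have := le_trans H1 hg'; have := le_trans H2 hg; lra.
have ift : leb.-integrable `[h, T] (EFin \o f) by exact: integrable_pos.
have ifn : leb.-integrable `[h, T] (EFin \o (fun u => `|f u|)) by exact: integrable_norm.
have sub : `]h, T]%classic `<=` `[h, T]%classic by apply: subset_itvr; rewrite bnd_simp.
have ifn' : leb.-integrable `]h, T] (EFin \o (fun u => `|f u|)) by exact: integrableS ifn.
have b3 : `|\int[leb]_(u in `]h, T]) (g u - g' u)| <=
    2 * (\int[leb]_(u in `[h, T]) `|f u|) * w.
  rewrite -(Rintegral_itv_obnd_cbnd ifn') mulrAC -RintegralZl//.
  apply: normr_Rintegral_le => //.
  - have sub0 : `]h, T]%classic `<=` `[0, T]%classic.
      by apply: subset_itvr; rewrite bnd_simp ltW.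
    exact: measurable_funS (integrable_measurable iB).
  - move=> u; rewrite /= in_itv/= => /andP[hu uT].
    have -> : g u - g' u = f u * ((y (t - u) - y (t' - u)) - (y t - y t')).
      by rewrite /g/g'; ring.
    rewrite normrM mulrC ler_wpM2r//.
    apply: (le_trans (ler_normB _ _)).
    have := yw u; rewrite uT andbT => /(_ (ltW (lt_trans h0 hu))).
    by have := yw 0; rewrite !subr0 lexx (ltW T0) => /(_ isT); lra.
  - exact: integrableRZ.
apply: (le_trans (ler_normD _ _)).
apply: (le_trans (lerD b1 (ler_normD _ _))).
by rewrite mulrDl -!addrA lerD2l; exact: lerD b3 b2.
Qed.

Lemma sGamma_ucont : ucont_on T (sGamma k f y).
Proof.
move=> e e0.
have [h /andP[h0 hT] hh] : exists2 h, 0 < h <= T &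
    2 * (M * (h `^ beta / beta)) <= e / 2.
  have c0 : 0 <= 4 * M / beta by rewrite divr_ge0 ?mulr_ge0// ltW.
  have [h0 h00 hh] := power_small c0 beta0 e0.
  have m0 : 0 < Num.min T h0 by rewrite lt_min T0.
  exists (Num.min T h0); first by rewrite m0 ge_min lexx.
  have : 4 * M / beta * (Num.min T h0) `^ beta <= e.
    by apply: hh; rewrite m0 ge_min lexx orbT.
  have -> : 4 * M / beta * (Num.min T h0) `^ beta =
      2 * (2 * (M * ((Num.min T h0) `^ beta / beta))).
    by field; rewrite gt_eqF.
  lra.
pose c := `|k T| + 2 * \int[leb]_(u in `[h, T]) `|f u| + 1.
have c10 : 0 <= `|k T| + 2 * \int[leb]_(u in `[h, T]) `|f u|.
  by rewrite addr_ge0// mulr_ge0// Rintegral_ge0.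
have c0 : 0 < c by rewrite ltr_pwDr.
have ec : 0 < e / (4 * c) by rewrite divr_gt0// mulr_gt0.
have [del del0 hd] := uy ec; exists del => // s t sT tT st.
have := @sGamma_modulus s t h (e / (4 * c)) sT tT.
rewrite h0 hT => /(_ isT) H; apply: (le_lt_trans (H _)).
  move=> u _; apply/ltW/hd; suff -> : s - u - (t - u) = s - t by [].
  ring.
have : (`|k T| + 2 * (\int[leb]_(u in `[h, T]) `|f u|)) * (e / (4 * c)) <= e / 4.
  apply: (@le_trans _ _ (c * (e / (4 * c)))).
    by rewrite ler_wpM2r ?(ltW ec)// /c lerDl.
  by rewrite le_eqVlt; apply/orP; left; apply/eqP; field; rewrite gt_eqF.
move=> H2; apply: (le_lt_trans (lerD H2 hh)); lra.
Qed.

Local Notation cutoff del := (f \_ `]del, T]).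

Lemma conv_cutoffE s del : 0 <= s <= T -> 0 < del <= T ->
  conv (cutoff del) y s = \int[leb]_(u in `]del, T]) (f u * y (s - u)).
Proof.
move=> /andP[s0 sT] /andP[d0 dT].
have isub a b : 0 < a -> leb.-integrable `[a, b] (EFin \o (fun u => f u * y (s - u))).
  move=> a0; apply: continuous_compact_integrable; first exact: segment_compact.
  apply: continuous_in_subspaceT => u.
  rewrite inE/= in_itv/= => /andP[au _].
  apply: continuousM; first by apply: cf; exact: lt_le_trans au.
  apply: continuous_comp; last exact: cy.
  by apply: continuousB => //; exact: cst_continuous.
have ih : leb.-integrable `[0, T] (EFin \o ((fun u => f u * y (s - u)) \_ `]del, T])).
  rewrite -restrict_EFin; apply/integrable_restrict => //=.
  apply: integrableS (isub del T d0) => //.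
    exact: measurableI.
  by move=> u /= [_]; rewrite !in_itv/= => /andP[/ltW -> ->].
have e1 u : y (s - u) * (cutoff del) u = ((fun u => f u * y (s - u)) \_ `]del, T]) u.
  by rewrite !patchE; case: ifPn => _; rewrite ?mulr0// mulrC.
rewrite conv_comm; last first.
  apply: (@integrableR_eq _ _ _ ((fun u => f u * y (s - u)) \_ `]del, T])) => //.
  by apply: integrableS ih => //; apply: subset_itvl; rewrite bnd_simp.
rewrite /conv; under eq_Rintegral do rewrite e1.
have := Rintegral_itvB (a := BLeft 0) (b := BRight T) (x := s) ih.
rewrite !bnd_simp => /(_ s0 sT).
rewrite [X in _ = X -> _](_ : _ = 0); last first.
  rewrite (@eq_Rintegral _ _ _ leb _ (cst 0)); first by rewrite Rintegral_cst// mul0r.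
  move=> u /set_mem; rewrite /= in_itv/= => /andP[su _].
  by rewrite patchE y0 ?mulr0 ?if_same// subr_le0 ltW.
move/eqP; rewrite subr_eq0 => /eqP <-.
rewrite -Rintegral_mkcondr setIidr//.
by apply: subset_itvr; rewrite bnd_simp ltW.
Qed.

(** Removing the singularity: the operator of the kernel cut at del is
    k(del) y + (f 1_{u > del}) * y. *)
Lemma sGamma_cutoff s del : 0 <= s <= T -> 0 < del <= T ->
  `|sGamma k f y s - (k del * y s + conv (cutoff del) y s)| <= M * (del `^ beta / beta).
Proof.
move=> sT /[dup] dT /andP[d0 dT'].
rewrite conv_cutoffE// sGamma_fullE//.
have ig := integrable_incrementT sT.
have [igd hgd] := integrable_increment sT dT.
set g := fun u => f u * (y (s - u) - y s) in ig igd hgd *.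
have := Rintegral_itvB (a := BLeft 0) (b := BRight T) (x := del) ig.
rewrite !bnd_simp => /(_ (ltW d0) dT') /(canRL (subrK _)) ->.
have ift : leb.-integrable `[del, T] (EFin \o f) by exact: integrable_pos.
have ift' : leb.-integrable `]del, T] (EFin \o f).
  by apply: integrableS ift => //; apply: subset_itvr; rewrite bnd_simp.
have igt : leb.-integrable `]del, T] (EFin \o g).
  by apply: integrableS ig => //; apply: subset_itvr; rewrite bnd_simp ltW.
have iyf : leb.-integrable `]del, T] (EFin \o (fun u => y s * f u)) by exact: integrableRZ.
have -> : \int[leb]_(u in `]del, T]) (f u * y (s - u)) =
    \int[leb]_(u in `]del, T]) g u + y s * (k T - k del).
  rewrite -(FTC_pos d0 dT' dk cf) -(Rintegral_itv_obnd_cbnd ift') -RintegralZl//.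
  rewrite -RintegralD//; apply: eq_Rintegral => u _; rewrite /g; ring.
set I1 := \int[leb]_(u in `]del, T]) g u.
have -> : k T * y s + (I1 + \int[leb]_(u in `[0, del]) g u) -
    (k del * y s + (I1 + y s * (k T - k del))) = \int[leb]_(u in `[0, del]) g u.
  ring.
apply: le_trans hgd; exact: le_normr_Rintegral.
Qed.

Variables (alpha N : R).
Hypothesis alpha0 : 0 < alpha <= 1.
Hypothesis N0 : 0 <= N.
Hypothesis kN : forall u : R, 0 < u <= T -> `|k u| <= N * u `^ (alpha - 1).

Let ck u : 0 < u -> {for u, continuous k}.
Proof.
by move=> u0; apply/differentiable_continuous/derivable1_diffP; case: (dk u0).
Qed.

Lemma kernel_integrable : leb.-integrable `[0, T] (EFin \o k).
Proof.
have /andP[a0 _] := alpha0.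
case: (normr_Rintegral_power a0 T0 N0 (measurable_pos ck) kN); exact.
Qed.

(** The primitive of the cut derivative is k stopped at del. *)
Lemma cutoff_primitive u del : 0 <= u <= T -> 0 < del <= T ->
  k del + \int[leb]_(r in `[0, u]) (cutoff del) r =
  k u + ((fun r => k del - k r) \_ `[0, del]) u.
Proof.
move=> /andP[u0 uT] /andP[d0 dT].
rewrite -Rintegral_mkcondr patchE.
have [ud|du] := leP u del.
  rewrite mem_set/=; last by rewrite in_itv/= u0.
  rewrite (_ : _ `&` _ = set0) ?Rintegral_set0; first by ring.
  apply/seteqP; split => r //= [/=]; rewrite !in_itv/= => /andP[_ ru] /andP[dr _].
  by have := lt_le_trans dr (le_trans ru ud); rewrite ltxx.
rewrite memNset/=; last by rewrite in_itv/= u0/= leNgt du.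
have -> : `[0, u]%classic `&` `]del, T]%classic = `]del, u]%classic.
  apply/seteqP; split => r /=; rewrite !in_itv/=.
    by move=> [/andP[_ ->] /andP[-> _]].
  move=> /andP[dr ru]; rewrite ru dr (le_trans ru uT) andbT; split => //.
  by rewrite ltW// (lt_trans d0).
have ifu : leb.-integrable `]del, u] (EFin \o f).
  by apply: integrableS (integrable_pos u d0 cf) => //; apply: subset_itvr; rewrite bnd_simp.
rewrite (Rintegral_itv_obnd_cbnd ifu) (FTC_pos d0 (ltW du) dk cf).
rewrite [point](_ : _ = 0)//; ring.
Qed.

(** The operator Gamma is the derivative of the convolution with k.  The
    identity is proved for the kernel cut at del, up to an error that vanishes
    with del. *)
Lemma sGamma_primitive t : 0 <= t <= T ->
  \int[leb]_(s in `[0, t]) sGamma k f y s = conv k y t.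
Proof.
move=> /[dup] tT /andP[t0 tT'].
have /andP[a0 a1] := alpha0.
have [Y Y0 yY] := ucont_on_bounded (@ucont_sub _ _ T _ uy).
have subT : `[0, t]%classic `<=` `[0, T]%classic.
  by apply: subset_itvl; rewrite bnd_simp.
have yYt s : `[0, t]%classic s -> `|y s| <= Y.
  by move=> /subT; rewrite /= in_itv/=; exact: yY.
have myt : mfun_on `[0, t] y by exact: measurable_funTS.
(* The error of the cut operator, then that of the cut kernel k stopped at del,
   which differs from k by at most 2 N u^(alpha - 1) on [0, del]. *)
have est del : 0 < del <= T ->
    `|\int[leb]_(s in `[0, t]) sGamma k f y s - conv k y t| <=
    (T * M / beta) * del `^ beta + (Y * (2 * N) / alpha) * del `^ alpha.
  move=> /[dup] dT /andP[d0 dT'].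
  have ifd : leb.-integrable `[0, t] (EFin \o cutoff del).
    by apply: integrableS (integrable_pos_cutoff d0).
  have e1 := Rintegral_conv_primitive (k del) t0 ifd myt Y0 yYt.
  have id1 : leb.-integrable `[0, t] (EFin \o (fun s => k del * y s + conv (cutoff del) y s)).
    apply: integrableRD => //; last exact: (conv_integrable t0 ifd myt Y0 yYt).
    apply: integrableRZ => //; apply: (integrable_bounded (M := Y)) => //.
    exact: leb_itv0_lty.
  have iG : leb.-integrable `[0, t] (EFin \o sGamma k f y).
    by apply: integrableS (ucont_on_integrable sGamma_ucont).
  pose phi := (fun r => k del - k r) \_ `[0, del].
  have e2 : conv (fun u => k del + \int[leb]_(r in `[0, u]) (cutoff del) r) y t =
      conv (fun u => k u + phi u) y t.
    apply: eq_conv => u /subT; rewrite /= in_itv/= => uT.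
    by rewrite cutoff_primitive.
  have ik : leb.-integrable `[0, t] (EFin \o k) by exact: integrableS kernel_integrable.
  have ikd : leb.-integrable `[0, del] (EFin \o k).
    by apply: integrableS kernel_integrable => //; apply: subset_itvl; rewrite bnd_simp.
  have ikd' : leb.-integrable `[0, del] (EFin \o (fun r => k del - k r)).
    apply: integrableRB => //; apply: (integrable_bounded (M := `|k del|)) => //.
    exact: leb_itv0_lty.
  have iphi : leb.-integrable `[0, T] (EFin \o phi).
    rewrite -restrict_EFin; apply/integrable_restrict => //=.
    by apply: integrableS ikd' => //; exact: measurableI.
  have iphit : leb.-integrable `[0, t] (EFin \o phi) by exact: integrableS iphi.
  have e3 := convDl ik iphit myt yYt.
  have -> : \int[leb]_(s in `[0, t]) sGamma k f y s - conv k y t =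
      \int[leb]_(s in `[0, t]) (sGamma k f y s - (k del * y s + conv (cutoff del) y s))
      + conv phi y t.
    by rewrite RintegralB// e1 e2 e3; ring.
  apply: (le_trans (ler_normD _ _)); apply: lerD.
    have := @normr_Rintegral_le_cst R leb `[0, t]%classic
      (fun s => sGamma k f y s - (k del * y s + conv (cutoff del) y s))
      (M * (del `^ beta / beta)).
    have mG := integrable_measurable (integrableRB (measurable_itv _) iG id1).
    move=> /(_ (measurable_itv _) (leb_itv0_lty t) mG) H.
    have {}H := H _; rewrite fine_leb_itv0// in H.
    apply: (le_trans (H _)).
      by move=> s /subT; rewrite /= in_itv/= => sT; exact: sGamma_cutoff.
    have -> : T * M / beta * del `^ beta = M * (del `^ beta / beta) * T by ring.
    by rewrite ler_wpM2l// mulr_ge0// divr_ge0 ?powR_ge0// ltW.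
  apply: (le_trans (normr_conv_le iphit myt Y0 yYt)).
  rewrite -[leRHS]mulrA -mulrA ler_wpM2l//.
  have iphin : leb.-integrable `[0, T] (EFin \o (fun u => `|phi u|)) by exact: integrable_norm.
  apply: (@le_trans _ _ (\int[leb]_(u in `[0, T]) `|phi u|)).
    rewrite /Rintegral fine_le ?integrable_fin_num//.
      exact: integrableS iphin.
    by apply: ge0_subset_integral => //; apply: (measurable_int _ iphin).
  have -> : \int[leb]_(u in `[0, T]) `|phi u| = \int[leb]_(u in `[0, del]) `|k del - k u|.
    rewrite -(@setIidr _ `[0, T]%classic `[0, del]%classic); last first.
      by apply: subset_itvl; rewrite bnd_simp.
    rewrite Rintegral_mkcondr; apply: eq_Rintegral => u _.
    by rewrite /phi !patchE; case: ifPn; rewrite ?normr0.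
  have N20 : 0 <= 2 * N by rewrite mulr_ge0.
  have bd u : 0 < u <= del -> `|k del - k u| <= 2 * N * u `^ (alpha - 1).
    move=> /andP[u0 ud]; apply: (le_trans (ler_normB _ _)).
    have h1 : `|k del| <= N * u `^ (alpha - 1).
      apply: le_trans (kN dT) _; rewrite ler_wpM2l//.
      exact: powR_subr1_le.
    have h2 : `|k u| <= N * u `^ (alpha - 1) by apply: kN; rewrite u0 (le_trans ud).
    by rewrite -mulrA mulr_natl mulr2n; exact: lerD h1 h2.
  have [_ h] := normr_Rintegral_power a0 d0 N20 (integrable_measurable ikd') bd.
  by apply: (le_trans h); rewrite [del `^ _ / _]mulrC -mulrA.
apply/eqP; rewrite -subr_eq0 -normr_le0; apply/ler_addgt0Pr => e e0; rewrite add0r.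
have e20 : 0 < e / 2 by rewrite divr_gt0.
have c10 : 0 <= T * M / beta by rewrite divr_ge0 ?mulr_ge0// ltW.
have c20 : 0 <= Y * (2 * N) / alpha by rewrite divr_ge0 ?mulr_ge0// ltW.
have [h1 h10 H1] := power_small c10 beta0 e20.
have [h2 h20 H2] := power_small c20 a0 e20.
pose del := Num.min T (Num.min h1 h2).
have d0 : 0 < del by rewrite !lt_min T0 h10.
apply: le_trans (est del _) _; first by rewrite d0 ge_min lexx.
rewrite [leRHS](splitr e); apply: lerD.
  by apply: H1; rewrite d0 !ge_min lexx orbT.
by apply: H2; rewrite d0 !ge_min lexx !orbT.
Qed.

End scalar_Gamma.

(** * Convolution with a measure of locally bounded variation *)

Section uniqueness.
Variable R : realType.
Local Notation leb := (@lebesgue_measure R).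

(** If p(t) were not 0, the mean of p over a short interval around t, which is
    a difference of primitives, would be close to p(t). *)
Lemma ucont_on_eq0 (T : R) (p : R -> R) : 0 < T -> ucont_on T p ->
  (forall t, 0 <= t <= T -> \int[leb]_(s in `[0, t]) p s = 0) ->
  forall t, 0 <= t <= T -> p t = 0.
Proof.
move=> T0 up p0 t /[dup] tT /andP[t0 tT'].
apply/eqP; rewrite -normr_le0; apply/ler_addgt0Pr => e e0; rewrite add0r.
have [del del0 hd] := up e e0.
(* The interval is shortened at the ends of [0, T] but never degenerate. *)
pose a := Num.max 0 (t - del / 2); pose b := Num.min T (t + del / 2).
have d20 : 0 < del / 2 by rewrite divr_gt0.
have a0 : 0 <= a by rewrite le_max lexx.
have bT : b <= T by rewrite ge_min lexx.
have at_ : a <= t by rewrite ge_max t0/= gerBl ltW.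
have tb : t <= b by rewrite le_min tT'/= lerDl ltW.
have ab : a < b.
  rewrite lt_min !gt_max T0/=; apply/andP; split; first lra.
  by apply/andP; split; lra.
have near u : a < u <= b -> `|t - u| < del.
  move=> /andP[au ub]; rewrite ltr_norml; apply/andP; split.
    have : b <= t + del / 2 by rewrite ge_min lexx orbT.
    lra.
  have : t - del / 2 <= a by rewrite le_max lexx orbT.
  lra.
have ip := ucont_on_integrable up.
have ipb : leb.-integrable `[0, b] (EFin \o p).
  by apply: integrableS ip => //; apply: subset_itvl; rewrite bnd_simp.
have := Rintegral_itvB (a := BLeft 0) (b := BRight b) (x := a) ipb.
rewrite !bnd_simp => /(_ a0 (ltW ab)).
rewrite !p0 ?subrr; first last.
- by rewrite (le_trans t0 tb).
- by rewrite a0 (le_trans at_).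
move=> I0.
have sub : `]a, b]%classic `<=` `[0, b]%classic.
  by apply: subset_itvr; rewrite bnd_simp.
have ipab : leb.-integrable `]a, b] (EFin \o p) by exact: integrableS ipb.
have lab : leb `]a, b]%classic = (b - a)%:E.
  by rewrite lebesgue_measure_itv/= lte_fin ab.
have labf : (leb `]a, b]%classic < +oo)%E by rewrite lab ltry.
have ic : leb.-integrable `]a, b] (EFin \o (fun=> p t)).
  by apply: (integrable_bounded (M := `|p t|)).
have eqI : \int[leb]_(u in `]a, b]) (p t - p u) = p t * (b - a).
  rewrite RintegralB// -I0 subr0 Rintegral_cst//; congr (_ * _).
  exact: (congr1 fine lab).
have : `|p t * (b - a)| <= e * (b - a).
  rewrite -eqI.
  have -> : b - a = fine (leb `]a, b]%classic) by exact/esym/(congr1 fine lab).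
  apply: normr_Rintegral_le_cst => //.
    exact: (integrable_measurable (integrableRB _ ic ipab)).
  move=> u; rewrite /= in_itv/= => /[dup] uab /andP[au ub].
  apply/ltW/hd => //; last exact: near.
  by rewrite (le_trans a0 (ltW au)) (le_trans ub).
by rewrite normrM (@gtr0_norm _ (b - a)) ?subr_gt0// ler_pM2r// subr_gt0.
Qed.

End uniqueness.

Section lbv_convolution.
Variables (R : realType).
Local Notation leb := (@lebesgue_measure R).
Local Notation mfun_on D f :=
  (measurable_fun (D : set (measurableTypeR R)) (f : measurableTypeR R -> R)).
Implicit Types (nu : lbv_measure R) (a b k y g : R -> R) (t M : R).

Definition lconv nu a t := mconv (lbv_pos nu) a t - mconv (lbv_neg nu) a t.

Lemma lconv_assoc nu t a b (N : R) : 0 <= t ->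
  mfun_on `[0, t] a -> mfun_on `[0, t] b ->
  (forall r, `[0, t]%classic r ->
    (\int[leb]_(s in `[0%R, (t - r)%R]) `|(a (t - r - s) * b s)%:E| <= N%:E)%E) ->
  [/\ lbv_integrable nu `[0, t] (fun r => conv a b (t - r)),
      leb.-integrable `[0, t] (EFin \o (fun s => lconv nu a (t - s) * b s)) &
      lconv nu (conv a b) t = conv (lconv nu a) b t].
Proof.
move=> t0 ma mb hN.
have [p1 p2 p3] := conv_assoc t0 (lbv_pos_fin nu t) ma mb hN.
have [n1 n2 n3] := conv_assoc t0 (lbv_neg_fin nu t) ma mb hN.
split => //.
  by apply: integrableR_eq (integrableRB _ p2 n2) => // s _; rewrite /lconv mulrBl.
rewrite /lconv p3 n3 /conv -RintegralB//.
by apply: eq_Rintegral => s _; rewrite mulrBl.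
Qed.

(** Associativity and commutativity combined:
    k * (y * nu) = (k * nu) * y = (k * y) * nu. *)
Lemma lconv_swap nu t k y M : 0 <= t -> leb.-integrable `[0, t] (EFin \o k) ->
  mfun_on `[0, t] y -> 0 <= M -> (forall s, `[0, t]%classic s -> `|y s| <= M) ->
  [/\ leb.-integrable `[0, t] (EFin \o (fun s => lconv nu k (t - s) * y s)),
      leb.-integrable `[0, t] (EFin \o (fun s => k (t - s) * lconv nu y s)),
      lbv_integrable nu `[0, t] (fun r => conv k y (t - r)),
      conv k (lconv nu y) t = conv (lconv nu k) y t &
      lconv nu (conv k y) t = conv (lconv nu k) y t].
Proof.
move=> t0 ik my M0 yM.
have mk := integrable_measurable ik.
have [N1 hN1] := conv_bound_l ik my M0 yM.
have [N2 hN2] := conv_bound_r ik my M0 yM.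
have [A1 A2 A3] := lconv_assoc nu t0 mk my hN1.
have [B1 B2 B3] := lconv_assoc nu t0 my mk hN2.
split => //.
- apply: integrableR_eq (integrable_rev B2) => // s _.
  by rewrite mulrC; congr (k _ * lconv nu y _); ring.
- rewrite conv_comm// -B3 -A3 /lconv.
  have swap mu : mconv mu (conv y k) t = mconv mu (conv k y) t.
    apply: eq_Rintegral => r /set_mem rt; rewrite -conv_comm//.
    have sub := subitv_rev rt.
    have ik' : leb.-integrable `[0, t - r] (EFin \o k) by exact: integrableS ik.
    have my' : mfun_on `[0, t - r] y by exact: measurable_funS my.
    by have [] := integrable_conv ik' my' (fun s st => yM s (sub s st)).
  by rewrite !swap.
Qed.

(** Associativity with the constant function 1. *)
Lemma lconv_primitive nu t g M : 0 <= t ->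
  mfun_on `[0, t] g -> 0 <= M -> (forall s, `[0, t]%classic s -> `|g s| <= M) ->
  leb.-integrable `[0, t] (EFin \o lconv nu g) /\
  \int[leb]_(s in `[0, t]) lconv nu g s =
    lconv nu (fun u => \int[leb]_(s in `[0, u]) g s) t.
Proof.
move=> t0 mg M0 gM.
have i1 : leb.-integrable `[0, t] (EFin \o (cst 1 : R -> R)).
  apply: (integrable_bounded (M := 1)) => //; first exact: leb_itv0_lty.
  by move=> s _; rewrite normr1.
have ig : leb.-integrable `[0, t] (EFin \o g).
  by apply: (integrable_bounded (M := M)) => //; exact: leb_itv0_lty.
have [N hN] := conv_bound_r i1 mg M0 gM.
have [A1 A2 A3] := lconv_assoc nu t0 mg (integrable_measurable i1) hN.
have il : leb.-integrable `[0, t] (EFin \o lconv nu g).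
  apply: integrable_revE; apply: integrableR_eq A2 => // s _.
  by rewrite mulr1.
split => //.
rewrite -(Rintegral_rev il).
transitivity (conv (lconv nu g) (cst 1) t).
  by apply: eq_Rintegral => s _; rewrite mulr1.
rewrite -A3 /lconv.
have e mu : mconv mu (conv g (cst 1)) t =
    mconv mu (fun u => \int[leb]_(s in `[0, u]) g s) t.
  apply: eq_Rintegral => r /set_mem rt.
  rewrite /conv -[RHS](@Rintegral_rev R (t - r) g).
    by apply: eq_Rintegral => s _; rewrite mulr1.
  by apply: integrableS ig => //; exact: subitv_rev.
by rewrite !e.
Qed.

Lemma eq_lconv nu t a b : (forall u, `[0, t]%classic u -> a u = b u) ->
  lconv nu a t = lconv nu b t.
Proof.
move=> ab; rewrite /lconv; congr (_ - _);
  by apply: eq_Rintegral => s /set_mem/rev_itv st; rewrite ab.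
Qed.

Lemma lbv_integrable_bounded nu t y M : mfun_on `[0, t] y ->
  (forall s, `[0, t]%classic s -> `|y s| <= M) -> lbv_integrable nu `[0, t] y.
Proof.
move=> my yM; split; apply: (integrable_bounded (M := M)) => //.
  exact: lbv_pos_fin.
exact: lbv_neg_fin.
Qed.

Lemma lconv_lin nu t (c : R) a b :
  lbv_integrable nu `[0, t] (fun s => a (t - s)) ->
  lbv_integrable nu `[0, t] (fun s => b (t - s)) ->
  lconv nu (fun u => c * a u + b u) t = c * lconv nu a t + lconv nu b t.
Proof.
move=> [ap an] [bp bn]; rewrite /lconv /mconv.
rewrite !RintegralD//; [|exact: integrableRZ..].
by rewrite !RintegralZl//; ring.
Qed.

Definition variation nu (T : R) : R :=
  fine (lbv_pos nu `[0%R, T]) + fine (lbv_neg nu `[0%R, T]).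

Lemma variation_ge0 nu T : 0 <= variation nu T.
Proof. by rewrite addr_ge0 ?fine_ge0. Qed.

(** As y vanishes on the left, the bound t can be replaced by T. *)
Lemma lconv_fullE nu T y t : 0 <= t <= T -> (forall u, u <= 0 -> y u = 0) ->
  lconv nu y t = \int[lbv_pos nu]_(s in `[0, T]) y (t - s) -
                 \int[lbv_neg nu]_(s in `[0, T]) y (t - s).
Proof.
move=> /andP[t0 tT] y0; rewrite /lconv.
have e mu : mconv mu y t = \int[mu]_(s in `[0, T]) y (t - s).
  rewrite /mconv -(@setIidr _ `[0, T]%classic `[0, t]%classic); last first.
    by apply: subset_itvl; rewrite bnd_simp.
  rewrite Rintegral_mkcondr; apply: eq_Rintegral => s /set_mem.
  rewrite /= in_itv/= => /andP[s0 sT]; rewrite patchE; case: ifPn => //.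
  move=> /negP st; rewrite y0//; rewrite subr_le0 leNgt; apply/negP => ts.
  by apply: st; rewrite inE/= in_itv/= s0 ltW.
by rewrite !e.
Qed.

Lemma normr_lconv_le nu T y t w : 0 <= t <= T -> ucont y ->
  (forall u, u <= 0 -> y u = 0) ->
  (forall s, 0 <= s <= T -> `|y (t - s)| <= w) ->
  `|lconv nu y t| <= w * variation nu T.
Proof.
move=> tT uy y0 yw; rewrite (lconv_fullE _ tT y0) mulrDr.
have mD : mfun_on `[0, T] (fun s => y (t - s)).
  apply: measurable_funTS; apply: (measurableT_comp _ (measurable_rev t)).
  exact: continuous_measurable_fun (ucont_continuous uy).
apply: (le_trans (ler_normB _ _)).
apply: lerD; apply: normr_Rintegral_le_cst => //.
- exact: lbv_pos_fin.
- exact: lbv_neg_fin.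
Qed.

Lemma lconv_modulus nu T y t t' w : 0 <= t <= T -> 0 <= t' <= T -> ucont y ->
  (forall u, u <= 0 -> y u = 0) ->
  (forall s, 0 <= s <= T -> `|y (t - s) - y (t' - s)| <= w) ->
  `|lconv nu y t - lconv nu y t'| <= w * variation nu T.
Proof.
move=> tT t'T uy y0 yw; rewrite (lconv_fullE _ tT y0) (lconv_fullE _ t'T y0) mulrDr.
have my : measurable_fun [set: measurableTypeR R] (y : measurableTypeR R -> R).
  exact: continuous_measurable_fun (ucont_continuous uy).
have mD s : mfun_on `[0, T] (fun u => y (s - u)).
  by apply: measurable_funTS; apply: (measurableT_comp my (measurable_rev s)).
have [Y Y0 yY] := ucont_on_bounded (@ucont_sub _ _ T _ uy).
have yb s u : 0 <= s <= T -> `[0, T]%classic u -> `|y (s - u)| <= Y.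
  move=> /andP[s0 sT]; rewrite /= in_itv/= => /andP[u0 uT].
  have [su|su] := leP (s - u) 0; first by rewrite y0// normr0.
  by apply: yY; rewrite ltW//= lerBlDr (le_trans sT)// lerDl.
have ib s (mu : {measure set (measurableTypeR R) -> \bar R}) :
    (mu `[0%R, T] < +oo)%E -> 0 <= s <= T ->
    mu.-integrable `[0, T] (EFin \o (fun u => y (s - u))).
  move=> muoo sT; apply: (integrable_bounded (M := Y)) => //.
  by move=> u uT; exact: yb.
have [pf nf] := (lbv_pos_fin nu T, lbv_neg_fin nu T).
have rearrange (A B C D : R) : A - B - (C - D) = (A - C) - (B - D) by ring.
rewrite rearrange -RintegralB//; [|exact: ib..].
rewrite -RintegralB//; [|exact: ib..].
apply: (le_trans (ler_normB _ _)).
by apply: lerD; apply: normr_Rintegral_le_cst => //; exact: measurable_funB.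
Qed.

End lbv_convolution.

Definition entry (R : realType) m n (K : R -> 'M[R]_(m, n)) i j : R -> R :=
  fun u => K u i j.

Definition coord (R : realType) n (z : R -> 'cV[R]_n) j : R -> R :=
  fun u => z u j ord0.

(** * Matrix kernels and the inverse relations *)

Section matrix_norm.
Variable R : realType.

Lemma le_mx_norm m n (A : 'M[R]_(m, n)) i j : `|A i j| <= `|A|.
Proof.
rewrite [leRHS](_ : _ = mx_norm A)// mx_normrE; apply/bigmax_geP; right.
by exists (i, j).
Qed.

Lemma mx_norm_le m n (A : 'M[R]_(m, n)) (M : R) : 0 <= M ->
  (forall i j, `|A i j| <= M) -> `|A| <= M.
Proof.
move=> M0 AM; rewrite [leLHS](_ : _ = mx_norm A)// mx_normrE; apply/bigmax_leP.
by split => // -[i j] _ /=; exact: AM.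
Qed.

Lemma normr_mulmx_le m n (A : 'M[R]_(m, n)) (v : 'cV[R]_n) :
  `|A *m v| <= n%:R * `|A| * `|v|.
Proof.
apply: mx_norm_le => [|i j]; first by rewrite !mulr_ge0.
rewrite mxE; apply: (le_trans (ler_norm_sum _ _ _)).
apply: (@le_trans _ _ (\sum_(k < n) `|A| * `|v|)).
  by apply: ler_sum => k _; rewrite normrM ler_pM// le_mx_norm.
by rewrite sumr_const card_ord -[leLHS]mulr_natl mulrA.
Qed.

Lemma ucont_on_coord n T (z : R -> 'cV[R]_n) j : ucont_on T z ->
  ucont_on T (coord z j).
Proof.
move=> uz e /uz[del del0 h]; exists del => // s t sT tT st.
apply: le_lt_trans (h _ _ sT tT st).
by have := le_mx_norm (z s - z t) j ord0; rewrite !mxE.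
Qed.

Lemma ucont_coord n (z : R -> 'cV[R]_n) j : ucont z -> ucont (coord z j).
Proof.
move=> uz e /uz[del del0 h]; exists del => // s t st.
apply: le_lt_trans (h _ _ st).
by have := le_mx_norm (z s - z t) j ord0; rewrite !mxE.
Qed.

Lemma ucont_on_sum (I : Type) (r : seq I) T (g : I -> R -> R) :
  (forall i, ucont_on T (g i)) -> ucont_on T (fun t => \sum_(i <- r) g i t).
Proof.
move=> ug; elim: r => [|i r ih] e e0.
  by exists 1 => // s t _ _ _; rewrite !big_nil subrr normr0.
have e20 : 0 < e / 2 by rewrite divr_gt0.
have [d1 d10 H1] := ug i _ e20; have [d2 d20 H2] := ih _ e20.
exists (Num.min d1 d2); first by rewrite lt_min d10.
move=> s t sT tT; rewrite lt_min => /andP[/(H1 _ _ sT tT) h1 /(H2 _ _ sT tT) h2].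
rewrite !big_cons opprD addrACA.
by apply: (le_lt_trans (ler_normD _ _)); lra.
Qed.

Lemma ucont_on_mx n T (z : R -> 'cV[R]_n) :
  (forall j, ucont_on T (coord z j)) -> ucont_on T z.
Proof.
move=> uz e e0; have e20 : 0 < e / 2 by rewrite divr_gt0.
have /choice[del hdel] : forall j, exists del : R, 0 < del /\
    forall s t : R, 0 <= s <= T -> 0 <= t <= T -> `|s - t| < del ->
    `|coord z j s - coord z j t| < e / 2.
  by move=> j; have [del del0 h] := uz j _ e20; exists del.
exists (\big[Num.min/1]_j del j).
  by apply/bigmin_gtP; split => // j _; case: (hdel j).
move=> s t sT tT st; apply: (@le_lt_trans _ _ (e / 2)); last by lra.
apply: mx_norm_le => [|i j]; first exact: ltW.
rewrite ord1 !mxE; apply/ltW; case: (hdel i) => _; apply => //.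
by move/bigmin_gtP : st => [_]; apply.
Qed.

End matrix_norm.

Section matrix_derivative.
Variables (R : realType) (d : nat).
Implicit Types K : R -> 'M[R]_d.

Lemma is_derive_coord K i j (u : R) : derivable K u 1 ->
  is_derive u (1 : R) (entry K i j) (entry (derive1 K) i j u).
Proof.
move=> dK.
have cv : (fun h : R => h^-1 *: (K (h *: (1 : R) + u) - K u)) @ 0^' --> derive1 K u.
  by rewrite derive1E; exact: dK.
have cvij : (fun h : R => h^-1 *: (K (h *: (1 : R) + u) i j - K u i j)) @ 0^' --> derive1 K u i j.
  have := cvg_comp _ _ cv (@coord_continuous _ _ _ i j (derive1 K u)).
  apply: cvg_trans; apply: near_eq_cvg; near=> h.
  by rewrite /= !mxE.
by split; [apply/cvg_ex; eexists; exact: cvij|exact/cvg_lim].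
Unshelve. all: by end_near. Qed.

Lemma derivable_continuous_mx K (u : R) : derivable K u 1 -> {for u, continuous K}.
Proof. by move=> dK; apply/differentiable_continuous/derivable1_diffP. Qed.

Lemma continuous_coord K i j (u : R) : {for u, continuous K} ->
  {for u, continuous (entry K i j)}.
Proof.
by move=> cK; exact: (cvg_comp _ _ cK (@coord_continuous _ _ _ i j (K u))).
Qed.

End matrix_derivative.

Section operators_extensionality.
Variables (R : realType) (d : nat).
Local Notation leb := (@lebesgue_measure R).
Implicit Types (K : R -> 'M[R]_d) (x z : R -> 'cV[R]_d) (L : mx_measure R d).

Lemma Gammaop_eq K z z' t : 0 <= t -> (forall s, 0 <= s <= t -> z s = z' s) ->
  Gammaop K z t = Gammaop K z' t.
Proof.
move=> t0 zz'; rewrite /Gammaop zz'; last by rewrite t0 lexx.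
congr (_ + _); apply/colP => i; rewrite !mxE; apply: eq_Rintegral => s /set_mem.
by rewrite /= in_itv/= => st; rewrite zz'.
Qed.

Lemma Gammaop_sumE K z t i : (forall j, leb.-integrable `[0, t]
    (EFin \o (fun s => entry (derive1 K) i j (t - s) * (coord z j s - coord z j t)))) ->
  Gammaop K z t i ord0 =
  \sum_j sGamma (entry K i j) (entry (derive1 K) i j) (coord z j) t.
Proof.
move=> h; rewrite /Gammaop !mxE /sGamma big_split/=; congr (_ + _).
rewrite -(Rintegral_sum _ _ h)//; apply: eq_Rintegral => s _.
by rewrite mxE; apply: eq_bigr => j _; rewrite !mxE.
Qed.

Lemma Zop_sumE L x t i : Zop L x t i ord0 =
  \sum_k lconv (L i k) (fun u => coord x k u - coord x k 0) t.
Proof.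
rewrite /Zop /int_mvec mxE; apply: eq_bigr => k _.
by rewrite /lbv_integral /lconv; congr (_ - _); apply: eq_Rintegral => s _; rewrite !mxE.
Qed.

Lemma lconv_sum (nu : lbv_measure R) (t : R) (a : 'I_d -> R -> R) :
  (forall j, lbv_integrable nu `[0, t] (fun s => a j (t - s))) ->
  lconv nu (fun u => \sum_j a j u) t = \sum_j lconv nu (a j) t.
Proof.
move=> ha; rewrite /lconv /mconv.
rewrite (@Rintegral_sum _ _ _ _ _ (fun j s => a j (t - s)))//; last by move=> j; case: (ha j).
rewrite (@Rintegral_sum _ _ _ _ _ (fun j s => a j (t - s)))//; last by move=> j; case: (ha j).
by rewrite sumrB.
Qed.

Lemma conv_eq_cst (a y : R -> R) (c t : R) :
  leb.-integrable `[0, t] (EFin \o (fun s => a (t - s) * y s)) ->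
  leb.-integrable `[0, t] (EFin \o y) ->
  (forall u, 0 < u <= t -> a u = c) ->
  conv a y t = c * \int[leb]_(s in `[0, t]) y s.
Proof.
move=> ia iy ac; rewrite -RintegralZl// /conv.
have sub : `[0, t[%classic `<=` `[0, t]%classic.
  by apply: subset_itvl; rewrite bnd_simp.
have icy : leb.-integrable `[0, t] (EFin \o (fun s => c * y s)) by exact: integrableRZ.
rewrite -(@Rintegral_itv_bndo_bndc _ _ t (fun s => a (t - s) * y s)); last exact: integrableS ia.
rewrite -(@Rintegral_itv_bndo_bndc _ _ t (fun s => c * y s)); last exact: integrableS icy.
apply: eq_Rintegral => s /set_mem; rewrite /= in_itv/= => /andP[s0 st].
by rewrite ac// subr_gt0 st/= lerBlDr lerDl.
Qed.

End operators_extensionality.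

Section inverse_operators.
Variables (R : realType) (d : nat) (T : R) (K : R -> 'M[R]_d) (L : mx_measure R d).
Local Notation leb := (@lebesgue_measure R).
Local Notation mfun_on D f :=
  (measurable_fun (D : set (measurableTypeR R)) (f : measurableTypeR R -> R)).
Local Notation k i j := (entry K i j).
Local Notation f i j := (entry (derive1 K) i j).

Hypothesis T0 : 0 < T.
Hypothesis dk : forall i j (u : R), 0 < u -> is_derive u (1 : R) (k i j) (f i j u).
Hypothesis cf : forall i j (u : R), 0 < u -> {for u, continuous (f i j)}.

(** The arguments on which the integral in Gamma converges like that of
    u^(beta - 1) near 0: Hoelder functions of exponent eta vanishing at 0, with
    beta = eta + alpha - 1, when K' is O(u^(alpha - 2)), and all continuous
    functions vanishing at 0, with beta = 1, when K' is bounded. *)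
Definition regular (beta M : R) (y : R -> 'cV[R]_d) := [/\ ucont y,
  forall u, u <= 0 -> y u = 0 &
  forall i j u s, 0 < u <= T -> 0 <= s <= T ->
    `|f i j u * (coord y j (s - u) - coord y j s)| <= M * u `^ (beta - 1)].

Section regular_argument.
Variables (beta M : R) (y : R -> 'cV[R]_d).
Hypothesis beta0 : 0 < beta.
Hypothesis M0 : 0 <= M.
Hypothesis ry : regular beta M y.

Let uy j : ucont (coord y j).
Proof. by case: ry => + _ _; exact: ucont_coord. Qed.

Let y0 j u : u <= 0 -> coord y j u = 0.
Proof. by case: ry => _ + _ u0; rewrite /coord => ->; rewrite ?mxE. Qed.

Let reg i j u s : 0 < u <= T -> 0 <= s <= T ->
  `|f i j u * (coord y j (s - u) - coord y j s)| <= M * u `^ (beta - 1).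
Proof. by case: ry => _ _; exact. Qed.

Lemma regular_GammaE t i : 0 <= t <= T -> Gammaop K y t i ord0 =
  \sum_j sGamma (k i j) (f i j) (coord y j) t.
Proof.
move=> tT; apply: Gammaop_sumE => j.
exact: (sGamma_integrable T0 (@cf i j) (@uy j) beta0 M0 (@reg i j) tT).
Qed.

Lemma regular_Gamma_ucont : ucont_on T (Gammaop K y).
Proof.
apply: ucont_on_mx => i.
apply: (@ucont_on_eq _ _ _ (fun t => \sum_j sGamma (k i j) (f i j) (coord y j) t)).
  by move=> t tT; rewrite -regular_GammaE.
have h j : ucont_on T (sGamma (k i j) (f i j) (coord y j)).
  exact: (sGamma_ucont T0 (@dk i j) (@cf i j) (@uy j) (@y0 j) beta0 M0 (@reg i j)).
exact: ucont_on_sum.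
Qed.

Lemma regular_Gamma0 : Gammaop K y 0 = 0.
Proof.
apply/colP => i; rewrite regular_GammaE ?lexx ?(ltW T0)// mxE big1// => j _.
by rewrite /sGamma set_itv1 Rintegral_set1 y0// mulr0 addr0.
Qed.

Lemma regular_Gamma_modulus t t' h w i : 0 <= t <= T -> 0 <= t' <= T ->
  0 < h <= T -> (forall u, 0 <= u <= T -> `|y (t - u) - y (t' - u)| <= w) ->
  `|Gammaop K y t i ord0 - Gammaop K y t' i ord0| <=
    \sum_j ((`|k i j T| + 2 * \int[leb]_(u in `[h, T]) `|f i j u|) * w +
            2 * (M * (h `^ beta / beta))).
Proof.
move=> tT t'T hT yw.
rewrite [X in `|X - _|](regular_GammaE i tT) [X in `|_ - X|](regular_GammaE i t'T) -sumrB.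
apply: (le_trans (ler_norm_sum _ _ _)); apply: ler_sum => j _.
apply: (sGamma_modulus T0 (@dk i j) (@cf i j) (@uy j) (@y0 j) beta0 M0 (@reg i j)) => // u uT.
apply: le_trans (yw u uT); rewrite /coord.
by have := le_mx_norm (y (t - u) - y (t' - u)) j ord0; rewrite !mxE.
Qed.

Variables (alpha N : R).
Hypothesis alpha0 : 0 < alpha <= 1.
Hypothesis N0 : 0 <= N.
Hypothesis kN : forall i j u, 0 < u <= T -> `|k i j u| <= N * u `^ (alpha - 1).

Lemma regular_Gamma_primitive t i : 0 <= t <= T ->
  \int[leb]_(s in `[0, t]) coord (Gammaop K y) i s = \sum_j conv (k i j) (coord y j) t.
Proof.
move=> /[dup] tT /andP[t0 tT'].
have ij j : leb.-integrable `[0, t] (EFin \o sGamma (k i j) (f i j) (coord y j)).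
  have uG := sGamma_ucont T0 (@dk i j) (@cf i j) (@uy j) (@y0 j) beta0 M0 (@reg i j).
  by apply: integrableS (ucont_on_integrable uG) => //; apply: subset_itvl; rewrite bnd_simp.
transitivity (\int[leb]_(s in `[0, t]) \sum_j sGamma (k i j) (f i j) (coord y j) s).
  apply: eq_Rintegral => s /set_mem; rewrite /= in_itv/= => /andP[s0 st].
  by rewrite /coord regular_GammaE// s0 (le_trans st).
rewrite (Rintegral_sum _ _ ij)//; apply: eq_bigr => j _.
exact: (sGamma_primitive T0 (@dk i j) (@cf i j) (@uy j) (@y0 j) beta0 M0 (@reg i j)
  alpha0 N0 (@kN i j)).
Qed.

Lemma entry_integrable i j : leb.-integrable `[0, T] (EFin \o k i j).
Proof. exact: (kernel_integrable T0 (@dk i j) alpha0 N0 (@kN i j)). Qed.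

End regular_argument.

Hypothesis resL : resolvent_first_kind K L.

Lemma resolvent_KL i j (t : R) : 0 < t ->
  \sum_l lconv (L l j) (k i l) t = (i == j)%:R.
Proof. by move=> /resL[_ /matrixP/(_ i j) + _]; rewrite !mxE. Qed.

Lemma resolvent_LK i j (t : R) : 0 < t ->
  \sum_l lconv (L i l) (k l j) t = (i == j)%:R.
Proof. by move=> /resL[_ _ /matrixP/(_ i j)]; rewrite !mxE. Qed.

Section origin_argument.
Variable x : R -> 'cV[R]_d.
Hypothesis Cx : ucont_on T x.

(* Composing with clamp first makes y vanish before the time 0. *)
Let y u := x (clamp T u) - x 0.

Let T0' : 0 <= T. Proof. exact: ltW. Qed.

Lemma shift_ucont : ucont y.
Proof.
move=> e e0; have [del del0 h] := ucont_clamp T0' Cx e0; exists del => // s t st.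
by rewrite /y opprB addrA subrK; exact: h.
Qed.

Lemma shift_le0 u : u <= 0 -> y u = 0.
Proof. by move=> u0; rewrite /y clamp_le0// subrr. Qed.

Lemma Zop_shiftE t i : 0 <= t <= T ->
  Zop L x t i ord0 = \sum_l lconv (L i l) (coord y l) t.
Proof.
move=> /andP[t0 tT]; rewrite Zop_sumE; apply: eq_bigr => l _.
apply: eq_lconv => u; rewrite /= in_itv/= => /andP[u0 ut].
by rewrite /y /coord clamp_id ?u0 ?(le_trans ut)// !mxE.
Qed.

Lemma coord_shift_ucont l : ucont (coord y l).
Proof. exact: ucont_coord shift_ucont. Qed.

Lemma coord_shift_le0 l u : u <= 0 -> coord y l u = 0.
Proof. by move=> u0; rewrite /coord shift_le0// mxE. Qed.

Lemma Zop_modulus t t' w : 0 <= w -> 0 <= t <= T -> 0 <= t' <= T ->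
  (forall s, 0 <= s <= T -> `|y (t - s) - y (t' - s)| <= w) ->
  `|Zop L x t - Zop L x t'| <= w * \sum_i \sum_l variation (L i l) T.
Proof.
move=> w0 tT t'T yw.
have V0 i : 0 <= \sum_l variation (L i l) T by apply: sumr_ge0 => l _; exact: variation_ge0.
apply: mx_norm_le => [|i j]; first by rewrite mulr_ge0// sumr_ge0.
rewrite ord1 [X in `|X|]mxE [X in _ + X]mxE (Zop_shiftE i tT) (Zop_shiftE i t'T) -sumrB.
apply: (le_trans (ler_norm_sum _ _ _)).
apply: (@le_trans _ _ (w * \sum_l variation (L i l) T)); last first.
  by rewrite ler_wpM2l// [leRHS](bigD1 i)//= lerDl sumr_ge0.
rewrite mulr_sumr; apply: ler_sum => l _.
apply: lconv_modulus => //; first exact: coord_shift_ucont.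
  exact: coord_shift_le0.
move=> s sT; apply: le_trans (yw s sT).
by have := le_mx_norm (y (t - s) - y (t' - s)) l ord0; rewrite /coord !mxE.
Qed.

Lemma Zop_bound t w : 0 <= w -> 0 <= t <= T ->
  (forall s, 0 <= s <= T -> `|y (t - s)| <= w) ->
  `|Zop L x t| <= w * \sum_i \sum_l variation (L i l) T.
Proof.
move=> w0 tT yw.
have V0 i : 0 <= \sum_l variation (L i l) T by apply: sumr_ge0 => l _; exact: variation_ge0.
apply: mx_norm_le => [|i j]; first by rewrite mulr_ge0// sumr_ge0.
rewrite ord1 Zop_shiftE//.
apply: (le_trans (ler_norm_sum _ _ _)).
apply: (@le_trans _ _ (w * \sum_l variation (L i l) T)); last first.
  by rewrite ler_wpM2l// [leRHS](bigD1 i)//= lerDl sumr_ge0.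
rewrite mulr_sumr; apply: ler_sum => l _.
apply: normr_lconv_le => //; first exact: coord_shift_ucont.
  exact: coord_shift_le0.
move=> s sT; apply: le_trans (yw s sT).
exact: le_mx_norm.
Qed.

Lemma Zop_ucont : ucont_on T (Zop L x).
Proof.
move=> e e0; pose V := \sum_i \sum_l variation (L i l) T.
have V0 : 0 <= V by apply: sumr_ge0 => i _; apply: sumr_ge0 => l _; exact: variation_ge0.
have e20 : 0 < e / (V + 1) by rewrite divr_gt0// ltr_pwDr.
have [del del0 h] := shift_ucont e20; exists del => // s t sT tT st.
apply: (@le_lt_trans _ _ (e / (V + 1) * V)).
  apply: Zop_modulus => //; first exact: ltW.
  move=> u uT; apply/ltW/h.
  by have -> : s - u - (t - u) = s - t by ring.
rewrite mulrAC -mulrA -[ltRHS]mulr1 ltr_pM2l// ltr_pdivrMr ?mul1r ?ltrDl//.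
by rewrite ltr_pwDr.
Qed.

Lemma Zop_at0 : Zop L x 0 = 0.
Proof.
apply/colP => i; rewrite Zop_shiftE ?lexx// mxE big1// => l _.
rewrite /lconv /mconv set_itv1.
have e mu : \int[mu]_(s in [set 0%R : measurableTypeR R]) coord y l (0 - s) = 0.
  rewrite (@eq_Rintegral _ _ _ mu _ (cst 0)); first by rewrite Rintegral_cst// mul0r.
  by move=> s /set_mem ->; rewrite subr0 coord_shift_le0.
by rewrite !e subrr.
Qed.

End origin_argument.

Section resolvent_convolution.
Hypothesis ik : forall i j, leb.-integrable `[0, T] (EFin \o k i j).
Variables (s : R) (b : 'I_d -> R -> R) (Y : R).
Hypothesis sT : 0 <= s <= T.
Hypothesis mb : forall l, mfun_on `[0, s] (b l).
Hypothesis Y0 : 0 <= Y.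
Hypothesis bY : forall l u, `[0, s]%classic u -> `|b l u| <= Y.

Let s0 : 0 <= s. Proof. by case/andP : sT. Qed.

Let iks i j : leb.-integrable `[0, s] (EFin \o k i j).
Proof.
apply: integrableS (ik i j) => //; apply: subset_itvl; rewrite bnd_simp.
by case/andP : sT.
Qed.

Let ib l : leb.-integrable `[0, s] (EFin \o b l).
Proof. by apply: (integrable_bounded (M := Y)) => //; [exact: leb_itv0_lty|exact: bY]. Qed.

Lemma conv_delta (a : 'I_d -> 'I_d -> R -> R) i :
  (forall j l, leb.-integrable `[0, s] (EFin \o (fun r => a j l (s - r) * b l r))) ->
  (forall l u, 0 < u <= s -> \sum_j a j l u = (i == l)%:R) ->
  \sum_l \sum_j conv (a j l) (b l) s = \int[leb]_(u in `[0, s]) b i u.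
Proof.
move=> ia aE.
transitivity (\sum_l (i == l)%:R * \int[leb]_(u in `[0, s]) b l u).
  apply: eq_bigr => l _.
  rewrite /conv -(Rintegral_sum _ _ (fun j => ia j l))//.
  transitivity (conv (fun u => \sum_j a j l u) (b l) s).
    by apply: eq_Rintegral => r _; rewrite mulr_suml.
  apply: conv_eq_cst => //; last exact: aE.
  apply: (@integrableR_eq _ _ _ (fun r => \sum_j (a j l (s - r) * b l r))) => //.
    by move=> r _; rewrite mulr_suml.
  by apply: integrableR_sum => // j; exact: ia.
rewrite (bigD1 i)//= eqxx mul1r big1 ?addr0// => l li.
by rewrite eq_sym (negbTE li) mul0r.
Qed.

(** K * (L * b) = (K * L) * b = I * b, the primitive of b. *)
Lemma conv_KL i :
  \sum_j conv (k i j) (fun u => \sum_l lconv (L j l) (b l) u) s =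
  \int[leb]_(u in `[0, s]) b i u.
Proof.
have sw j l := lconv_swap (L j l) s0 (iks i j) (mb l) Y0 (@bY l).
rewrite -(@conv_delta (fun j l => lconv (L j l) (k i j))).
- rewrite exchange_big/=; apply: eq_bigr => j _.
  rewrite /conv; under eq_Rintegral do rewrite mulr_sumr.
  rewrite (@Rintegral_sum _ _ _ _ _ (fun l r => k i j (s - r) * lconv (L j l) (b l) r))//.
    by apply: eq_bigr => l _; case: (sw j l).
  by move=> l; case: (sw j l).
- by move=> j l; case: (sw j l).
- by move=> l u /andP[u0 us]; exact: resolvent_KL.
Qed.

(** L * (K * b) = (L * K) * b = I * b, the primitive of b. *)
Lemma lconv_LK i :
  \sum_l lconv (L i l) (fun u => \sum_j conv (k l j) (b j) u) s =
  \int[leb]_(u in `[0, s]) b i u.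
Proof.
have sw l j := lconv_swap (L i l) s0 (iks l j) (mb j) Y0 (@bY j).
rewrite -(@conv_delta (fun l j => lconv (L i l) (k l j))).
- rewrite exchange_big/=; apply: eq_bigr => l _.
  rewrite lconv_sum; last by move=> j; case: (sw l j).
  by apply: eq_bigr => j _; case: (sw l j).
- by move=> l j; case: (sw l j).
- by move=> j u /andP[u0 us]; exact: resolvent_LK.
Qed.

End resolvent_convolution.

Section inverses.
Variables (alpha N beta M : R).
Hypothesis alpha0 : 0 < alpha <= 1.
Hypothesis N0 : 0 <= N.
Hypothesis kN : forall i j u, 0 < u <= T -> `|k i j u| <= N * u `^ (alpha - 1).
Hypothesis beta0 : 0 < beta.
Hypothesis M0 : 0 <= M.

Let ik i j : leb.-integrable `[0, T] (EFin \o k i j).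
Proof. exact: (entry_integrable alpha0 N0 kN). Qed.

Let T0' : 0 <= T. Proof. exact: ltW. Qed.

(** Both sides have the same primitive, K * (L * (x - x_0)) by
    [regular_Gamma_primitive] and [conv_KL]. *)
Lemma Gamma_Zop x t : ucont_on T x -> regular beta M (fun u => Zop L x (clamp T u)) ->
  0 <= t <= T -> Gammaop K (Zop L x) t = x t - x 0.
Proof.
move=> Cx rz tT; set zc := fun u => _ in rz.
rewrite (@Gammaop_eq _ _ _ _ zc); first last.
- move=> r /andP[r0 rt]; rewrite /zc clamp_id// r0 (le_trans rt)//.
  by case/andP : tT.
- by case/andP : tT.
pose y u := x (clamp T u) - x 0.
have uy l : ucont (coord y l) by exact: coord_shift_ucont.
apply/colP => i.
suff : coord (Gammaop K zc) i t - coord y i t = 0.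
  by move/eqP; rewrite subr_eq0 /coord /y clamp_id// => /eqP.
apply: (@ucont_on_eq0 _ T (fun t => coord (Gammaop K zc) i t - coord y i t)) => //.
  apply: ucont_onB; last exact: ucont_sub.
  by apply: ucont_on_coord; apply: (regular_Gamma_ucont beta0 M0 rz).
move=> r rT.
have sub : `[0, r]%classic `<=` `[0, T]%classic.
  by apply: subset_itvl; rewrite bnd_simp; case/andP : rT.
have iG : leb.-integrable `[0, r] (EFin \o coord (Gammaop K zc) i).
  apply: integrableS (ucont_on_integrable (T := T) _) => //.
  by apply: ucont_on_coord; apply: (regular_Gamma_ucont beta0 M0 rz).
have iy : leb.-integrable `[0, r] (EFin \o coord y i).
  by apply: integrableS (ucont_on_integrable (T := T) _) => //; exact: ucont_sub.
rewrite RintegralB// (regular_Gamma_primitive beta0 M0 rz alpha0 N0 kN)//.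
have [Y Y0 yY] := ucont_on_bounded (@ucont_sub _ _ T _ (shift_ucont Cx)).
rewrite -[X in _ - X](@conv_KL ik r (coord y) Y)//.
- apply/eqP; rewrite subr_eq0; apply/eqP; apply: eq_bigr => j _.
  apply: eq_Rintegral => u /set_mem /sub; rewrite /= in_itv/= => uT.
  by congr (_ * _); rewrite -(Zop_shiftE x j uT) /coord /zc clamp_id.
- move=> l; apply: measurable_funTS.
  exact: continuous_measurable_fun (ucont_continuous (uy l)).
- move=> l u /sub; rewrite /= in_itv/= => /yY; apply: le_trans.
  exact: le_mx_norm.
Qed.

(** Both sides have the same primitive, L * (K * y) by [lconv_primitive],
    [regular_Gamma_primitive] and [lconv_LK]. *)
Lemma Zop_Gamma y t : regular beta M y -> 0 <= t <= T ->
  Zop L (Gammaop K y) t = y t.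
Proof.
move=> ry tT.
have uG := regular_Gamma_ucont beta0 M0 ry.
have G0 : Gammaop K y 0 = 0 := regular_Gamma0 beta0 M0 ry.
have uZ : ucont_on T (Zop L (Gammaop K y)) by exact: Zop_ucont.
have [uy y0 _] := ry.
have uyj j : ucont (coord y j) by exact: ucont_coord.
apply/colP => i.
suff : coord (Zop L (Gammaop K y)) i t - coord y i t = 0.
  by move/eqP; rewrite subr_eq0 => /eqP.
apply: (@ucont_on_eq0 _ T (fun t => coord (Zop L (Gammaop K y)) i t - coord y i t)) => //.
  by apply: ucont_onB; [exact: ucont_on_coord|exact: ucont_sub].
move=> r /[dup] rT /andP[r0 rT'].
have sub : `[0, r]%classic `<=` `[0, T]%classic.
  by apply: subset_itvl; rewrite bnd_simp.
have iZ : leb.-integrable `[0, r] (EFin \o coord (Zop L (Gammaop K y)) i).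
  by apply: integrableS (ucont_on_integrable (ucont_on_coord i uZ)).
have iy : leb.-integrable `[0, r] (EFin \o coord y i).
  by apply: integrableS (ucont_on_integrable (T := T) _) => //; exact: ucont_sub.
have [Y Y0 yY] := ucont_on_bounded (@ucont_sub _ _ T _ uy).
have [Q Q0 GQ] := ucont_on_bounded uG.
have mG l : mfun_on `[0, r] (coord (Gammaop K y) l).
  exact: measurable_funS (ucont_on_measurable (ucont_on_coord l uG)).
have GQr l u : `[0, r]%classic u -> `|coord (Gammaop K y) l u| <= Q.
  move=> /sub; rewrite /= in_itv/= => /GQ; apply: le_trans.
  exact: le_mx_norm.
have prim l := lconv_primitive (L i l) r0 (mG l) Q0 (@GQr l).
rewrite RintegralB//.
transitivity (\int[leb]_(u in `[0, r]) (\sum_l lconv (L i l) (coord (Gammaop K y) l) u) -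
  \int[leb]_(u in `[0, r]) coord y i u).
  congr (_ - _); apply: eq_Rintegral => u _.
  rewrite /coord Zop_sumE; apply: eq_bigr => l _; apply: eq_lconv => v _.
  by rewrite [coord _ l 0]/coord G0 mxE subr0.
rewrite (@Rintegral_sum _ _ _ _ _
  (fun l u => lconv (L i l) (coord (Gammaop K y) l) u))//; last first.
  by move=> l; case: (prim l).
rewrite -[X in _ - X](@lconv_LK ik r (coord y) Y)//.
- apply/eqP; rewrite subr_eq0; apply/eqP; apply: eq_bigr => l _.
  case: (prim l) => _ ->; apply: eq_lconv => u /sub; rewrite /= in_itv/= => uT.
  exact: (regular_Gamma_primitive beta0 M0 ry alpha0 N0 kN).
- move=> l; apply: measurable_funTS.
  exact: continuous_measurable_fun (ucont_continuous (uyj l)).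
- move=> l u /sub; rewrite /= in_itv/= => /yY; apply: le_trans.
  exact: le_mx_norm.
Qed.

End inverses.

End inverse_operators.

(** * Positive semidefinite matrices *)

Section positive_semidefinite.
Variables (R : realType) (d : nat).
Implicit Types A : 'M[R]_d.

Lemma cquad2E A i j (c : R[i]) :
  cquad A (delta_mx i ord0 + c *: delta_mx j ord0) =
  (A i i)%:C%C + c * (A i j)%:C%C + conjc c * (A j i)%:C%C + conjc c * c * (A j j)%:C%C.
Proof.
rewrite /cquad.
have -> : (map_mx conjc (delta_mx i ord0 + c *: delta_mx j ord0))^T =
    delta_mx ord0 i + conjc c *: delta_mx ord0 j :> 'rV[R[i]]_d.
  apply/rowP => l; rewrite !mxE/= rmorphD rmorphM/= !andbT.
  by rewrite !conjc_nat.
set B := map_mx _ A.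
pose q (u : 'rV[R[i]]_d) (v : 'cV[R[i]]_d) : R[i] := (u *m B *m v) ord0 ord0.
have qDl u u' v : q (u + u') v = q u v + q u' v by rewrite /q !mulmxDl mxE.
have qDr u v v' : q u (v + v') = q u v + q u v' by rewrite /q !mulmxDr mxE.
have qZl a u v : q (a *: u) v = a * q u v by rewrite /q -!scalemxAl mxE.
have qZr a u v : q u (a *: v) = a * q u v by rewrite /q -!scalemxAr mxE.
have e p r : q (delta_mx ord0 p) (delta_mx r ord0) = (A p r)%:C%C.
  by rewrite /q -rowE -colE !mxE.
rewrite -[LHS]/(q _ _) !qDl !qDr !qZl !qZr !e; ring.
Qed.

Lemma mx_ge0_diag A i : mx_ge0 A -> 0 <= A i i.
Proof.
move=> /(_ (delta_mx i ord0 + 0 *: delta_mx i ord0)).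
by rewrite cquad2E conjc0 !mul0r !addr0 lecE/= eqxx.
Qed.

(** A quadratic form over the complex vectors that takes real values comes from
    a symmetric matrix. *)
Lemma mx_ge0_sym A i j : mx_ge0 A -> A i j = A j i.
Proof.
move=> /(_ (delta_mx i ord0 + 'i%C *: delta_mx j ord0)).
rewrite cquad2E/=; simpc => /andP[/eqP h _].
lra.
Qed.

(** The form at e_i + e_j and at e_i - e_j gives
    2 |A i j| <= A i i + A j j. *)
Lemma mx_ge0_entry_le A i j : mx_ge0 A -> `|A i j| <= \sum_l A l l.
Proof.
move=> A0; have D l := mx_ge0_diag l A0.
have tr l : A l l <= \sum_l A l l.
  by rewrite (bigD1 l)//= lerDl sumr_ge0.
have bd (c : R) : c ^+ 2 = 1 -> - (c * A i j) *+ 2 <= A i i + A j j.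
  move=> c1; have := A0 (delta_mx i ord0 + c%:C%C *: delta_mx j ord0).
  rewrite cquad2E/= (mx_ge0_sym j i A0); simpc; rewrite -expr2 c1 => h.
  rewrite mulr2n; lra.
have h1 := bd 1; have h2 := bd (-1).
rewrite expr1n mul1r in h1; rewrite sqrrN expr1n mulN1r opprK in h2.
have := h1 erefl; have := h2 erefl; have := tr i; have := tr j.
rewrite !mulr2n => *; rewrite ler_norml; apply/andP; split; lra.
Qed.

End positive_semidefinite.

(** * Continuity of linear operators in Hoelder norms *)

Section bounded_operators.
Variables (R : realType) (d : nat).
Implicit Types (T eta M C : R) (x y z : R -> 'cV[R]_d).

Lemma C_space_ucont T x : C_space T x <-> ucont_on T x.
Proof. by split; [exact: within_ucont_on|exact: ucont_on_within]. Qed.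

Lemma sup_norm_leP T x M :
  (sup_norm T x <= M%:E)%E <-> (forall t, 0 <= t <= T -> `|x t| <= M).
Proof.
split=> [xM t tT|xM].
  rewrite -lee_fin; apply: le_trans xM; apply: ereal_sup_ubound.
  by exists t => //=; rewrite in_itv.
apply: ge_ereal_sup => _ [t /= tT <-].
by rewrite lee_fin; apply: xM; move: tT; rewrite in_itv.
Qed.

Lemma sup_norm_ge0 T x : 0 <= T -> (0 <= sup_norm T x)%E.
Proof.
move=> T0; apply: (@le_trans _ _ `|x 0|%:E); first by rewrite lee_fin.
by apply: ereal_sup_ubound; exists 0 => //=; rewrite in_itv/= lexx.
Qed.

Lemma holder_seminorm_ge0 T eta x : 0 < T -> (0 <= holder_seminorm T eta x)%E.
Proof.
move=> T0; apply: (@le_trans _ _ (`|x 0 - x T| / `|0 - T| `^ eta)%:E).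
  by rewrite lee_fin divr_ge0 ?powR_ge0.
apply: ereal_sup_ubound; exists (0, T) => //=; split; rewrite ?lexx ?(ltW T0)//.
by rewrite lt_eqF.
Qed.

Lemma holder_seminorm_leP T eta x M : 0 <= M ->
  (holder_seminorm T eta x <= M%:E)%E <->
  (forall s t, 0 <= s <= T -> 0 <= t <= T -> `|x s - x t| <= M * `|s - t| `^ eta).
Proof.
move=> M0; split=> [xM s t sT tT|xM].
  have [->|st] := eqVneq s t.
    by rewrite subrr normr0 mulr_ge0// powR_ge0.
  have st0 : 0 < `|s - t| `^ eta by rewrite powR_gt0// normr_gt0 subr_eq0.
  rewrite -ler_pdivrMr// -lee_fin; apply: le_trans xM; apply: ereal_sup_ubound.
  by exists (s, t).
apply: ge_ereal_sup => _ [[s t]/= [sT tT st] <-].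
have st0 : 0 < `|s - t| `^ eta by rewrite powR_gt0// normr_gt0 subr_eq0.
by rewrite lee_fin ler_pdivrMr//; exact: xM.
Qed.

(** Up to a factor 2 this is a bound of the norm by M, in real numbers; for
    the exponent 0 the norm has no seminorm part. *)
Definition holder_bound T eta x M :=
  (forall t, 0 <= t <= T -> `|x t| <= M) /\
  (eta != 0 -> forall s t, 0 <= s <= T -> 0 <= t <= T ->
     `|x s - x t| <= M * `|s - t| `^ eta).

Lemma holder_bound_ge0 T eta x M : 0 <= T -> holder_bound T eta x M -> 0 <= M.
Proof. by move=> T0 [/(_ 0)]; rewrite lexx T0 => /(_ isT) h _; exact: le_trans h. Qed.

Lemma holder_norm_bound T eta x M : 0 < T ->
  (holder_norm T eta x <= M%:E)%E -> holder_bound T eta x M.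
Proof.
move=> T0; rewrite /holder_norm; case: ifPn => [/eqP ->|eta0] h.
  by split; [exact/sup_norm_leP|rewrite eqxx].
have h1 : (sup_norm T x <= M%:E)%E.
  by apply: le_trans h; rewrite leeDl// holder_seminorm_ge0.
have h2 : (holder_seminorm T eta x <= M%:E)%E.
  by apply: le_trans h; rewrite leeDr// sup_norm_ge0// ltW.
have M0 : 0 <= M by rewrite -lee_fin; apply: le_trans h1; rewrite sup_norm_ge0// ltW.
by split => [|_]; [exact/sup_norm_leP|exact/holder_seminorm_leP].
Qed.

Lemma holder_bound_norm T eta x M : 0 < T ->
  holder_bound T eta x M -> (holder_norm T eta x <= (2 * M)%:E)%E.
Proof.
move=> T0 hx; have M0 := holder_bound_ge0 (ltW T0) hx; case: hx => h1 h2.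
rewrite /holder_norm; case: ifPn => [_|eta0].
  by apply/sup_norm_leP => t /h1 /le_trans; apply; lra.
have -> : 2 * M = M + M by ring.
rewrite EFinD; apply: leeD; first exact/sup_norm_leP.
by apply/holder_seminorm_leP => //; exact: h2.
Qed.

Lemma holder_norm_ge0 T eta x : 0 < T -> (0 <= holder_norm T eta x)%E.
Proof.
move=> T0; rewrite /holder_norm; case: ifPn => _; first by rewrite sup_norm_ge0// ltW.
by rewrite adde_ge0 ?sup_norm_ge0 ?holder_seminorm_ge0// ltW.
Qed.

Lemma holder_spaceP T eta x : 0 < T ->
  holder_space T eta x <-> ucont_on T x /\ exists M, holder_bound T eta x M.
Proof.
move=> T0; split.
  move=> [/C_space_ucont Cx xoo]; split => //.
  exists (fine (holder_norm T eta x)); apply: holder_norm_bound => //.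
  by rewrite fineK// ge0_fin_numE// holder_norm_ge0.
move=> [ux [M /(holder_bound_norm T0) xM]]; split; first exact/C_space_ucont.
exact: le_lt_trans xM (ltry _).
Qed.

Lemma holder_boundB T eta x y M M' :
  holder_bound T eta x M -> holder_bound T eta y M' ->
  holder_bound T eta (fun t => y t - x t) (M + M').
Proof.
move=> [x1 x2] [y1 y2]; split=> [t tT|eta0 s t sT tT].
  by rewrite (le_trans (ler_normB _ _))// addrC lerD ?x1 ?y1.
have -> : y s - x s - (y t - x t) = (y s - y t) - (x s - x t).
  by rewrite !opprD !opprK addrACA.
by rewrite (le_trans (ler_normB _ _))// mulrDl addrC lerD ?x2 ?y2.
Qed.

Lemma holder_spaceB T eta x y : 0 < T -> holder_space T eta x ->
  holder_space T eta y -> holder_space T eta (fun t => y t - x t).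
Proof.
move=> T0 /(holder_spaceP _ _ T0)[ux [M xM]] /(holder_spaceP _ _ T0)[uy [M' yM]].
apply/holder_spaceP => //; split; first exact: ucont_onB.
by exists (M + M'); exact: holder_boundB.
Qed.

Lemma holder_norm_eq T eta x y : (forall t, 0 <= t <= T -> x t = y t) ->
  holder_norm T eta x = holder_norm T eta y.
Proof.
move=> xy; have e1 : sup_norm T x = sup_norm T y.
  rewrite /sup_norm; congr ereal_sup; apply: eq_imagel => t /=.
  by rewrite in_itv/= => tT; rewrite xy.
rewrite /holder_norm e1; case: ifPn => // _; congr (_ + _)%E.
rewrite /holder_seminorm; congr ereal_sup; apply: eq_imagel => -[s t] /= [sT tT _].
by rewrite !xy.
Qed.

Lemma sup_norm_holder0 T x : sup_norm T x = holder_norm T 0 x.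
Proof. by rewrite /holder_norm eqxx. Qed.

(** By linearity, a bound of F by C on U is a Lipschitz bound. *)
Lemma bounded_linear_continuous T (U V : set (R -> 'cV[R]_d)) eta eta'
    (F : (R -> 'cV[R]_d) -> R -> 'cV[R]_d) C : 0 < T -> 0 <= C ->
  (forall x, U x -> V (F x)) ->
  (forall x y, U x -> U y -> U (fun t => y t - x t)) ->
  (forall a x y, U x -> U y -> forall t, 0 <= t <= T ->
    F (fun s => a *: x s + y s) t = a *: F x t + F y t) ->
  (forall x M, U x -> holder_bound T eta x M -> holder_bound T eta' (F x) (C * M)) ->
  continuous_linear_operator T U (holder_norm T eta) V (holder_norm T eta') F.
Proof.
move=> T0 C0 UV UB lin bd; split => // x Ux e e0.
(* The factor 2 is the one lost in [holder_bound_norm]. *)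
pose c := 2 * C + 1; have c0 : 0 < c by rewrite ltr_pwDr// mulr_ge0.
exists (e / c); first by rewrite divr_gt0.
move=> y Uy /ltW/(holder_norm_bound T0) hb.
rewrite (@holder_norm_eq _ _ _ (F (fun t => y t - x t))); last first.
  move=> t tT; have := lin (-1) x y Ux Uy t tT.
  rewrite scaleN1r [RHS]addrC => <-; congr (F _ t); apply/funext => s.
  by rewrite scaleN1r addrC.
apply: le_lt_trans (holder_bound_norm T0 (bd _ _ (UB _ _ Ux Uy) hb)) _.
rewrite lte_fin mulrA -[ltRHS](@divfK _ c) ?gt_eqF// mulrC.
by rewrite ltr_pM2l ?divr_gt0// /c ltrDl.
Qed.

End bounded_operators.

(** Only the values of the argument on [0, t] matter. *)
Lemma Zop_eq (R : realType) (d : nat) (L : mx_measure R d) (x y : R -> 'cV[R]_d) t :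
  0 <= t -> (forall s, 0 <= s <= t -> x s = y s) -> Zop L x t = Zop L y t.
Proof.
move=> t0 xy; apply/colP => i; rewrite [LHS]Zop_sumE [RHS]Zop_sumE.
apply: eq_bigr => l _; apply: eq_lconv => u.
by rewrite /= in_itv/= => ut; rewrite /coord !xy// lexx.
Qed.

Section Zop_continuous.
Variables (R : realType) (d : nat) (T : R) (L : mx_measure R d).
Hypothesis T0 : 0 < T.

Lemma ucont_on_lbv_integrable (nu : lbv_measure R) (g : R -> R) t :
  0 <= t <= T -> ucont_on T g -> lbv_integrable nu `[0, t] (fun s => g (t - s)).
Proof.
move=> /andP[t0 tT] ug; have [M M0 gM] := ucont_on_bounded ug.
have sub : `[0, t]%classic `<=` `[0, T]%classic.
  by apply: subset_itvl; rewrite bnd_simp.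
apply: (@lbv_integrable_bounded _ _ _ _ M).
  by apply: measurable_fun_rev; apply: measurable_funS (ucont_on_measurable ug).
by move=> s /rev_itv/sub; rewrite /= in_itv/=; exact: gM.
Qed.

Lemma Zop_linear a (x y : R -> 'cV[R]_d) t : ucont_on T x -> ucont_on T y ->
  0 <= t <= T -> Zop L (fun s => a *: x s + y s) t = a *: Zop L x t + Zop L y t.
Proof.
move=> ux uy tT; apply/colP => i; rewrite [RHS]mxE [X in _ = X + _]mxE !Zop_sumE.
rewrite mulr_sumr -big_split/=; apply: eq_bigr => l _.
rewrite -lconv_lin.
- by apply: eq_lconv => u _; rewrite /coord !mxE; ring.
- apply: (ucont_on_lbv_integrable (L i l) tT (g := fun u => coord x l u - coord x l 0)).
  apply: ucont_onB; first exact: ucont_on_coord.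
  by move=> e e0; exists 1 => // *; rewrite subrr normr0.
- apply: (ucont_on_lbv_integrable (L i l) tT (g := fun u => coord y l u - coord y l 0)).
  apply: ucont_onB; first exact: ucont_on_coord.
  by move=> e e0; exists 1 => // *; rewrite subrr normr0.
Qed.

Let V := \sum_i \sum_l variation (L i l) T.

Let V0 : 0 <= V.
Proof. by apply: sumr_ge0 => i _; apply: sumr_ge0 => l _; exact: variation_ge0. Qed.

Lemma Zop_holder_bound eta x M : 0 <= eta -> ucont_on T x ->
  holder_bound T eta x M -> holder_bound T eta (Zop L x) (2 * V * M).
Proof.
move=> eta0 ux xM; have M0 := holder_bound_ge0 (ltW T0) xM; case: xM => x1 x2.
have T0' := ltW T0.
split=> [t tT|en0 s t sT tT].
  have -> : 2 * V * M = (2 * M) * V by ring.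
  apply: (Zop_bound L T0 ux) => //; first by rewrite mulr_ge0.
  move=> s sT; rewrite (le_trans (ler_normB _ _))//.
  have := x1 _ (clamp_itv (t - s) T0'); have := x1 0; rewrite lexx T0' => /(_ isT); lra.
have st0 : 0 <= `|s - t| `^ eta by exact: powR_ge0.
have h : `|Zop L x s - Zop L x t| <= (M * `|s - t| `^ eta) * V.
  apply: (Zop_modulus L T0 ux) => //; first by rewrite mulr_ge0.
  move=> u uT; rewrite opprB addrA subrK.
  apply: le_trans (x2 en0 _ _ (clamp_itv _ T0') (clamp_itv _ T0')) _.
  rewrite ler_wpM2l// ge0_ler_powR ?nnegrE//.
  apply: le_trans (clamp_dist _ _ T0') _.
  by have -> : s - u - (t - u) = s - t by ring.
apply: (le_trans h); have -> : 2 * V * M * `|s - t| `^ eta = 2 * (M * `|s - t| `^ eta * V) by ring.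
by rewrite ler_peMl ?mulr_ge0//; lra.
Qed.

Lemma Zop_continuous_linear eta : 0 <= eta ->
  continuous_linear_operator T
    (@holder_space R d T eta) (holder_norm T eta)
    (@holder0_space R d T eta) (holder_norm T eta) (Zop L).
Proof.
move=> eta0; apply: (@bounded_linear_continuous _ _ _ _ _ _ _ _ (2 * V)) => //.
- by rewrite mulr_ge0.
- move=> x /(holder_spaceP _ _ T0)[ux [M xM]]; split; last exact: Zop_at0.
  apply/holder_spaceP => //; split; first exact: Zop_ucont.
  by exists (2 * V * M); exact: Zop_holder_bound.
- by move=> x y Ux Uy; exact: holder_spaceB.
- move=> a x y /(holder_spaceP _ _ T0)[ux _] /(holder_spaceP _ _ T0)[uy _] t tT.
  exact: Zop_linear.
- by move=> x M /(holder_spaceP _ _ T0)[ux _]; exact: Zop_holder_bound.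
Qed.

End Zop_continuous.

(** * Linearity and domain of Gamma *)

Section Gamma_integrability.
Variables (R : realType) (d : nat) (K : R -> 'M[R]_d).
Local Notation leb := (@lebesgue_measure R).

Definition Gamma_integrable (z : R -> 'cV[R]_d) t := forall i j,
  leb.-integrable `[0, t] (EFin \o (fun s =>
    entry (derive1 K) i j (t - s) * (coord z j s - coord z j t))).

Lemma Gammaop_linear a (x y : R -> 'cV[R]_d) t :
  Gamma_integrable x t -> Gamma_integrable y t ->
  Gammaop K (fun s => a *: x s + y s) t = a *: Gammaop K x t + Gammaop K y t.
Proof.
move=> ix iy; apply/colP => i; rewrite [RHS]mxE [X in _ = X + _]mxE.
have iax j : leb.-integrable `[0, t] (EFin \o (fun s =>
    a * (entry (derive1 K) i j (t - s) * (coord x j s - coord x j t)))).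
  by apply: integrableRZ => //; exact: ix.
have cE j s : coord (fun s => a *: x s + y s) j s = a * coord x j s + coord y j s.
  by rewrite /coord !mxE.
have iz j : leb.-integrable `[0, t] (EFin \o (fun s => entry (derive1 K) i j (t - s) *
    (coord (fun s => a *: x s + y s) j s - coord (fun s => a *: x s + y s) j t))).
  apply: integrableR_eq (integrableRD _ (iax j) (iy i j)) => // s _.
  by rewrite !cE; ring.
rewrite [LHS](Gammaop_sumE iz) [X in _ = _ * X + _](Gammaop_sumE (ix i)).
rewrite [X in _ = _ + X](Gammaop_sumE (iy i)).
rewrite mulr_sumr -big_split/=; apply: eq_bigr => j _.
rewrite /sGamma cE mulrDr [X in _ = X + _]mulrDr addrACA; congr (_ + _); first by ring.
have ixj := ix i j; have iyj := iy i j; have iaxj := iax j.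
rewrite -(RintegralZl a _ ixj)// -(RintegralD _ iaxj iyj)//.
by apply: eq_Rintegral => s _; rewrite !cE; ring.
Qed.

Lemma Gamma_integrable_eq (x y : R -> 'cV[R]_d) t : 0 <= t ->
  (forall s, 0 <= s <= t -> x s = y s) -> Gamma_integrable x t -> Gamma_integrable y t.
Proof.
move=> t0 xy ix i j; apply: integrableR_eq (ix i j) => // s.
by rewrite /= in_itv/= => st; rewrite /coord !xy// t0 lexx.
Qed.

End Gamma_integrability.

Section Gamma_domain.
Variables (R : realType) (d : nat) (T : R) (K : R -> 'M[R]_d).
Local Notation leb := (@lebesgue_measure R).
Hypothesis T0 : 0 < T.

(** Integrable bounds of both terms in the definition of the domain. *)
Lemma Gamma_dom_power (z : R -> 'cV[R]_d) (c beta : R) : 0 < beta -> 0 <= c ->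
  ucont_on T z ->
  (forall t, 0 <= t <= T -> `|K t *m z t| <= c * t `^ (beta - 1)) ->
  (forall t s, 0 <= s <= t -> t <= T ->
     `|derive1 K (t - s)| * `|z s - z t| <= c * (t - s) `^ (beta - 1)) ->
  Gamma_dom K T z.
Proof.
move=> b0 c0 uz h1 h2; split; first exact/C_space_ucont.
have ip t : 0 < t -> leb.-integrable `[0, t] (EFin \o (fun u => c * u `^ (beta - 1))).
  by move=> t0; apply: integrableRZ => //; exact: integrable_power.
have bound t : 0 <= t <= T ->
    (\int[leb]_(s in `[0%R, t]) (c * (t - s) `^ (beta - 1))%:E <= (c * (T `^ beta / beta))%:E)%E.
  move=> /andP[]; rewrite le_eqVlt => /predU1P[<- _|t0 tT].
    by rewrite set_itv1 integral_set1 lee_fin mulr_ge0// divr_ge0 ?powR_ge0// ltW.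
  have ir := integrable_rev (ip t t0).
  rewrite -[leLHS]fineK ?(integrable_fin_num _ ir)// lee_fin.
  rewrite -/(Rintegral leb _ _) (Rintegral_rev (ip t t0)).
  rewrite RintegralZl//; last exact: integrable_power.
  rewrite ler_wpM2l//; apply: (le_trans (Rintegral_power_le b0 t0)).
  rewrite ler_pM2r ?invr_gt0//; apply: ge0_ler_powR; rewrite ?nnegrE//; exact: ltW.
apply: lte_add_pinfty.
  apply: (@le_lt_trans _ _ (\int[leb]_(t in `[0%R, T]) (c * t `^ (beta - 1))%:E)%E).
    by apply: ge0_integral_le => t //=; rewrite in_itv/= => tT; rewrite lee_fin h1.
  by rewrite -ge0_fin_numE ?(integrable_fin_num _ (ip T T0))//; apply: integral_ge0 => t _;
    rewrite lee_fin mulr_ge0// powR_ge0.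
apply: (@le_lt_trans _ _ (\int[leb]_(t in `[0%R, T]) (c * (T `^ beta / beta))%:E)%E).
  apply: ge0_integral_le => t.
    by move=> _; apply: integral_ge0 => s _; rewrite lee_fin mulr_ge0.
  rewrite /= in_itv/= => /[dup] tT /andP[t0 tT'].
  apply: le_trans (bound t tT); apply: ge0_integral_le => s.
    by move=> _; rewrite lee_fin mulr_ge0.
  by rewrite /= in_itv/= => st; rewrite lee_fin h2.
rewrite integral_cst//= lte_mul_pinfty//.
  by rewrite lee_fin mulr_ge0// divr_ge0 ?powR_ge0// ltW.
exact: leb_itv0_lty.
Qed.

End Gamma_domain.

(** * Kernels with a power singularity at the origin *)

Section singular_kernel.
Variables (R : realType) (d : nat) (T : R) (K : R -> 'M[R]_d).
Local Notation leb := (@lebesgue_measure R).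
Local Notation k i j := (entry K i j).
Local Notation f i j := (entry (derive1 K) i j).
Hypothesis T0 : 0 < T.
Hypothesis dk : forall i j (u : R), 0 < u -> is_derive u (1 : R) (k i j) (f i j u).
Hypothesis cf : forall i j (u : R), 0 < u -> {for u, continuous (f i j)}.
Hypothesis K'_le0 : forall u : R, 0 < u -> mx_ge0 (- derive1 K u).
Variables (alpha eta N : R).
Hypothesis alpha0 : 0 < alpha <= 1.
Hypothesis eta1 : 1 - alpha < eta <= 1.
Hypothesis N0 : 0 <= N.
Hypothesis KN : forall u, 0 < u <= T -> `|K u| <= N * u `^ (alpha - 1).
Hypothesis K'N : forall u, 0 < u <= T -> `|derive1 K u| <= N * u `^ (alpha - 2).

Let beta := eta + alpha - 1.

Let T0' : 0 <= T. Proof. exact: ltW. Qed.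

Let beta0 : 0 < beta. Proof. by case/andP: eta1; rewrite /beta; lra. Qed.

Let eta0 : 0 < eta. Proof. by case/andP: eta1 => + _; case/andP: alpha0; lra. Qed.

Let kN i j u : 0 < u <= T -> `|k i j u| <= N * u `^ (alpha - 1).
Proof. by move=> /KN; apply: le_trans; exact: le_mx_norm. Qed.

Lemma powR_merge (u : R) : 0 < u -> u `^ (alpha - 2) * u `^ eta = u `^ (beta - 1).
Proof.
move=> u0; rewrite -powRD; first by congr (_ `^ _); rewrite /beta; ring.
by apply/implyP => _; rewrite gt_eqF.
Qed.

Lemma holder_clamp (z : R -> 'cV[R]_d) M u v : holder_bound T eta z M ->
  `|z (clamp T u) - z (clamp T v)| <= M * `|u - v| `^ eta.
Proof.
move=> zM; have M0 := holder_bound_ge0 T0' zM; case: zM => _ /(_ (lt0r_neq0 eta0)) h.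
apply: le_trans (h _ _ (clamp_itv _ T0') (clamp_itv _ T0')) _.
by rewrite ler_wpM2l// ge0_ler_powR ?nnegrE ?clamp_dist// ltW.
Qed.

Lemma holder_regular (z : R -> 'cV[R]_d) M : ucont_on T z -> z 0 = 0 ->
  holder_bound T eta z M -> regular T K beta (N * M) (fun u => z (clamp T u)).
Proof.
move=> uz z0 zM; have M0 := holder_bound_ge0 T0' zM; split.
- exact: ucont_clamp.
- by move=> u u0; rewrite clamp_le0.
move=> i j u s /[dup] uT /andP[u0 uT'] sT.
rewrite normrM -powR_merge//.
have h1 : `|f i j u| <= N * u `^ (alpha - 2).
  by apply: le_trans (K'N uT); exact: le_mx_norm.
have h2 : `|coord (fun u => z (clamp T u)) j (s - u) -
    coord (fun u => z (clamp T u)) j s| <= M * u `^ eta.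
  apply: (@le_trans _ _ `|z (clamp T (s - u)) - z (clamp T s)|).
    by have := le_mx_norm (z (clamp T (s - u)) - z (clamp T s)) j ord0; rewrite !mxE.
  apply: le_trans (holder_clamp _ _ zM) _.
  by rewrite addrAC subrr sub0r normrN gtr0_norm.
have -> : N * M * (u `^ (alpha - 2) * u `^ eta) = (N * u `^ (alpha - 2)) * (M * u `^ eta) by ring.
exact: ler_pM.
Qed.

(** The entries of -K' are dominated by its trace, and the trace integrates
    to a difference of values of K.  The bound of K' alone would lose a
    logarithm when alpha = 1. *)
Lemma variation_kernel_le h i j : 0 < h <= T ->
  \int[leb]_(u in `[h, T]) `|f i j u| <= 2 * d%:R * N * h `^ (alpha - 1).
Proof.
move=> /[dup] hT /andP[h0 hT'].
have ifh p q : leb.-integrable `[h, T] (EFin \o f p q) by exact: (integrable_pos T h0 (@cf p q)).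
have ifn : leb.-integrable `[h, T] (EFin \o (fun u => `|f i j u|)) by exact: integrable_norm.
have ifN l : leb.-integrable `[h, T] (EFin \o (fun u => (-1) * f l l u)) by exact: integrableRZ.
apply: (@le_trans _ _ (\int[leb]_(u in `[h, T]) (\sum_l (-1) * f l l u))).
  apply: le_Rintegral => //; first by apply: integrableR_sum.
  move=> u; rewrite /= in_itv/= => /andP[hu _].
  have := mx_ge0_entry_le i j (K'_le0 (lt_le_trans h0 hu)).
  rewrite mxE normrN => /le_trans; apply; apply: ler_sum => l _.
  by rewrite mxE mulN1r.
rewrite (Rintegral_sum _ _ ifN)//.
apply: (@le_trans _ _ (\sum_(l < d) 2 * N * h `^ (alpha - 1))); last first.
  by rewrite sumr_const card_ord -mulr_natl le_eqVlt; apply/orP; left; apply/eqP; ring.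
apply: ler_sum => l _; rewrite RintegralZl// (FTC_pos h0 hT' (@dk l l) (@cf l l)).
have := @kN l l h hT; have := @kN l l T; rewrite T0 lexx => /(_ isT).
have := @powR_subr1_le _ h T alpha h0 hT'; case/andP: alpha0 => _ -> /(_ isT).
move=> /(ler_wpM2l N0) p1 p2 p3.
have := ler_normB (k l l T) (k l l h); have := ler_norm (k l l h - k l l T).
rewrite distrC => q1 q2.
have -> : -1 * (k l l T - k l l h) = k l l h - k l l T by ring.
have -> : 2 * N * h `^ (alpha - 1) = N * h `^ (alpha - 1) + N * h `^ (alpha - 1) by ring.
apply: (le_trans q1); apply: (le_trans q2); apply: lerD => //.
exact: (le_trans p2 p1).
Qed.

Definition Gamma_const := d%:R * (N + 2 * (2 * d%:R * N) + 2 * (N / beta)).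

Lemma Gamma_const_ge0 : 0 <= Gamma_const.
Proof.
by rewrite /Gamma_const mulr_ge0// !addr_ge0 ?mulr_ge0 ?invr_ge0// ltW.
Qed.

Lemma Gammaop_clamp (z : R -> 'cV[R]_d) t : 0 <= t <= T ->
  Gammaop K z t = Gammaop K (fun u => z (clamp T u)) t.
Proof.
move=> /andP[t0 tT]; apply: Gammaop_eq => // s /andP[s0 st].
by rewrite clamp_id// s0 (le_trans st).
Qed.

(** The modulus of continuity with the cut at h equal to the distance of the
    two times, which balances both contributions. *)
Lemma Gamma_holder_modulus (z : R -> 'cV[R]_d) M t t' : ucont_on T z -> z 0 = 0 ->
  holder_bound T eta z M -> 0 <= t <= T -> 0 <= t' <= T ->
  `|Gammaop K z t - Gammaop K z t'| <= Gamma_const * M * `|t - t'| `^ beta.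
Proof.
move=> uz z0 zM tT t'T; have M0 := holder_bound_ge0 T0' zM.
have [->|tt'] := eqVneq t t'.
  by rewrite subrr normr0 mulr_ge0 ?powR_ge0// mulr_ge0// Gamma_const_ge0.
have rz := holder_regular uz z0 zM.
have NM0 : 0 <= N * M by rewrite mulr_ge0.
set h := `|t - t'|.
have h0 : 0 < h by rewrite normr_gt0 subr_eq0.
have hT : 0 < h <= T.
  rewrite h0/= ler_norml; case/andP: tT => *; case/andP: t'T => *.
  by apply/andP; split; lra.
rewrite (Gammaop_clamp z tT) (Gammaop_clamp z t'T).
apply: mx_norm_le => [|i j0]; first by rewrite mulr_ge0 ?powR_ge0// mulr_ge0// Gamma_const_ge0.
rewrite ord1 [X in `|X|]mxE [X in _ + X]mxE.
have := @regular_Gamma_modulus _ _ _ _ T0 dk cf _ _ _ beta0 NM0 rz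
  t t' h (M * h `^ eta) i tT t'T hT.
have yw u : 0 <= u <= T -> `|z (clamp T (t - u)) - z (clamp T (t' - u))| <= M * h `^ eta.
  move=> _; apply: le_trans (holder_clamp _ _ zM) _.
  by have -> : t - u - (t' - u) = t - t' by ring.
move=> /(_ yw)/le_trans; apply.
apply: (@le_trans _ _ (\sum_(j < d)
    (N + 2 * (2 * d%:R * N) + 2 * (N / beta)) * M * h `^ beta)); last first.
  rewrite sumr_const card_ord -mulr_natl le_eqVlt; apply/orP; left; apply/eqP.
  by rewrite /Gamma_const; ring.
apply: ler_sum => j _.
have hb : h `^ (alpha - 1) * h `^ eta = h `^ beta.
  rewrite -powRD; first by congr (_ `^ _); rewrite /beta; ring.
  by apply/implyP => _; rewrite gt_eqF.
have b1 : `|k i j T| + 2 * (\int[leb]_(u in `[h, T]) `|f i j u|) <=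
    (N + 2 * (2 * d%:R * N)) * h `^ (alpha - 1).
  rewrite [leRHS]mulrDl; apply: lerD.
    apply: le_trans (@kN i j T _) _; first by rewrite T0 lexx.
    rewrite ler_wpM2l// powR_subr1_le//; first by case/andP: hT.
    by case/andP: alpha0.
  by rewrite -mulrA ler_wpM2l// variation_kernel_le.
have Mh : 0 <= M * h `^ eta by rewrite mulr_ge0 ?powR_ge0.
have := ler_wpM2r Mh b1.
have -> : (N + 2 * (2 * d%:R * N)) * h `^ (alpha - 1) * (M * h `^ eta) =
  (N + 2 * (2 * d%:R * N)) * M * h `^ beta by rewrite -hb; ring.
have -> : (N + 2 * (2 * d%:R * N) + 2 * (N / beta)) * M * h `^ beta =
  (N + 2 * (2 * d%:R * N)) * M * h `^ beta + 2 * (N * M * (h `^ beta / beta)) by ring.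
by move=> b2; rewrite lerD2r.
Qed.

Lemma Gamma_holder0 (z : R -> 'cV[R]_d) : z 0 = 0 -> Gammaop K z 0 = 0.
Proof.
move=> z0; apply/colP => i; rewrite /Gammaop z0 mulmx0 add0r !mxE.
by rewrite set_itv1 Rintegral_set1.
Qed.

Lemma Gamma_holder_sup (z : R -> 'cV[R]_d) M t : ucont_on T z -> z 0 = 0 ->
  holder_bound T eta z M -> 0 <= t <= T ->
  `|Gammaop K z t| <= Gamma_const * T `^ beta * M.
Proof.
move=> uz z0 zM /[dup] tT /andP[t0 tT']; have M0 := holder_bound_ge0 T0' zM.
have := @Gamma_holder_modulus z M t 0 uz z0 zM tT.
rewrite lexx T0' Gamma_holder0// !subr0 ger0_norm// => /(_ isT)/le_trans; apply.
rewrite mulrAC ler_wpM2r// ler_wpM2l ?Gamma_const_ge0//.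
by rewrite ge0_ler_powR ?nnegrE// ltW.
Qed.

Lemma Gamma_holder_bound (z : R -> 'cV[R]_d) M : ucont_on T z -> z 0 = 0 ->
  holder_bound T eta z M ->
  holder_bound T beta (Gammaop K z) (Gamma_const * (1 + T `^ beta) * M).
Proof.
move=> uz z0 zM; have M0 := holder_bound_ge0 T0' zM.
have G0 := Gamma_const_ge0.
split=> [t tT|_ s t sT tT].
  apply: le_trans (Gamma_holder_sup uz z0 zM tT) _.
  by rewrite ler_wpM2r// ler_wpM2l// lerDr.
apply: le_trans (Gamma_holder_modulus uz z0 zM sT tT) _.
rewrite ler_wpM2r ?powR_ge0// ler_wpM2r// -[leLHS]mulr1 ler_wpM2l//.
by rewrite lerDl powR_ge0.
Qed.

Lemma holder0_GammaE (z : R -> 'cV[R]_d) : holder0_space T eta z ->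
  [/\ ucont_on T z, z 0 = 0 & exists2 M, 0 <= M & holder_bound T eta z M].
Proof.
move=> [/(holder_spaceP _ _ T0)[uz [M zM]] z0]; split => //; exists M => //.
exact: holder_bound_ge0 zM.
Qed.

Lemma holder0_Gamma_ucont (z : R -> 'cV[R]_d) : holder0_space T eta z ->
  ucont_on T (Gammaop K z).
Proof.
move=> /holder0_GammaE[uz z0 [M M0 zM]].
have NM0 : 0 <= N * M by rewrite mulr_ge0.
have := regular_Gamma_ucont T0 dk cf beta0 NM0 (holder_regular uz z0 zM).
by apply: ucont_on_eq => t tT; rewrite -Gammaop_clamp.
Qed.

Lemma holder0_Gamma_dom : @holder0_space R d T eta `<=` Gamma_dom K T.
Proof.
move=> z /holder0_GammaE[uz z0 [M M0 zM]].
have c0 : 0 <= (d%:R * T + 1) * (N * M) by rewrite mulr_ge0 ?mulr_ge0// addr_ge0// mulr_ge0.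
have zh := zM.2 (lt0r_neq0 eta0).
apply: (Gamma_dom_power T0 beta0 c0 uz).
- move=> t /andP[]; rewrite le_eqVlt => /predU1P[<- _|t0 tT].
    by rewrite z0 mulmx0 normr0 mulr_ge0// powR_ge0.
  apply: (le_trans (normr_mulmx_le _ _)).
  have h1 := KN (introT andP (conj t0 tT)).
  have h2 : `|z t| <= M * t `^ eta.
    have := zh t 0; rewrite z0 !subr0 gtr0_norm//; apply.
      by rewrite ltW.
    by rewrite lexx.
  have e1 : t `^ (alpha - 1) * t `^ eta = t * t `^ (beta - 1).
    rewrite mulr_powRB1// ?ltW// -powRD; first by congr (_ `^ _); rewrite /beta; ring.
    by apply/implyP => _; rewrite gt_eqF.
  have h3 : `|K t| * `|z t| <= N * M * (t * t `^ (beta - 1)).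
    apply: (le_trans (ler_pM _ _ h1 h2)) => //.
    by rewrite -e1 le_eqVlt; apply/orP; left; apply/eqP; ring.
  have h4 : N * M * (t * t `^ (beta - 1)) <= T * (N * M) * t `^ (beta - 1).
    have -> : N * M * (t * t `^ (beta - 1)) = t * (N * M * t `^ (beta - 1)) by ring.
    by rewrite -[leRHS]mulrA ler_wpM2r// !mulr_ge0// powR_ge0.
  rewrite -mulrA; apply: (@le_trans _ _ (d%:R * (T * (N * M) * t `^ (beta - 1)))).
    by rewrite ler_wpM2l// (le_trans h3 h4).
  have -> : d%:R * (T * (N * M) * t `^ (beta - 1)) = d%:R * T * (N * M * t `^ (beta - 1)) by ring.
  by rewrite -[leRHS]mulrA ler_wpM2r ?mulr_ge0 ?powR_ge0// lerDl.
- move=> t s /andP[s0]; rewrite le_eqVlt => /predU1P[-> _|st tT].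
    by rewrite !subrr normr0 mulr0 mulr_ge0// powR_ge0.
  have ts0 : 0 < t - s by rewrite subr_gt0.
  have h1 : `|derive1 K (t - s)| <= N * (t - s) `^ (alpha - 2).
    by apply: K'N; rewrite ts0/= lerBlDr (le_trans tT)// lerDl.
  have h2 : `|z s - z t| <= M * (t - s) `^ eta.
    have := zh s t; rewrite [X in X `^ _]distrC (gtr0_norm ts0); apply.
      by rewrite s0 (le_trans (ltW st)).
    by rewrite tT (le_trans s0 (ltW st)).
  apply: (le_trans (ler_pM _ _ h1 h2)) => //.
  have -> : N * (t - s) `^ (alpha - 2) * (M * (t - s) `^ eta) =
      N * M * (t - s) `^ (beta - 1) by rewrite -powR_merge//; ring.
  by rewrite ler_wpM2r ?powR_ge0// ler_peMl ?mulr_ge0// lerDr mulr_ge0.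
Qed.

Lemma holder0_Gamma_integrable (z : R -> 'cV[R]_d) t : holder0_space T eta z ->
  0 <= t <= T -> Gamma_integrable K z t.
Proof.
move=> /holder0_GammaE[uz z0 [M M0 zM]] /[dup] tT /andP[t0 tT'].
have NM0 : 0 <= N * M by rewrite mulr_ge0.
have [uc c0 cr] := holder_regular uz z0 zM.
apply: (Gamma_integrable_eq (x := fun u => z (clamp T u))) => //.
  by move=> s /andP[s0 st]; rewrite clamp_id// s0 (le_trans st).
move=> i j.
apply: (sGamma_integrable T0 (@cf i j) (ucont_coord j uc) beta0 NM0 _ tT).
by move=> u s; exact: cr.
Qed.

Lemma holder0_spaceB (x y : R -> 'cV[R]_d) : holder0_space T eta x ->
  holder0_space T eta y -> holder0_space T eta (fun t => y t - x t).
Proof.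
move=> [Ux x0] [Uy y0]; split; first exact: holder_spaceB.
by rewrite /= x0 y0 subr0.
Qed.

Lemma holder0_Gamma_C0 : continuous_linear_operator T
  (@holder0_space R d T eta) (holder_norm T eta) (@C0_space R d T) (sup_norm T) (Gammaop K).
Proof.
have -> : sup_norm T = @holder_norm R d T 0 by apply/funext => x; exact: sup_norm_holder0.
apply: (@bounded_linear_continuous _ _ _ _ _ _ _ _ (Gamma_const * T `^ beta)) => //.
- by rewrite mulr_ge0 ?powR_ge0 ?Gamma_const_ge0.
- move=> z Uz; split; first exact/C_space_ucont/holder0_Gamma_ucont.
  by apply: Gamma_holder0; case: Uz.
- exact: holder0_spaceB.
- move=> a x y Ux Uy t tT; apply: Gammaop_linear.
    exact: (holder0_Gamma_integrable Ux tT).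
  exact: (holder0_Gamma_integrable Uy tT).
- move=> z M /holder0_GammaE[uz z0 _] zM; split; last by rewrite eqxx.
  by move=> t tT; exact: Gamma_holder_sup.
Qed.

Lemma holder0_Gamma_holder : continuous_linear_operator T
  (@holder0_space R d T eta) (holder_norm T eta)
  (@holder0_space R d T beta) (holder_norm T beta) (Gammaop K).
Proof.
apply: (@bounded_linear_continuous _ _ _ _ _ _ _ _ (Gamma_const * (1 + T `^ beta))) => //.
- by rewrite mulr_ge0 ?addr_ge0 ?powR_ge0 ?Gamma_const_ge0.
- move=> z /[dup] Uz /holder0_GammaE[uz z0 [M M0 zM]].
  split; last exact: Gamma_holder0.
  apply/holder_spaceP => //; split; first exact: holder0_Gamma_ucont.
  by eexists; exact: Gamma_holder_bound zM.
- exact: holder0_spaceB.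
- move=> a x y Ux Uy t tT; apply: Gammaop_linear.
    exact: (holder0_Gamma_integrable Ux tT).
  exact: (holder0_Gamma_integrable Uy tT).
- by move=> z M /holder0_GammaE[uz z0 _] zM; exact: Gamma_holder_bound.
Qed.

Variable L : mx_measure R d.
Hypothesis resL : resolvent_first_kind K L.

Lemma holder0_Gamma_Zop (x : R -> 'cV[R]_d) t : C_space T x ->
  holder0_space T eta (Zop L x) -> 0 <= t <= T -> Gammaop K (Zop L x) t = x t - x 0.
Proof.
move=> /C_space_ucont ux /holder0_GammaE[uz z0 [M M0 zM]] tT.
have NM0 : 0 <= N * M by rewrite mulr_ge0.
exact: (Gamma_Zop T0 dk cf resL alpha0 N0 kN beta0 NM0 ux (holder_regular uz z0 zM)).
Qed.

Lemma holder0_Zop_Gamma (z : R -> 'cV[R]_d) t : holder0_space T eta z ->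
  0 <= t <= T -> Zop L (Gammaop K z) t = z t.
Proof.
move=> /holder0_GammaE[uz z0 [M M0 zM]] tT.
have NM0 : 0 <= N * M by rewrite mulr_ge0.
have h := Zop_Gamma T0 dk cf resL alpha0 N0 kN beta0 NM0 (holder_regular uz z0 zM) tT.
apply: (etrans _ (etrans h (congr1 z (clamp_id tT)))).
case/andP: tT => t0 tT; apply: (Zop_eq L t0) => s /andP[s0 st].
have sT : 0 <= s <= T by rewrite s0 (le_trans st).
exact (Gammaop_clamp z sT).
Qed.

End singular_kernel.

(** * Kernels continuously differentiable up to the origin *)

Section kernel_differentiable_at_origin.
Variables (R : realType) (d : nat) (K : R -> 'M[R]_d).

Lemma C1_quotient_near (K1 : R -> 'M[R]_d) (t e : R) :
  (fun s => (s - t)^-1 *: (K s - K t)) @ within `[0, +oo[ t^' --> K1 t ->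
  0 < e -> exists2 del : R, 0 < del & forall s, 0 <= s -> s != t ->
    `|s - t| < del -> `|K1 t - (s - t)^-1 *: (K s - K t)| < e.
Proof.
move=> /cvgrPdist_lt /(_ e) h e0; move: (h e0).
move=> /nbhs_ballP[del /= del0 hdel]; exists del => // s s0 st std.
apply: hdel => //=; first by rewrite /ball/= distrC.
by rewrite in_itv/= s0.
Qed.

(** The one-sided derivative of the definition agrees with the derivative at
    u > 0; at 0 the value of the latter is arbitrary, hence the additional
    term in the bound. *)
Lemma C1_Rplus_bounded (T : R) : 0 < T -> C1_Rplus K ->
  (forall u, 0 < u -> derivable K u 1) ->
  exists2 F : R, 0 <= F & forall u, 0 <= u <= T -> `|derive1 K u| <= F.
Proof.
move=> T0 [K1 cK1 hK1] dK.
have : ucont_on T K1.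
  apply: within_ucont_on; apply: continuous_subspaceW cK1.
  by move=> u; rewrite /= !in_itv/= => /andP[-> _].
move=> /ucont_on_bounded[F F0 K1F].
exists (F + `|derive1 K 0|); first by rewrite addr_ge0.
move=> u /andP[]; rewrite le_eqVlt => /predU1P[<- _|u0 uT]; first by rewrite lerDr.
suff -> : derive1 K u = K1 u by rewrite (le_trans (K1F u _)) ?lerDl// ltW.
apply/eqP; rewrite -subr_eq0 -normr_le0; apply/ler_addgt0Pl => e e0; rewrite addr0.
have e20 : 0 < e / 2 by rewrite divr_gt0.
have [del del0 hdel] := C1_quotient_near (hK1 u (ltW u0)) e20.
have cv : (fun h : R => h^-1 *: (K (h *: (1 : R) + u) - K u)) @ 0^' --> derive1 K u.
  by rewrite derive1E; exact: dK.
move/cvgrPdist_lt : cv => /(_ _ e20)/nbhs_ballP[del' /= del'0 hdel'].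
(* A step h for which both difference quotients are within e / 2. *)
pose h := Num.min del del' / 2.
have h0 : 0 < h by rewrite divr_gt0// lt_min del0.
have [hd hd'] : h < del /\ h < del'.
  have m0 : 0 < Num.min del del' by rewrite lt_min del0.
  have h1 : h < Num.min del del' by rewrite /h; lra.
  by apply/andP; rewrite -lt_min.
have := hdel (h + u) _ _ _; rewrite addrK gtr0_norm// => /(_ _ _ hd) H1.
have H1' := H1 (ltW (addr_gt0 h0 u0)) _.
have := hdel' h _ (lt0r_neq0 h0); rewrite /ball/= sub0r normrN gtr0_norm// => /(_ hd').
rewrite scaler1 => H2.
have := H1' _; rewrite -[X in _ == X]add0r (inj_eq (addIr _)) gt_eqF// => /(_ isT) H3.
have -> : derive1 K u - K1 u =
  (derive1 K u - h^-1 *: (K (h + u) - K u)) - (K1 u - h^-1 *: (K (h + u) - K u)).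
  by rewrite opprB addrA subrK.
apply: le_trans (ler_normB _ _) _; lra.
Qed.

Lemma C1_Rplus_right_continuous : C1_Rplus K ->
  forall e : R, 0 < e -> exists2 del : R, 0 < del &
    forall u, 0 < u < del -> `|K u - K 0| <= e.
Proof.
move=> [K1 _ hK1] e e0.
have [del del0 hdel] := C1_quotient_near (hK1 0 (lexx _)) ltr01.
have c0 : 0 < `|K1 0| + 1 by rewrite ltr_wpDl.
exists (Num.min del (e / (`|K1 0| + 1))); first by rewrite lt_min del0 divr_gt0.
move=> u /andP[u0]; rewrite lt_min => /andP[ud ue].
have := hdel u (ltW u0) (lt0r_neq0 u0); rewrite subr0 gtr0_norm// => /(_ ud) h.
have : `|u^-1 *: (K u - K 0)| <= `|K1 0| + 1.
  rewrite -[X in `|X|](subKr (K1 0)); apply: (le_trans (ler_normB _ _)).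
  by rewrite lerD2l ltW.
rewrite normrZ normfV gtr0_norm// mulrC ler_pdivrMr// => /le_trans; apply.
by rewrite mulrC -ler_pdivlMr// ltW.
Qed.

End kernel_differentiable_at_origin.

Section cauchy_schwarz.
Variable R : realType.
Local Notation leb := (@lebesgue_measure R).
Local Notation mfun_on D f :=
  (measurable_fun (D : set (measurableTypeR R)) (f : measurableTypeR R -> R)).

(** The discriminant of a nonnegative quadratic polynomial in c. *)
Lemma sqr_le_mul_of_quadratic (X P Q : R) : 0 <= P ->
  (forall c, 2 * c * X <= c ^+ 2 * P + Q) -> X ^+ 2 <= P * Q.
Proof.
move=> P0 h; move: P0; rewrite le_eqVlt => /predU1P[P0|P0].
  rewrite -P0 mul0r; have [->|X0] := eqVneq X 0; first by rewrite expr0n.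
  have := h ((Q + 1) / X); rewrite -P0 mulr0 add0r mulrA divfK//.
  have := h 0; rewrite -P0; lra.
have := h (X / P); have -> : (X / P) ^+ 2 * P = X ^+ 2 / P.
  by field; rewrite gt_eqF.
have -> : 2 * (X / P) * X = 2 * (X ^+ 2 / P) by ring.
move=> {}h; have : X ^+ 2 / P <= Q by lra.
by rewrite ler_pdivrMr// mulrC.
Qed.

(** Integrate (c f(t - s) - y(s))^2 >= 0. *)
Lemma conv_cauchy_schwarz (f y : R -> R) t F Y : mfun_on `[0, t] f -> mfun_on `[0, t] y ->
  (forall s, `[0, t]%classic s -> `|f s| <= F) ->
  (forall s, `[0, t]%classic s -> `|y s| <= Y) ->
  conv f y t ^+ 2 <=
    (\int[leb]_(s in `[0, t]) (f s ^+ 2)) * (\int[leb]_(s in `[0, t]) (y s ^+ 2)).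
Proof.
move=> mf my fF yY.
have ib g h G H : mfun_on `[0, t] g -> mfun_on `[0, t] h ->
    (forall s, `[0, t]%classic s -> `|g s| <= G) ->
    (forall s, `[0, t]%classic s -> `|h s| <= H) ->
    leb.-integrable `[0, t] (EFin \o (fun s => g s * h s)).
  move=> mg mh gG hH; apply: (integrable_bounded (M := G * H)) => //.
  - exact: leb_itv0_lty.
  - exact: measurable_funM.
  - by move=> s st; rewrite normrM ler_pM ?gG ?hH.
have mr := measurable_fun_rev mf.
have rF s : `[0, t]%classic s -> `|f (t - s)| <= F by move=> /rev_itv/fF.
have iff : leb.-integrable `[0, t] (EFin \o (fun s => f s ^+ 2)) by exact (ib f f F F mf mf fF fF).
have irr : leb.-integrable `[0, t] (EFin \o (fun s => f (t - s) ^+ 2))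
  by exact (ib _ _ F F mr mr rF rF).
have iyy : leb.-integrable `[0, t] (EFin \o (fun s => y s ^+ 2)) by exact (ib y y Y Y my my yY yY).
have iry : leb.-integrable `[0, t] (EFin \o (fun s => f (t - s) * y s))
  by exact (ib _ y F Y mr my rF yY).
apply: sqr_le_mul_of_quadratic => [|c]; first by apply: Rintegral_ge0 => s _; exact: sqr_ge0.
rewrite -(Rintegral_rev iff) /conv -!RintegralZl//.
have icr : leb.-integrable `[0, t] (EFin \o (fun s => c ^+ 2 * f (t - s) ^+ 2)).
  exact: integrableRZ.
have icy : leb.-integrable `[0, t] (EFin \o (fun s => 2 * c * (f (t - s) * y s))).
  exact: integrableRZ.
rewrite -(RintegralD _ icr iyy)//; apply: le_Rintegral => //.
  exact: (integrableRD _ icr iyy).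
move=> s _; move: (f (t - s)) (y s) => a b; rewrite -subr_ge0.
have -> : c ^+ 2 * a ^+ 2 + b ^+ 2 - 2 * c * (a * b) = (c * a - b) ^+ 2 by ring.
exact: sqr_ge0.
Qed.

End cauchy_schwarz.

Section differentiable_kernel.
Variables (R : realType) (d : nat) (T : R) (K : R -> 'M[R]_d).
Local Notation leb := (@lebesgue_measure R).
Local Notation mfun_on D f :=
  (measurable_fun (D : set (measurableTypeR R)) (f : measurableTypeR R -> R)).
Local Notation k i j := (entry K i j).
Local Notation f i j := (entry (derive1 K) i j).
Hypothesis T0 : 0 < T.
Hypothesis dk : forall i j (u : R), 0 < u -> is_derive u (1 : R) (k i j) (f i j u).
Hypothesis cK' : forall u : R, 0 < u -> {for u, continuous (derive1 K)}.
Variable F : R.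
Hypothesis F0 : 0 <= F.
Hypothesis K'F : forall u, 0 <= u <= T -> `|derive1 K u| <= F.
Hypothesis K0 : forall e : R, 0 < e -> exists2 del : R, 0 < del &
  forall u, 0 < u < del -> `|K u - K 0| <= e.

Let T0' : 0 <= T. Proof. exact: ltW. Qed.

Let cf i j (u : R) : 0 < u -> {for u, continuous (f i j)}.
Proof. by move=> /cK'; exact: continuous_coord. Qed.

Let fF i j u : 0 <= u <= T -> `|f i j u| <= F.
Proof. by move=> /K'F; apply: le_trans; exact: le_mx_norm. Qed.

Let mf i j t : mfun_on `[0, t] (f i j).
Proof. by apply: measurable_pos => u; exact: cf. Qed.

Let sub t : t <= T -> `[0, t]%classic `<=` `[0, T]%classic.
Proof. by move=> tT; apply: subset_itvl; rewrite bnd_simp. Qed.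

Let fFt i j t s : t <= T -> `[0, t]%classic s -> `|f i j s| <= F.
Proof. by move=> /sub h /h; rewrite /= in_itv/=; exact: fF. Qed.

Lemma kernel_derivative_integrable i j t : t <= T -> leb.-integrable `[0, t] (EFin \o f i j).
Proof.
move=> tT; apply: (integrable_bounded (M := F)) => //; first exact: leb_itv0_lty.
by move=> s; exact: fFt.
Qed.

(** The fundamental theorem on [s, u] with s > 0, then s -> 0. *)
Lemma kernel_FTC0 i j u : 0 <= u <= T ->
  \int[leb]_(s in `[0, u]) f i j s = k i j u - k i j 0.
Proof.
move=> /andP[]; rewrite le_eqVlt => /predU1P[<- _|u0 uT].
  by rewrite set_itv1 Rintegral_set1 subrr.
apply/eqP; rewrite -subr_eq0 -normr_le0; apply/ler_addgt0Pl => e e0; rewrite addr0.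
have e20 : 0 < e / 2 by rewrite divr_gt0.
have [del del0 hdel] := K0 e20.
have F10 : 0 < F + 1 by rewrite ltr_wpDl.
pose m := Num.min (Num.min del u) (e / 2 / (F + 1)).
have m0 : 0 < m by rewrite !lt_min del0 u0 divr_gt0.
pose s := m / 2; have s0 : 0 < s by rewrite divr_gt0.
have : s < m by rewrite /s; lra.
rewrite !lt_min => /andP[/andP[sd su] se].
have ifu := kernel_derivative_integrable i j uT.
have sT : s <= T by rewrite (le_trans (ltW su)).
have h1 : `|k i j s - k i j 0| <= e / 2.
  apply: le_trans (hdel s _); last by rewrite s0.
  by have := le_mx_norm (K s - K 0) i j; rewrite !mxE.
have h2 : `|\int[leb]_(r in `[0, s]) f i j r| <= F * s.
  rewrite -[X in _ * X]fine_leb_itv0 ?(ltW s0)//; apply: normr_Rintegral_le_cst => //.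
    exact: leb_itv0_lty.
  by move=> r; exact: fFt.
have h3 : F * s <= e / 2.
  apply: (@le_trans _ _ ((F + 1) * s)); first by rewrite ler_wpM2r ?lerDl// ltW.
  by rewrite mulrC -ler_pdivlMr// ltW.
have e1 : \int[leb]_(r in `[0, u]) f i j r =
    \int[leb]_(r in `[0, s]) f i j r + (k i j u - k i j s).
  rewrite -(FTC_pos s0 (ltW su) (@dk i j) (@cf i j)).
  rewrite -(@Rintegral_itv_obnd_cbnd _ s (BRight u)).
    rewrite -(@Rintegral_itvB _ _ _ (BRight u) s ifu) ?bnd_simp ?(ltW s0) ?(ltW su)//.
    by rewrite addrC subrK.
  apply: integrableS ifu => //; apply: subset_itv => //; rewrite bnd_simp; lra.
have -> : \int[leb]_(r in `[0, u]) f i j r - (k i j u - k i j 0) =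
  \int[leb]_(r in `[0, s]) f i j r - (k i j s - k i j 0) by rewrite e1; ring.
apply: (le_trans (ler_normB _ _)); rewrite (splitr e); apply: lerD => //.
exact: le_trans h2 h3.
Qed.

Lemma kernel_entry_lipschitz0 i j u : 0 <= u <= T -> `|k i j u - k i j 0| <= F * u.
Proof.
move=> /[dup] uT /andP[u0 uT']; rewrite -(kernel_FTC0 i j uT).
rewrite -[X in _ * X]fine_leb_itv0//; apply: normr_Rintegral_le_cst => //.
  exact: leb_itv0_lty.
by move=> r; exact: fFt.
Qed.

Lemma kernel_bounded u : 0 <= u <= T -> `|K u| <= `|K 0| + F * T.
Proof.
move=> /[dup] uT /andP[u0 uT']; apply: mx_norm_le => [|i j].
  by rewrite addr_ge0// mulr_ge0.
have -> : K u i j = K 0 i j + (k i j u - k i j 0) by rewrite addrC subrK.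
apply: (le_trans (ler_normD _ _)); apply: lerD; first exact: le_mx_norm.
by apply: le_trans (kernel_entry_lipschitz0 i j uT) _; rewrite ler_wpM2l.
Qed.

Lemma kernel_entry_ucont i j : ucont_on T (k i j).
Proof.
apply: (@ucont_on_eq _ _ _ (fun u => k i j 0 + \int[leb]_(s in `[0, u]) f i j s)).
  by move=> u uT; rewrite kernel_FTC0// addrC subrK.
move=> e e0; have F10 : 0 < F + 1 by rewrite ltr_wpDl.
exists (e / (F + 1)); first by rewrite divr_gt0.
have lip u v : 0 <= v <= T -> u <= v -> 0 <= u ->
    `|\int[leb]_(s in `[0, v]) f i j s - \int[leb]_(s in `[0, u]) f i j s| <= F * (v - u).
  move=> /andP[v0 vT] uv u0; have ifv := kernel_derivative_integrable i j vT.
  have e1 : leb `]u, v] = (v - u)%:E.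
    by rewrite lebesgue_measure_itv/= lte_fin; case: ltgtP uv => // ->; rewrite subrr.
  have e2 : (leb `]u, v]%classic < +oo)%E by rewrite e1 ltry.
  have s1 : `]u, v]%classic `<=` `[0, v]%classic.
    by apply: subset_itv => //; rewrite bnd_simp.
  rewrite (@Rintegral_itvB _ _ _ (BRight v) u ifv) ?bnd_simp//.
  have -> : v - u = fine (leb `]u, v]%classic) by rewrite e1.
  apply: normr_Rintegral_le_cst => //.
    exact: measurable_funS (@mf i j v).
  by move=> s /s1; exact: fFt.
move=> s t /andP[s0 sT] /andP[t0 tT] st.
have h : F * `|s - t| < e.
  apply: (@le_lt_trans _ _ ((F + 1) * `|s - t|)); first by rewrite ler_wpM2r ?lerDl.
  by rewrite mulrC -ltr_pdivlMr.
apply: le_lt_trans h; have -> : forall a b c : R, a + b - (a + c) = b - c by move=> *; ring.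
case: (leP s t) => [st'|/ltW st'].
  have -> : `|s - t| = t - s by rewrite distrC ger0_norm ?subr_ge0.
  by rewrite distrC lip// t0.
have -> : `|s - t| = s - t by rewrite ger0_norm ?subr_ge0.
by rewrite lip// s0.
Qed.

Section continuous_argument.
Variable z : R -> 'cV[R]_d.
Hypothesis uz : ucont_on T z.

Let y u := z (clamp T u) - z 0.

Let mz j t : t <= T -> mfun_on `[0, t] (coord z j).
Proof. by move=> /sub tT; apply: measurable_funS (ucont_on_measurable (ucont_on_coord j uz)). Qed.

(** As K' is bounded, a bound of the increments of y is enough. *)
Lemma C1_regular M : (forall t, 0 <= t <= T -> `|z t| <= M) ->
  regular T K 1 (F * (2 * M)) y.
Proof.
move=> zM; split.
- exact: shift_ucont.
- exact: shift_le0.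
move=> i j u s /andP[u0 uT] sT; rewrite subrr powRr0 mulr1 normrM ler_pM//.
  by rewrite fF// ltW.
have := le_mx_norm (y (s - u) - y s) j ord0.
rewrite /coord !mxE => /le_trans; apply.
rewrite /y opprB addrA subrK; apply: (le_trans (ler_normB _ _)).
by have := zM _ (clamp_itv (s - u) T0'); have := zM _ (clamp_itv s T0'); lra.
Qed.

Lemma C1_Gamma_integrable t : 0 <= t <= T -> Gamma_integrable K z t.
Proof.
move=> /andP[t0 tT] i j; have [M M0 zM] := ucont_on_bounded (ucont_on_coord j uz).
apply: (integrable_bounded (M := F * (M + M))) => //; first exact: leb_itv0_lty.
  have mr := measurable_fun_rev (@mf i j t).
  by apply: measurable_funM mr _; apply: measurable_funB => //; exact: mz.
move=> s st; rewrite normrM ler_pM//; first exact: (fFt i j tT (rev_itv st)).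
apply: (le_trans (ler_normB _ _)); apply: lerD; apply: zM; last by rewrite t0.
by move/(sub tT): st; rewrite /= in_itv.
Qed.

(** The integral of f over [0, t] turns k(t) into k(0). *)
Lemma C1_sGammaE i j t : 0 <= t <= T ->
  sGamma (k i j) (f i j) (coord z j) t = k i j 0 * coord z j t + conv (f i j) (coord z j) t.
Proof.
move=> /[dup] tT /andP[t0 tT']; rewrite /sGamma.
have ift := kernel_derivative_integrable i j tT'.
have ir := integrable_rev ift.
have [M M0 zM] := ucont_on_bounded (ucont_on_coord j uz).
have zb s : `[0, t]%classic s -> `|coord z j s| <= M.
  by move=> /(sub tT'); rewrite /= in_itv/=; exact: zM.
have [ifz _] := integrable_conv ift (mz j tT') zb.
transitivity (k i j t * coord z j t + \int[leb]_(s in `[0, t])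
    (f i j (t - s) * coord z j s - coord z j t * f i j (t - s))).
  by congr (_ + _); apply: eq_Rintegral => s _; ring.
have irz := integrableRZ (coord z j t) _ ir.
rewrite (RintegralB _ ifz (irz _))// (RintegralZl _ _ ir)// (Rintegral_rev ift).
rewrite (kernel_FTC0 i j tT) /conv; ring.
Qed.

Lemma C1_GammaE i t : 0 <= t <= T -> Gammaop K z t i ord0 =
  \sum_j (k i j 0 * coord z j t + conv (f i j) (coord z j) t).
Proof.
move=> tT; rewrite (Gammaop_sumE (C1_Gamma_integrable tT i)).
by apply: eq_bigr => j _; rewrite C1_sGammaE.
Qed.

(** A constant has no increments, so that Gamma maps z_0 to K z_0. *)
Lemma C1_Gamma_shift t : 0 <= t <= T ->
  Gammaop K z t = Gammaop K y t + K t *m z 0.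
Proof.
move=> /[dup] tT /andP[t0 tT'].
have uy : ucont_on T y by apply: ucont_sub; exact: shift_ucont.
have ic : Gamma_integrable K (fun=> z 0) t.
  move=> i j; apply: integrableR_eq (integrable0 _ _) => // s _.
  by rewrite /coord subrr mulr0.
have iy : Gamma_integrable K y t.
  apply: (Gamma_integrable_eq (x := fun s => (-1) *: z 0 + z s)) => //.
    move=> s /andP[s0 st]; rewrite /y clamp_id ?s0 ?(le_trans st)//.
    by rewrite scaleN1r addrC.
  move=> i j; apply: integrableR_eq (C1_Gamma_integrable tT i j) => // s _.
  by rewrite /coord !mxE; ring.
have -> : K t *m z 0 = Gammaop K (fun=> z 0) t.
  rewrite /Gammaop -[LHS]addr0; congr (_ + _); apply/colP => i; rewrite !mxE.
  rewrite (@eq_Rintegral _ _ _ leb _ (cst 0)); first by rewrite Rintegral_cst// mul0r.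
  by move=> s _; rewrite subrr mulmx0 mxE.
rewrite -[X in _ = X + _]scale1r -(Gammaop_linear 1 iy ic).
apply: (Gammaop_eq K t0) => s /andP[s0 st].
by rewrite /y scale1r subrK clamp_id// s0 (le_trans st).
Qed.

Lemma C1_Gamma_sup M t : (forall s, 0 <= s <= T -> `|z s| <= M) -> 0 <= t <= T ->
  `|Gammaop K z t| <= d%:R * (`|K 0| + F * T) * M.
Proof.
move=> zM /[dup] tT /andP[t0 tT'].
have M0 : 0 <= M by apply: le_trans (zM 0 _); rewrite ?lexx.
have zb j s : `[0, t]%classic s -> `|coord z j s| <= M.
  move=> /(sub tT'); rewrite /= in_itv/= => sT; apply: le_trans (zM _ sT).
  exact: le_mx_norm.
apply: mx_norm_le => [|i j]; first by rewrite !mulr_ge0// addr_ge0// mulr_ge0.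
rewrite ord1 C1_GammaE//; apply: (le_trans (ler_norm_sum _ _ _)).
apply: (@le_trans _ _ (\sum_(j < d) (`|K 0| + F * T) * M)); last first.
  by rewrite sumr_const card_ord -[leLHS]mulr_natl mulrA.
apply: ler_sum => l _; rewrite mulrDl; apply: (le_trans (ler_normD _ _)); apply: lerD.
  rewrite normrM ler_pM//; first exact: le_mx_norm.
  by apply: zb; rewrite /= in_itv/= t0 lexx.
have ift := kernel_derivative_integrable i l tT'.
apply: le_trans (normr_conv_le ift (mz l tT') M0 (zb l)) _.
rewrite mulrC ler_wpM2r//; apply: le_trans (ler_norm _) _.
have mn : mfun_on `[0, t] (fun u => `|f i l u|) by exact: measurableT_comp.
apply: (@le_trans _ _ (F * fine (leb `[0, t]%classic))).
  apply: normr_Rintegral_le_cst => //; first exact: leb_itv0_lty.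
  by move=> s st; rewrite normr_id (fFt _ _ tT').
by rewrite fine_leb_itv0// ler_wpM2l.
Qed.

Lemma norm_sqr_integrable (m n : nat) (A : R -> 'M[R]_(m, n)) t :
  mfun_on `[0, t] (fun s => `|A s|) ->
  (exists M, forall s, `[0, t]%classic s -> `|A s| <= M) ->
  leb.-integrable `[0, t] (EFin \o (fun s => `|A s| ^+ 2)).
Proof.
move=> mA [M AM]; apply: (integrable_bounded (M := M ^+ 2)) => //; first exact: leb_itv0_lty.
  exact: measurable_funX.
move=> s st; rewrite ger0_norm ?sqr_ge0// ler_sqr ?nnegrE ?AM//.
exact: le_trans (AM _ st).
Qed.

Lemma K'_sqr_integrable : leb.-integrable `[0, T] (EFin \o (fun r => `|derive1 K r| ^+ 2)).
Proof.
apply: norm_sqr_integrable; last by exists F => s; rewrite /= in_itv/=; exact: K'F.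
by apply: measurable_pos => u /cK' ck; apply: cvg_norm; exact: ck.
Qed.

Lemma z_sqr_integrable t : t <= T -> leb.-integrable `[0, t] (EFin \o (fun s => `|z s| ^+ 2)).
Proof.
move=> tT; apply: norm_sqr_integrable; last first.
  have [M M0 zM] := ucont_on_bounded uz.
  by exists M => s /(sub tT); rewrite /= in_itv/=; exact: zM.
apply: measurable_funS (ucont_on_measurable (T := T) _) => //; first exact: sub.
move=> e /uz[del del0 h]; exists del => // s r sT rT sr.
exact: le_lt_trans (ler_dist_dist _ _) (h _ _ sT rT sr).
Qed.

Lemma C1_conv_sqr_le i j t : 0 <= t <= T ->
  conv (f i j) (coord z j) t ^+ 2 <=
  (\int[leb]_(r in `[0, T]) (`|derive1 K r| ^+ 2)) *
  (\int[leb]_(s in `[0, t]) (`|z s| ^+ 2)).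
Proof.
move=> /[dup] tT /andP[t0 tT'].
have [M M0 zM] := ucont_on_bounded uz.
have zb s : `[0, t]%classic s -> `|coord z j s| <= M.
  move=> /(sub tT'); rewrite /= in_itv/= => sT; apply: le_trans (zM _ sT).
  exact: le_mx_norm.
have fb s : `[0, t]%classic s -> `|f i j s| <= F by exact: fFt.
apply: le_trans (conv_cauchy_schwarz (@mf i j t) (mz j tT') fb zb) _.
have sqr_ge0' (g : R -> R) D : 0 <= \int[leb]_(s in D) (g s ^+ 2).
  by apply: Rintegral_ge0 => s _; exact: sqr_ge0.
have iK := K'_sqr_integrable.
have iKt : leb.-integrable `[0, t] (EFin \o (fun r => `|derive1 K r| ^+ 2)).
  by apply: integrableS iK => //; exact: sub.
have ent (m n : nat) (A : 'M[R]_(m, n)) p q : A p q ^+ 2 <= `|A| ^+ 2.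
  by rewrite -[leLHS]real_normK ?num_real// ler_sqr ?nnegrE ?le_mx_norm.
have sqr_int (g : R -> R) G : mfun_on `[0, t] g ->
    (forall s, `[0, t]%classic s -> `|g s| <= G) ->
    leb.-integrable `[0, t] (EFin \o (fun s => g s ^+ 2)).
  move=> mg gG; apply: (integrable_bounded (M := G ^+ 2)) => //; first exact: leb_itv0_lty.
    exact: measurable_funX.
  move=> s st; rewrite normrX ler_sqr ?nnegrE ?gG//; exact: le_trans (gG _ st).
apply: ler_pM => //.
  apply: (@le_trans _ _ (\int[leb]_(s in `[0, t]) (`|derive1 K s| ^+ 2))).
    apply: le_Rintegral => //; first exact: (sqr_int _ F (@mf i j t) fb).
    by move=> s _; exact: ent.
  rewrite -subr_ge0 (@Rintegral_itvB _ _ _ (BRight T) t iK) ?bnd_simp//.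
apply: le_Rintegral => //; first exact: (sqr_int _ M (mz j tT') zb).
  exact: z_sqr_integrable.
by move=> s _; exact: ent.
Qed.

Lemma C1_Gamma_L2 t : 0 <= t <= T ->
  `|Gammaop K z t| ^+ 2 <= (2 * d%:R ^+ 2 + 1) * `|K 0| ^+ 2 * `|z t| ^+ 2 +
    (2 * d%:R ^+ 2 + 1) * (\int[leb]_(r in `[0, T]) (`|derive1 K r| ^+ 2)) *
    (\int[leb]_(s in `[0, t]) (`|z s| ^+ 2)).
Proof.
move=> tT; set P := \int[leb]_(r in _) _; set Q := \int[leb]_(s in _) _.
have P0 : 0 <= P by apply: Rintegral_ge0 => s _; exact: sqr_ge0.
have Q0 : 0 <= Q by apply: Rintegral_ge0 => s _; exact: sqr_ge0.
pose X := Num.sqrt (P * Q); have X0 : 0 <= X by exact: sqrtr_ge0.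
have X2 : X ^+ 2 = P * Q by rewrite sqr_sqrtr// mulr_ge0.
have convX i j : `|conv (f i j) (coord z j) t| <= X.
  by rewrite -ler_sqr ?nnegrE// X2 real_normK ?num_real// C1_conv_sqr_le.
pose A := `|K 0| * `|z t|; have A0 : 0 <= A by rewrite mulr_ge0.
have h : `|Gammaop K z t| <= d%:R * (A + X).
  apply: mx_norm_le => [|i j]; first by rewrite mulr_ge0// addr_ge0.
  rewrite ord1 C1_GammaE//; apply: (le_trans (ler_norm_sum _ _ _)).
  apply: (@le_trans _ _ (\sum_(j < d) (A + X))); last first.
    by rewrite sumr_const card_ord -[leLHS]mulr_natl.
  apply: ler_sum => l _; apply: (le_trans (ler_normD _ _)); apply: lerD => //.
  by rewrite normrM ler_pM ?le_mx_norm.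
have d0 : 0 <= (d%:R : R) by [].
have h2 : `|Gammaop K z t| ^+ 2 <= (d%:R * (A + X)) ^+ 2.
  by rewrite ler_sqr ?nnegrE// mulr_ge0// addr_ge0.
apply: (le_trans h2); rewrite exprMn.
have -> : (2 * d%:R ^+ 2 + 1) * `|K 0| ^+ 2 * `|z t| ^+ 2 + (2 * d%:R ^+ 2 + 1) * P * Q =
  (2 * d%:R ^+ 2 + 1) * (A ^+ 2 + X ^+ 2) by rewrite X2 /A; ring.
apply: (@le_trans _ _ (2 * d%:R ^+ 2 * (A ^+ 2 + X ^+ 2))); last first.
  by rewrite ler_wpM2r ?addr_ge0 ?sqr_ge0// lerDl.
rewrite -subr_ge0.
have -> : 2 * d%:R ^+ 2 * (A ^+ 2 + X ^+ 2) - d%:R ^+ 2 * (A + X) ^+ 2 =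
  d%:R ^+ 2 * (A - X) ^+ 2 by ring.
by rewrite mulr_ge0 ?sqr_ge0.
Qed.

Lemma C1_Gamma_dom : Gamma_dom K T z.
Proof.
have [M M0 zM] := ucont_on_bounded uz.
pose B := `|K 0| + F * T; have B0 : 0 <= B by rewrite addr_ge0// mulr_ge0.
have c0 : 0 <= d%:R * B * M + F * (2 * M) by rewrite addr_ge0// !mulr_ge0.
apply: (Gamma_dom_power T0 ltr01 c0 uz).
  move=> t tT; rewrite subrr powRr0 mulr1; apply: (le_trans (normr_mulmx_le _ _)).
  apply: (@le_trans _ _ (d%:R * B * M)); last by rewrite lerDl !mulr_ge0.
  by rewrite ler_pM ?mulr_ge0 ?zM// ler_wpM2l// kernel_bounded.
move=> t s /andP[s0 st] tT; rewrite subrr powRr0 mulr1.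
have sT : 0 <= s <= T by rewrite s0 (le_trans st).
have tT' : 0 <= t <= T by rewrite (le_trans s0).
apply: (@le_trans _ _ (F * (2 * M))); last by rewrite lerDr !mulr_ge0.
rewrite ler_pM//.
  by rewrite K'F// subr_ge0 st lerBlDr (le_trans tT)// lerDl.
apply: (le_trans (ler_normB _ _)); have := zM _ sT; have := zM _ tT'; lra.
Qed.

Lemma kernel_mul_ucont (v : 'cV[R]_d) : ucont_on T (fun t => K t *m v).
Proof.
apply: ucont_on_mx => i.
apply: (@ucont_on_eq _ _ _ (fun t => \sum_j (v j ord0 * k i j t))).
  by move=> t _; rewrite /coord mxE; apply: eq_bigr => j _; rewrite mulrC.
apply: ucont_on_sum => j e e0.
have c0 : 0 < `|v j ord0| + 1 by rewrite ltr_wpDl.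
have [del del0 h] := @kernel_entry_ucont i j (e / (`|v j ord0| + 1)) (divr_gt0 e0 c0).
exists del => // s t sT tT /(h _ _ sT tT); rewrite -mulrBr normrM ltr_pdivlMr// => h'.
by apply: le_lt_trans h'; rewrite mulrC ler_wpM2l// lerDl.
Qed.

Lemma C1_Gamma_ucont : ucont_on T (Gammaop K z).
Proof.
have [M M0 zM] := ucont_on_bounded uz.
have FM0 : 0 <= F * (2 * M) by rewrite !mulr_ge0.
have uG := regular_Gamma_ucont T0 dk cf ltr01 FM0 (C1_regular zM).
apply: (@ucont_on_eq _ _ _ (fun t => Gammaop K y t - (- (K t *m z 0)))).
  by move=> t tT; rewrite opprK C1_Gamma_shift.
apply: ucont_onB => //; apply: (@ucont_on_eq _ _ _ (fun t => K t *m (- z 0))).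
  by move=> t _; rewrite mulmxN.
exact: kernel_mul_ucont.
Qed.

End continuous_argument.

Lemma C1_Gamma_continuous_linear : continuous_linear_operator T
  (@C_space R d T) (sup_norm T) (@C_space R d T) (sup_norm T) (Gammaop K).
Proof.
have -> : sup_norm T = @holder_norm R d T 0 by apply/funext => x; exact: sup_norm_holder0.
apply: (@bounded_linear_continuous _ _ _ _ _ _ _ _ (d%:R * (`|K 0| + F * T))) => //.
- by rewrite mulr_ge0// addr_ge0// mulr_ge0.
- by move=> z /C_space_ucont/C1_Gamma_ucont/C_space_ucont.
- by move=> x y' /C_space_ucont ux /C_space_ucont uy; apply/C_space_ucont; exact: ucont_onB.
- move=> a x y' /C_space_ucont ux /C_space_ucont uy t tT; apply: Gammaop_linear.
    exact: C1_Gamma_integrable.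
  exact: C1_Gamma_integrable.
- move=> z M /C_space_ucont uz [zM _]; split; last by rewrite eqxx.
  by move=> t tT; exact: C1_Gamma_sup.
Qed.

Section resolvent.
Variable L : mx_measure R d.
Hypothesis resL : resolvent_first_kind K L.

Let N := `|K 0| + F * T.

Let N0 : 0 <= N. Proof. by rewrite addr_ge0// mulr_ge0. Qed.

Let kN i j u : 0 < u <= T -> `|k i j u| <= N * u `^ (1 - 1).
Proof.
move=> /andP[/ltW u0 uT]; rewrite subrr powRr0 mulr1.
by apply: le_trans (kernel_bounded (introT andP (conj u0 uT))); exact: le_mx_norm.
Qed.

Let one01 : 0 < (1 : R) <= 1. Proof. by rewrite ltr01 lexx. Qed.

Lemma C1_Gamma_Zop (x : R -> 'cV[R]_d) t : ucont_on T x -> 0 <= t <= T ->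
  Gammaop K (Zop L x) t = x t - x 0.
Proof.
move=> ux tT; have uZ : ucont_on T (Zop L x) by exact: Zop_ucont.
have [M M0 zM] := ucont_on_bounded uZ.
have FM0 : 0 <= F * (2 * M) by rewrite !mulr_ge0.
have := C1_regular uZ zM.
have -> : (fun u => Zop L x (clamp T u) - Zop L x 0) = (fun u => Zop L x (clamp T u)).
  by apply/funext => u; rewrite (Zop_at0 L T0) subr0.
move=> rz; exact: (Gamma_Zop T0 dk cf resL one01 N0 kN ltr01 FM0 ux rz).
Qed.

(** For t > 0 the resolvent equation gives (L * K)_t v = v; the value K(0) v
    at the time 0, subtracted in the definition of Z, gives the second term. *)
Lemma Zop_kernel (v : 'cV[R]_d) t : 0 < t <= T ->
  Zop L (fun s => K s *m v) t = v - mxm_val L `[0, t] *m (K 0 *m v).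
Proof.
move=> /andP[t0 tT]; apply/colP => i; rewrite Zop_sumE [RHS]mxE [X in _ + X]mxE.
have tT' : 0 <= t <= T by rewrite ltW.
set w := K 0 *m v.
have ikL l j : lbv_integrable (L i l) `[0, t] (fun s => k l j (t - s)).
  exact: (ucont_on_lbv_integrable (L i l) tT' (kernel_entry_ucont l j)).
have icst l (c : R) : lbv_integrable (L i l) `[0, t] (fun=> c).
  by apply: (@lbv_integrable_bounded _ _ _ _ `|c|).
have lcst l : lconv (L i l) (fun=> 1) t =
    fine (lbv_pos (L i l) `[0, t]) - fine (lbv_neg (L i l) `[0, t]).
  by rewrite /lconv /mconv !Rintegral_cst// !mul1r.
have lZ l j : lconv (L i l) (fun u => v j ord0 * k l j u) t = v j ord0 * lconv (L i l) (k l j) t.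
  have := @lconv_lin _ (L i l) t (v j ord0) (k l j) (fun=> 0) (ikL l j) (icst l 0).
  have -> : lconv (L i l) (fun=> 0) t = 0.
    by rewrite /lconv /mconv !Rintegral_cst// !mul0r subrr.
  by rewrite addr0 => <-; apply: eq_lconv => u _; rewrite addr0.
have iZ l j : lbv_integrable (L i l) `[0, t] (fun s => v j ord0 * k l j (t - s)).
  by case: (ikL l j) => h1 h2; split; exact: integrableRZ.
have iS l : lbv_integrable (L i l) `[0, t] (fun s => \sum_j v j ord0 * k l j (t - s)).
  by split; apply: integrableR_sum => // j; case: (iZ l j).
transitivity (\sum_l (- w l ord0 * lconv (L i l) (fun=> 1) t +
    \sum_j v j ord0 * lconv (L i l) (k l j) t)).
  apply: eq_bigr => l _; under [in RHS]eq_bigr do rewrite -lZ.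
  rewrite -(lconv_sum (a := fun j u => v j ord0 * k l j u) (iZ l)).
  rewrite -(@lconv_lin _ (L i l) t (- w l ord0) (fun=> 1)
    (fun u => \sum_j v j ord0 * k l j u) (icst l 1) (iS l)); apply: eq_lconv => u _.
  rewrite mulr1 [RHS]addrC; congr (_ - _).
  by rewrite /coord mxE; apply: eq_bigr => j _; rewrite mulrC.
rewrite big_split/= addrC exchange_big/=; congr (_ + _).
  under eq_bigr do rewrite -mulr_sumr (resolvent_LK resL _ _ t0).
  rewrite (bigD1 i)//= eqxx mulr1 big1 ?addr0// => j ji.
  by rewrite eq_sym (negbTE ji) mulr0.
rewrite !mxE -sumrN; apply: eq_bigr => l _.
by rewrite lcst [in RHS]mxE mulNr mulrC.
Qed.

(** Continuity from above of both parts, which are finite on [0, 1]. *)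
Lemma lbv_mass_right_continuous (nu : lbv_measure R) :
  (fun n => fine (lbv_pos nu `[0, harmonic n]) - fine (lbv_neg nu `[0, harmonic n])) @ \oo -->
  fine (lbv_pos nu `[0, 0]) - fine (lbv_neg nu `[0, 0]).
Proof.
have h (mu : {measure set (measurableTypeR R) -> \bar R}) :
    (forall t, (mu `[0%R, t] < +oo)%E) ->
    fine (mu `[0, harmonic n]) @[n --> \oo] --> fine (mu `[0, 0]).
  move=> muoo; apply: fine_cvg.
  rewrite fineK ?ge0_fin_numE//.
  have -> : `[0%R, 0%R]%classic = \bigcap_n `[0%R, (harmonic n : R)]%classic.
    apply/seteqP; split => u /=.
      rewrite in_itv/= => /andP[u0 u1] n _; rewrite /= in_itv/= u0.
      by rewrite (le_trans u1)// harmonic_ge0.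
    move=> hu; rewrite in_itv/=; have := hu 0%N I; rewrite /= in_itv/= => /andP[-> _]/=.
    rewrite leNgt; apply/negP => u0.
    have /cvgrPdist_lt/(_ _ u0)[n _ /(_ n (leqnn _))] := @cvg_harmonic R.
    rewrite sub0r normrN gtr0_norm ?harmonic_gt0// ltNge.
    by have := hu n I; rewrite /= in_itv/= => /andP[_ ->].
  apply: (@nonincreasing_cvg_mu _ (measurableTypeR R) R mu
    (fun n => `[0%R, (harmonic n : R)]%classic)).
  - exact: muoo.
  - by [].
  - exact: bigcap_measurable.
  - move=> n m nm; apply/subsetPset; apply: subset_itvl; rewrite bnd_simp.
    by rewrite lef_pV2 ?posrE// ler_nat.
apply: cvgB; apply: h => t; [exact: lbv_pos_fin|exact: lbv_neg_fin].
Qed.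

(** The resolvent equation says nothing at t = 0: there both sides are limits
    of their values at 1 / (n + 1). *)
Lemma Zop_kernel0 (v : 'cV[R]_d) t : 0 <= t <= T ->
  Zop L (fun s => K s *m v) t = v - mxm_val L `[0, t] *m (K 0 *m v).
Proof.
move=> /andP[]; rewrite le_eqVlt => /predU1P[<- _|t0 tT]; last first.
  by apply: Zop_kernel; rewrite t0.
rewrite (Zop_at0 L T0); apply/colP => i.
pose a n := (v - mxm_val L `[0, harmonic n] *m (K 0 *m v)) i ord0.
have : a @ \oo --> (v - mxm_val L `[0, 0] *m (K 0 *m v)) i ord0.
  rewrite /a [X in _ --> X]mxE [X in _ --> _ + X]mxE [X in _ --> _ - X]mxE.
  under eq_cvg do rewrite mxE [X in _ + X]mxE [X in _ - X]mxE.
  apply: cvgB; first exact: cvg_cst.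
  apply: cvg_big; first exact: add_continuous.
  move=> l _; apply: cvgMl; rewrite [X in _ --> X]mxE; under eq_cvg do rewrite mxE.
  exact: lbv_mass_right_continuous.
suff : a @ \oo --> (0 : R).
  by move=> a1 a2; rewrite mxE; exact: (cvg_unique _ a1 a2).
apply/cvgrPdist_lt => e e0.
have uK := kernel_mul_ucont v.
have [del del0 h] := Zop_ucont L T0 uK e0.
have m0 : 0 < Num.min del T by rewrite lt_min del0.
have /cvgrPdist_lt/(_ _ m0) := @cvg_harmonic R.
apply: filterS => n; rewrite sub0r normrN gtr0_norm ?harmonic_gt0// lt_min => /andP[nd nT].
have nT' : 0 < (harmonic n : R) <= T by rewrite harmonic_gt0 ltW.
rewrite sub0r normrN /a -(Zop_kernel v nT').
apply: le_lt_trans (le_mx_norm _ _ _) _.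
have := h (harmonic n) 0; rewrite (Zop_at0 L T0) !subr0; apply.
- by rewrite harmonic_ge0 ltW.
- by rewrite lexx.
- by rewrite gtr0_norm ?harmonic_gt0.
Qed.

Lemma C1_Zop_Gamma (z : R -> 'cV[R]_d) t : ucont_on T z -> 0 <= t <= T ->
  Zop L (Gammaop K z) t = z t - mxm_val L `[0, t] *m (K 0 *m z 0).
Proof.
move=> uz /[dup] tT /andP[t0 tT'].
have [M M0 zM] := ucont_on_bounded uz.
have FM0 : 0 <= F * (2 * M) by rewrite !mulr_ge0.
have rz := C1_regular uz zM.
have uG := regular_Gamma_ucont T0 dk cf ltr01 FM0 rz.
rewrite (Zop_eq L (y := fun s => 1 *: Gammaop K (fun u => z (clamp T u) - z 0) s + K s *m z 0) t0).
  rewrite (Zop_linear L 1 uG (kernel_mul_ucont _) tT) scale1r (Zop_kernel0 _ tT).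
  rewrite (Zop_Gamma T0 dk cf resL one01 N0 kN ltr01 FM0 rz tT) clamp_id//.
  by rewrite addrA subrK.
by move=> s /andP[s0 st]; rewrite scale1r; apply: (C1_Gamma_shift uz); rewrite s0 (le_trans st).
Qed.

End resolvent.

End differentiable_kernel.

(** * Completely monotone kernels *)

Section completely_monotone_kernel.
Variables (R : realType) (d : nat) (K : R -> 'M[R]_d).
Hypothesis cmK : completely_monotone K.

Lemma completely_monotone_derivable (u : R) : 0 < u -> derivable K u 1.
Proof. by move=> u0; case: cmK => _ + _; move=> /(_ 0%N u u0). Qed.

Lemma completely_monotone_derivative_continuous (u : R) : 0 < u ->
  {for u, continuous (derive1 K)}.
Proof.
move=> u0; apply: derivable_continuous_mx.
by case: cmK => _ + _; move=> /(_ 1%N u u0).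
Qed.

Lemma completely_monotone_derivative_le0 (u : R) : 0 < u -> mx_ge0 (- derive1 K u).
Proof.
by move=> u0; case: cmK => _ _ /(_ 1%N u u0); rewrite expr1 scaleN1r.
Qed.

(** The supremum is replaced by its maximum with 0 because it is -oo when
    the interval is empty. *)
Lemma power_kernel_bound (T alpha : R) :
  (ereal_sup [set (t `^ (1 - alpha) * `|K t| +
                   t `^ (2 - alpha) * `|derive1 K t|)%R%:E
             | t in `]0%R, T]] < +oo)%E ->
  exists2 N : R, 0 <= N & forall u, 0 < u <= T ->
    `|K u| <= N * u `^ (alpha - 1) /\ `|derive1 K u| <= N * u `^ (alpha - 2).
Proof.
set S := ereal_sup _ => Soo; exists (fine (Order.max 0%E S)).
  by apply: fine_ge0; rewrite le_max lexx.
move=> u uT; have mfin : Order.max 0%E S \is a fin_num.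
  by rewrite ge0_fin_numE ?gt_max ?Soo ?ltry// le_max lexx.
have h : u `^ (1 - alpha) * `|K u| + u `^ (2 - alpha) * `|derive1 K u| <=
    fine (Order.max 0%E S).
  rewrite -lee_fin fineK//; apply: (@le_trans _ _ S); last by rewrite le_max lexx orbT.
  by apply: ereal_sup_ubound; exists u => //=; rewrite in_itv.
case/andP: uT => u0 _.
have inv p q (A : R) : q = - p -> u `^ p * A <= fine (Order.max 0%E S) ->
    A <= fine (Order.max 0%E S) * u `^ q.
  by move=> -> pA; rewrite powRN ler_pdivlMr ?powR_gt0// mulrC.
split.
  apply: (inv (1 - alpha)); first by rewrite opprB.
  by apply: le_trans h; rewrite lerDl mulr_ge0// powR_ge0.
apply: (inv (2 - alpha)); first by rewrite opprB.
by apply: le_trans h; rewrite lerDr mulr_ge0// powR_ge0.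
Qed.

End completely_monotone_kernel.

Unset Implicit Arguments.

Theorem lemma2p1 (R : realType) (d : nat) (T : R) (K : R -> 'M[R]_d)
    (L : mx_measure R d) :
  0 < T ->
  integrable_mx `[0, T] K ->
  completely_monotone K ->
  (exists2 t0 : R, 0 < t0 & mx_gt0 (K t0)) ->
  resolvent_first_kind K L ->
  [/\ (* (a) *)
      forall eta : R, 0 <= eta <= 1 ->
        continuous_linear_operator T
          (@holder_space R d T eta) (holder_norm T eta)
          (@holder0_space R d T eta) (holder_norm T eta) (Zop L),
      (* (b) *)
      C1_Rplus K ->
      [/\ @C_space R d T `<=` Gamma_dom K T,
          continuous_linear_operator T
            (@C_space R d T) (sup_norm T) (@C_space R d T) (sup_norm T)
            (Gammaop K),
          exists2 C : R, 0 < C &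
            forall (t : R) (z : R -> 'cV[R]_d), 0 <= t <= T -> C_space T z ->
            `|Gammaop K z t| ^+ 2 <=
              C * `|K 0| ^+ 2 * `|z t| ^+ 2 +
              C * (\int[@lebesgue_measure R]_(r in `[0, T])
                     (`|derive1 K r| ^+ 2)) *
                  (\int[@lebesgue_measure R]_(s in `[0, t]) (`|z s| ^+ 2)),
          forall x : R -> 'cV[R]_d, C_space T x ->
            forall t : R, 0 <= t <= T -> Gammaop K (Zop L x) t = x t - x 0 &
          forall z : R -> 'cV[R]_d, C_space T z ->
            forall t : R, 0 <= t <= T ->
            (* the factor K 0 comes from Gamma_0(z) = K(0) z_0 *)
            Zop L (Gammaop K z) t = z t - mxm_val L `[0, t] *m (K 0 *m z 0)],
      (* (c) *)
      forall alpha : R, 1 / 2 < alpha <= 1 ->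
        (ereal_sup [set (t `^ (1 - alpha) * `|K t| +
                         t `^ (2 - alpha) * `|derive1 K t|)%R%:E
                   | t in `]0%R, T]] < +oo)%E ->
        forall eta : R, 1 - alpha < eta <= 1 ->
        [/\ @holder0_space R d T eta `<=` Gamma_dom K T,
            continuous_linear_operator T
              (@holder0_space R d T eta) (holder_norm T eta)
              (@C0_space R d T) (sup_norm T) (Gammaop K),
            forall x : R -> 'cV[R]_d, C_space T x ->
              holder0_space T eta (Zop L x) ->
              forall t : R, 0 <= t <= T -> Gammaop K (Zop L x) t = x t - x 0 &
            forall z : R -> 'cV[R]_d, holder0_space T eta z ->
              forall t : R, 0 <= t <= T -> Zop L (Gammaop K z) t = z t] &
      (* (d) *)
      forall alpha : R, 1 / 2 < alpha <= 1 ->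
        (ereal_sup [set (t `^ (1 - alpha) * `|K t| +
                         t `^ (2 - alpha) * `|derive1 K t|)%R%:E
                   | t in `]0%R, T]] < +oo)%E ->
        (ereal_sup [set (t `^ (3 - alpha) * `|derive1n 2 K t|)%R%:E
                   | t in `]0%R, T]] < +oo)%E ->
        forall eta : R, 1 - alpha < eta <= 1 ->
        continuous_linear_operator T
          (@holder0_space R d T eta) (holder_norm T eta)
          (@holder0_space R d T (eta + alpha - 1))
          (holder_norm T (eta + alpha - 1)) (Gammaop K)].
Proof.
move=> T0 _ cmK _ resL.
have cK' := completely_monotone_derivative_continuous cmK.
have dk i j (u : R) (u0 : 0 < u) := is_derive_coord i j (completely_monotone_derivable cmK u0).
have cf i j (u : R) : 0 < u -> {for u, continuous (entry (derive1 K) i j)}.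
  by move=> /cK'; exact: continuous_coord.
have K'le0 := completely_monotone_derivative_le0 cmK.
split.
- by move=> eta /andP[eta0 _]; exact: Zop_continuous_linear.
- move=> C1K.
  have [F F0 K'F] := C1_Rplus_bounded T0 C1K (completely_monotone_derivable cmK).
  have K0 := C1_Rplus_right_continuous C1K.
  split.
  + by move=> z /C_space_ucont; exact: (C1_Gamma_dom T0 dk cK' F0 K'F K0).
  + exact: (C1_Gamma_continuous_linear T0 dk cK' F0 K'F K0).
  + exists (2 * d%:R ^+ 2 + 1); first by rewrite ltr_wpDl// mulr_ge0 ?sqr_ge0.
    by move=> t z tT /C_space_ucont uz; exact: (C1_Gamma_L2 dk cK' F0 K'F K0).
  + move=> x /C_space_ucont ux t tT.
    exact: (C1_Gamma_Zop T0 dk cK' F0 K'F K0 resL).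
  + move=> z /C_space_ucont uz t tT.
    exact: (C1_Zop_Gamma T0 dk cK' F0 K'F K0 resL).
- move=> alpha /andP[alpha1 alpha2] /power_kernel_bound[N N0 KN] eta eta1.
  have alpha0 : 0 < alpha <= 1 by rewrite alpha2 andbT; lra.
  have KN1 u uT := (KN u uT).1; have KN2 u uT := (KN u uT).2.
  split.
  + exact: (holder0_Gamma_dom T0 alpha0 eta1 N0 KN1 KN2).
  + exact: (holder0_Gamma_C0 T0 dk cf K'le0 alpha0 eta1 N0 KN1 KN2).
  + move=> x Cx Hx t tT.
    exact: (holder0_Gamma_Zop T0 dk cf alpha0 eta1 N0 KN1 KN2 resL Cx Hx tT).
  + move=> z Hz t tT.
    exact: (holder0_Zop_Gamma T0 dk cf alpha0 eta1 N0 KN1 KN2 resL Hz tT).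
- move=> alpha /andP[alpha1 alpha2] /power_kernel_bound[N N0 KN] _ eta eta1.
  have alpha0 : 0 < alpha <= 1 by rewrite alpha2 andbT; lra.
  have KN1 u uT := (KN u uT).1; have KN2 u uT := (KN u uT).2.
  exact: (holder0_Gamma_holder T0 dk cf K'le0 alpha0 eta1 N0 KN1 KN2).
Qed.
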